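(* Let $n\ge1$. For any $n$-fold category $\mathbb D$, we have $N^n(\lambda_{\mathbb D})=\rho_{N^n(\mathbb D)}$ as morphisms $N^n(\Delta^{\boxtimes n}/N^n(\mathbb D))\to N^n(\mathbb D)$. In particular, $\lambda_{\mathbb D}:\Delta^{\boxtimes n}/N^n(\mathbb D)\to\mathbb D$ is a weak equivalence of $n$-fold categories.
   Context: $n$-fold categories: a $1$-fold category is a small category; for $n\ge2$ a (small, strict) $n$-fold category is a category object internal to the category of $(n-1)$-fold categories; $n$-fold functors are the internal functors, forming $\mathbf{nFoldCat}$. Equivalently, an $n$-fold category $\mathbb D$ consists of sets $\mathbb D_\epsilon$, $\epsilon\in\{0,1\}^n$ ($\mathbb D_{(0,\dots,0)}$ the objects, $\mathbb D_{(1,\dots,1)}$ the $n$-cubes), such that whenever $\epsilon,\epsilon'$ agree except $\epsilon_i=0,\epsilon'_i=1$, the pair $(\mathbb D_\epsilon,\mathbb D_{\epsilon'})$ is a category, and the structures in different directions commute (including the interchange law). For small categories $\mathbf C_i$, $\mathbf C_1\boxtimes\cdots\boxtimes\mathbf C_n$ is the $n$-fold category whose $\epsilon$-cubes are tuples $(x_1,\dots,x_n)$ with $x_i$ a morphism of $\mathbf C_i$ if $\epsilon_i=1$ and an object if $\epsilon_i=0$, with the structure in direction $i$ that of $\mathbf C_i$. The $n$-fold nerve is the multisimplicial set $(N^n\mathbb D)_{p_1,\dots,p_n}=\mathbf{nFoldCat}([p_1]\boxtimes\cdots\boxtimes[p_n],\mathbb D)$. An $n$-fold functor $F$ is a weak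 equivalence iff $\delta^*N^nF$ is a weak equivalence of simplicial sets, where $(\delta^*Y)_p=Y_{p,\dots,p}$. $n$-fold Grothendieck construction $\Delta^{\boxtimes n}/Y$ of a multisimplicial set $Y:(\Delta^{\times n})^{\mathrm{op}}\to\mathbf{Set}$: objects are pairs $(y,\overline k)$ with $\overline k=([k_1],\dots,[k_n])\in\Delta^{\times n}$ and $y\in Y_{\overline k}$. An $n$-cube with $(0,\dots,0)$-vertex $(y,\overline k)$ and $(1,\dots,1)$-vertex $(z,\overline\ell)$ is a morphism $\overline f=(f_1,\dots,f_n):\overline k\to\overline\ell$ in $\Delta^{\times n}$ with $\overline f^*(z)=y$; its $\epsilon$-vertex is $(f_1^{1-\epsilon_1},\dots,f_n^{1-\epsilon_n})^*(z)$, where $f^1=f$, $f^0=\mathrm{id}$. A morphism in direction $i$ is an $n$-cube with $f_j$ the identity for $j\ne i$; a square in direction $ii'$ is one with $f_j$ the identity for $j\neq i,i'$; etc. Composition is induced by composition in $\Delta$ in each coordinate. The morphism $\rho_Y:N^n(\Delta^{\boxtimes n}/Y)\to Y$: a $\overline p$-multisimplex of the source amounts to $n$ composable paths $[k^j_0]\to\cdots\to[k^j_{p_j}]$ in $\Delta$ ($1\le j\le n$) and $z\in Y_{k^1_{p_1},\dots,k^n_{p_n}}$ (the last vertex); each path induces $g_j:[p_j]\to[k^j_{p_j}]$ sending $i$ to the image of the last element $k^j_i\in[k^j_i]$ under the composite of the last $p_j-i$ maps, and $\rho_Y$ sends the multisimplex to $(g_1,\dots,g_n)^*(z)$. The $n$-fold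 functor $\lambda_{\mathbb D}:\Delta^{\boxtimes n}/N^n(\mathbb D)\to\mathbb D$ (''last vertex''): on objects, $\lambda_{\mathbb D}(y,\overline k)$ is the object $y(k_1,\dots,k_n)$ of $\mathbb D$, the last vertex of the array of $n$-cubes $y:[k_1]\boxtimes\cdots\boxtimes[k_n]\to\mathbb D$. On an $n$-cube $\overline f:(y,\overline k)\to(z,\overline\ell)$, $\lambda_{\mathbb D}$ is the $n$-cube $z(f_1(k_1)\le\ell_1,\dots,f_n(k_n)\le\ell_n)$ of $\mathbb D$, and similarly for lower-dimensional cubes. *)

(* Defs.v *)
From HB Require Import structures.
From mathcomp Require Import all_boot all_order all_algebra.
From mathcomp Require Import all_classical all_reals all_analysis.
From Stdlib Require Import Relation_Operators.

Set Implicit Arguments.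
Unset Strict Implicit.
Unset Printing Implicit Defensive.

Import Order.TTheory GRing.Theory Num.Theory.
Import numFieldNormedType.Exports.

Lemma fext (I : Type) (T : I -> Type) (f g : forall i, T i) :
  (forall i, f i = g i) -> f = g.
Proof. exact: functional_extensionality_dep. Qed.

(* A category with set of objects O and set of arrows A; [cmp] is in
   diagrammatic order. *)
Record cat_on (O A : Type) := CatOn {
  dom : A -> O;
  cod : A -> O;
  idc : O -> A;
  cmp : forall f g : A, cod f = dom g -> A;
  dom_idc : forall x, dom (idc x) = x;
  cod_idc : forall x, cod (idc x) = x;
  dom_cmp : forall f g (H : cod f = dom g), dom (cmp H) = dom f;
  cod_cmp : forall f g (H : cod f = dom g), cod (cmp H) = cod g;
  cmp_idl : forall x f (H : cod (idc x) = dom f), cmp H = f;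
  cmp_idr : forall x f (H : cod f = dom (idc x)), cmp H = f;
  cmpA : forall f g h (Hfg : cod f = dom g) (Hgh : cod g = dom h)
    (H1 : cod (cmp Hfg) = dom h) (H2 : cod f = dom (cmp Hgh)),
    cmp H1 = cmp H2
}.

Record functor_on (O A O' A' : Type) (C : cat_on O A) (D : cat_on O' A')
    (F0 : O -> O') (F1 : A -> A') : Prop := FunctorOn {
  fun_dom : forall f, dom D (F1 f) = F0 (dom C f);
  fun_cod : forall f, cod D (F1 f) = F0 (cod C f);
  fun_idc : forall x, F1 (idc C x) = idc D (F0 x);
  fun_cmp : forall f g (H : cod C f = dom C g)
    (H' : cod D (F1 f) = dom D (F1 g)), F1 (cmp H) = cmp H'
}.

Record small_cat := SmallCat {
  ob : Type;
  ar : Type;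
  str : cat_on ob ar
}.

Record cat_functor (C D : small_cat) := CatFunctor {
  fob : ob C -> ob D;
  far : ar C -> ar D;
  fstr : functor_on (str C) (str D) fob far
}.

Definition edge n (i : 'I_n) (e e' : 'I_n -> bool) : bool :=
  [&& ~~ e i, e' i & [forall j, (j != i) ==> (e j == e' j)]].

(* In a square

     e01 --i--> e11
      ^          ^
      j          j
      |          |
     e00 --i--> e10

   the directions i and j are automatically distinct. Compatibility of the two
   structures amounts to: source, target and identity in direction i are
   functors for the structures in direction j (for all i and j), and the
   interchange law. The composability hypotheses of the composites on the two
   sides of an equation follow from the other axioms; quantifying over their
   proofs is harmless, by proof irrelevance. *)
Record nfold_cat (n : nat) := NFoldCat {
  cell : ('I_n -> bool) -> Type;
  dir : forall i e e', edge i e e' -> cat_on (cell e) (cell e');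
  dom_functor : forall i j e00 e10 e01 e11 (i0 : edge i e00 e10)
    (i1 : edge i e01 e11) (j0 : edge j e00 e01) (j1 : edge j e10 e11),
    functor_on (dir j1) (dir j0) (dom (dir i0)) (dom (dir i1));
  cod_functor : forall i j e00 e10 e01 e11 (i0 : edge i e00 e10)
    (i1 : edge i e01 e11) (j0 : edge j e00 e01) (j1 : edge j e10 e11),
    functor_on (dir j1) (dir j0) (cod (dir i0)) (cod (dir i1));
  idc_functor : forall i j e00 e10 e01 e11 (i0 : edge i e00 e10)
    (i1 : edge i e01 e11) (j0 : edge j e00 e01) (j1 : edge j e10 e11),
    functor_on (dir j0) (dir j1) (idc (dir i0)) (idc (dir i1));
  interchange : forall i j e00 e10 e01 e11 (i0 : edge i e00 e10)
    (i1 : edge i e01 e11) (j0 : edge j e00 e01) (j1 : edge j e10 e11)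
    (a b c d : cell e11)
    (Hab : cod (dir i1) a = dom (dir i1) b)
    (Hcd : cod (dir i1) c = dom (dir i1) d)
    (Hac : cod (dir j1) a = dom (dir j1) c)
    (Hbd : cod (dir j1) b = dom (dir j1) d)
    (Hj : cod (dir j1) (cmp Hab) = dom (dir j1) (cmp Hcd))
    (Hi : cod (dir i1) (cmp Hac) = dom (dir i1) (cmp Hbd)),
    cmp Hj = cmp Hi
}.
Arguments dir {n} D {i e e'} : rename.

Record nfunctor n (C D : nfold_cat n) := NFunctor {
  fcell :> forall e, cell C e -> cell D e;
  fdir : forall i e e' (h : edge i e e'),
    functor_on (dir C h) (dir D h) (@fcell e) (@fcell e')
}.
Arguments fcell {n C D} F e x : rename.

Lemma nfunctor_eq n (C D : nfold_cat n) (F G : nfunctor C D) :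
  (forall e x, F e x = G e x) -> F = G.
Proof.
case: F G => [F HF] [G HG] /= E.
have {}E : F = G by apply: fext => e; apply: fext => x; exact: E.
by subst G; congr NFunctor; exact: Prop_irrelevance.
Qed.

Lemma functor_on_comp O A O' A' O'' A'' (C : cat_on O A) (D : cat_on O' A')
    (E : cat_on O'' A'') F0 F1 G0 G1 :
  functor_on C D F0 F1 -> functor_on D E G0 G1 ->
  functor_on C E (G0 \o F0) (G1 \o F1).
Proof.
move=> HF HG; split=> [f|f|x|f g H H'] /=.
- by rewrite (fun_dom HG) (fun_dom HF).
- by rewrite (fun_cod HG) (fun_cod HF).
- by rewrite (fun_idc HF) (fun_idc HG).
- have H1 : cod D (F1 f) = dom D (F1 g).
    by rewrite (fun_cod HF) (fun_dom HF) H.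
  by rewrite (fun_cmp HF H H1) (fun_cmp HG H1 H').
Qed.

Definition nfunctor_comp n (C D E : nfold_cat n) (G : nfunctor D E)
    (F : nfunctor C D) : nfunctor C E :=
  @NFunctor n C E (fun e x => G e (F e x))
    (fun i e e' h => functor_on_comp (fdir F h) (fdir G h)).

Section DiscreteCategory.
Variable X : Type.

Definition disc_cat : cat_on X X.
Proof. by refine (@CatOn X X id id id (fun f g _ => g) _ _ _ _ _ _ _). Defined.

End DiscreteCategory.

Section ProductCategory.
Variables (I : Type) (O A : I -> Type) (S : forall i, cat_on (O i) (A i)).

Definition prod_cat : cat_on (forall i, O i) (forall i, A i).
Proof.
refine (@CatOn _ _ (fun f i => dom (S i) (f i)) (fun f i => cod (S i) (f i))
  (fun x i => idc (S i) (x i))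
  (fun f g H i => cmp (f_equal (fun u : forall i, O i => u i) H))
  _ _ _ _ _ _ _).
- by move=> x; apply: fext => i; exact: dom_idc.
- by move=> x; apply: fext => i; exact: cod_idc.
- by move=> f g H; apply: fext => i; exact: dom_cmp.
- by move=> f g H; apply: fext => i; exact: cod_cmp.
- by move=> x f H; apply: fext => i; exact: cmp_idl.
- by move=> x f H; apply: fext => i; exact: cmp_idr.
- by move=> f g h Hfg Hgh H1 H2; apply: fext => i; exact: cmpA.
Defined.

End ProductCategory.

Lemma prod_functor (I : Type) (O A O' A' : I -> Type)
    (S : forall i, cat_on (O i) (A i)) (S' : forall i, cat_on (O' i) (A' i))
    (F0 : forall i, O i -> O' i) (F1 : forall i, A i -> A' i) :
  (forall i, functor_on (S i) (S' i) (F0 i) (F1 i)) ->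
  functor_on (prod_cat S) (prod_cat S')
    (fun x i => F0 i (x i)) (fun f i => F1 i (f i)).
Proof.
move=> H; split=> [f|f|x|f g K K']; apply: fext => i /=.
- exact: (fun_dom (H i)).
- exact: (fun_cod (H i)).
- exact: (fun_idc (H i)).
- exact: (fun_cmp (H i)).
Qed.

Definition bcell (C : small_cat) (b : bool) : Type := if b then ar C else ob C.

(* The structure on one coordinate: that of C if the coordinate goes from 0 to
   1, and the discrete one (tuples being composed coordinatewise, and only
   composable if they agree there) if the coordinate does not change. *)
Definition bdir (C : small_cat) (b b' : bool) :
    b ==> b' -> cat_on (bcell C b) (bcell C b') :=
  match b, b' return b ==> b' -> cat_on (bcell C b) (bcell C b') with
  | false, true => fun _ => str C
  | false, false => fun _ => disc_cat (ob C)
  | true, true => fun _ => disc_cat (ar C)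
  | true, false => fun h => False_rect _ (notF h)
  end.

Lemma edge_le n (i : 'I_n) e e' : edge i e e' -> forall j, e j ==> e' j.
Proof.
case/and3P=> Hi Hi' /forallP H j; case: (eqVneq j i) => [->|ne].
  by rewrite (negbTE Hi).
by move: (H j); rewrite ne /= => /eqP ->; exact: implybb.
Qed.

Lemma edge_sq n (i j : 'I_n) e00 e10 e01 e11 :
  edge i e00 e10 -> edge i e01 e11 -> edge j e00 e01 -> edge j e10 e11 ->
  forall k, (e00 k == e10 k) && (e01 k == e11 k) ||
            (e00 k == e01 k) && (e10 k == e11 k).
Proof.
case/and3P=> _ i0 /forallP Hi /and3P [_ _ /forallP Hi'].
case/and3P=> _ _ /forallP Hj /and3P [j1 _ /forallP Hj'] k.
case: (eqVneq k i) => [->|ne]; last first.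
  by move: (Hi k) (Hi' k); rewrite ne /= => -> ->.
have ne : i != j by apply/eqP => E; move: j1; rewrite -E i0.
by move: (Hj i) (Hj' i); rewrite ne /= => -> ->; rewrite orbT.
Qed.

Section BSquare.
Variable C : small_cat.
Variables b00 b10 b01 b11 : bool.
Hypothesis i0 : b00 ==> b10.
Hypothesis i1 : b01 ==> b11.
Hypothesis j0 : b00 ==> b01.
Hypothesis j1 : b10 ==> b11.
Hypothesis sq : (b00 == b10) && (b01 == b11) || (b00 == b01) && (b10 == b11).

Ltac bcases := move: b00 b10 b01 b11 i0 i1 j0 j1 sq; do 4!case=> //=.

Lemma bdom_functor : functor_on (bdir C j1) (bdir C j0)
  (dom (bdir C i0)) (dom (bdir C i1)).
Proof.
bcases=> i0' i1' j0' j1' _; split=> //= *.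
by apply: f_equal; exact: Prop_irrelevance.
Qed.

Lemma bcod_functor : functor_on (bdir C j1) (bdir C j0)
  (cod (bdir C i0)) (cod (bdir C i1)).
Proof.
bcases=> i0' i1' j0' j1' _; split=> //= *.
by apply: f_equal; exact: Prop_irrelevance.
Qed.

Lemma bidc_functor : functor_on (bdir C j0) (bdir C j1)
  (idc (bdir C i0)) (idc (bdir C i1)).
Proof.
bcases=> i0' i1' j0' j1' _; split=> //= *.
by apply: f_equal; exact: Prop_irrelevance.
Qed.

Lemma binterchange (a b c d : bcell C b11)
    (Hab : cod (bdir C i1) a = dom (bdir C i1) b)
    (Hcd : cod (bdir C i1) c = dom (bdir C i1) d)
    (Hac : cod (bdir C j1) a = dom (bdir C j1) c)
    (Hbd : cod (bdir C j1) b = dom (bdir C j1) d)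
    (Hj : cod (bdir C j1) (cmp Hab) = dom (bdir C j1) (cmp Hcd))
    (Hi : cod (bdir C i1) (cmp Hac) = dom (bdir C i1) (cmp Hbd)) :
  cmp Hj = cmp Hi.
Proof.
move: a b c d Hab Hcd Hac Hbd Hj Hi.
bcases=> i0' i1' j0' j1' _ a b c d Hab Hcd Hac Hbd Hj Hi; move: Hac Hbd Hi Hab Hcd Hj => /=.
- by move=> Hac Hbd Hi Hab Hcd Hj; subst; congr cmp; exact: Prop_irrelevance.
- by move=> Hac Hbd Hi Hab Hcd Hj; subst; congr cmp; exact: Prop_irrelevance.
Qed.

End BSquare.

Definition box n (C : 'I_n -> small_cat) : nfold_cat n.
Proof.
refine (@NFoldCat n (fun e => forall j, bcell (C j) (e j))
  (fun i e e' h => prod_cat (fun j => bdir (C j) (edge_le h j))) _ _ _ _).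
- move=> i j e00 e10 e01 e11 i0 i1 j0 j1.
  exact: (prod_functor (fun k => bdom_functor (C k) (edge_le i0 k) (edge_le i1 k)
    (edge_le j0 k) (edge_le j1 k) (edge_sq i0 i1 j0 j1 k))).
- move=> i j e00 e10 e01 e11 i0 i1 j0 j1.
  exact: (prod_functor (fun k => bcod_functor (C k) (edge_le i0 k) (edge_le i1 k)
    (edge_le j0 k) (edge_le j1 k) (edge_sq i0 i1 j0 j1 k))).
- move=> i j e00 e10 e01 e11 i0 i1 j0 j1.
  exact: (prod_functor (fun k => bidc_functor (C k) (edge_le i0 k) (edge_le i1 k)
    (edge_le j0 k) (edge_le j1 k) (edge_sq i0 i1 j0 j1 k))).
- move=> i j e00 e10 e01 e11 i0 i1 j0 j1 a b c d Hab Hcd Hac Hbd Hj Hi.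
  apply: fext => k.
  exact: (binterchange (edge_le i0 k) (edge_le j0 k) (edge_sq i0 i1 j0 j1 k)).
Defined.

Definition bmap (C D : small_cat) (F : cat_functor C D) (b : bool) :
    bcell C b -> bcell D b :=
  match b return bcell C b -> bcell D b with
  | true => far F
  | false => fob F
  end.

Lemma bmap_functor (C D : small_cat) (F : cat_functor C D) b b'
    (h : b ==> b') :
  functor_on (bdir C h) (bdir D h) (@bmap C D F b) (@bmap C D F b').
Proof. by case: b b' h => [] [] //= h; exact: fstr. Qed.

Definition box_map n (C D : 'I_n -> small_cat)
    (F : forall j, cat_functor (C j) (D j)) : nfunctor (box C) (box D) :=
  @NFunctor n (box C) (box D) (fun e x j => bmap (F j) (x j))
    (fun i e e' h => prod_functor (fun j => bmap_functor (F j) (edge_le h j))).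

Definition dmono k l (f : {ffun 'I_k.+1 -> 'I_l.+1}) : bool :=
  [forall a : 'I_k.+1, forall b : 'I_k.+1, (a <= b)%N ==> (f a <= f b)%N].

Record dhom (k l : nat) :=
  DHom { dfun :> {ffun 'I_k.+1 -> 'I_l.+1}; dfunP : dmono dfun }.

Lemma dhomP k l (f : dhom k l) (a b : 'I_k.+1) : (a <= b)%N -> (f a <= f b)%N.
Proof. by move=> ab; have /forallP/(_ a)/forallP/(_ b)/implyP/(_ ab) := dfunP f. Qed.

Lemma dhom_eq k l (f g : dhom k l) : (forall a, f a = g a :> nat) -> f = g.
Proof.
case: f g => [f Hf] [g Hg] /= E.
have {}E : f = g by apply/ffunP => a; apply: val_inj; exact: E.
by subst g; congr DHom; exact: bool_irrelevance.
Qed.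

Lemma mkdhom_subproof k l (f : 'I_k.+1 -> 'I_l.+1) :
  (forall a b : 'I_k.+1, (a <= b)%N -> (f a <= f b)%N) ->
  dmono [ffun a => f a].
Proof.
by move=> H; apply/forallP => a; apply/forallP => b; apply/implyP => ab;
   rewrite !ffunE; exact: H.
Qed.

Definition mkdhom k l (f : 'I_k.+1 -> 'I_l.+1)
    (H : forall a b : 'I_k.+1, (a <= b)%N -> (f a <= f b)%N) : dhom k l :=
  DHom (mkdhom_subproof H).

Definition did k : dhom k k := @mkdhom k k id (fun a b ab => ab).

Definition dcomp k l m (g : dhom l m) (f : dhom k l) : dhom k m :=
  mkdhom (fun a b ab => dhomP g (dhomP f ab)).

Definition dcast k l (E : k = l) : dhom k l := ecast x (dhom k x) E (did k).

Lemma didE k a : did k a = a.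
Proof. by rewrite ffunE. Qed.

Lemma dcompE k l m (g : dhom l m) (f : dhom k l) a : dcomp g f a = g (f a).
Proof. by rewrite ffunE. Qed.

Lemma dcastE k l (E : k = l) a : dcast E a = a :> nat.
Proof. by case: l / E => /=; rewrite ffunE. Qed.

Lemma dcast_id k (E : k = k) : dcast E = did k.
Proof. by apply: dhom_eq => a; rewrite dcastE didE. Qed.

Lemma dcompA k l m p (h : dhom m p) (g : dhom l m) (f : dhom k l) :
  dcomp h (dcomp g f) = dcomp (dcomp h g) f.
Proof. by apply: dhom_eq => a; rewrite !dcompE. Qed.

Lemma dcomp1f k l (f : dhom k l) : dcomp (did l) f = f.
Proof. by apply: dhom_eq => a; rewrite dcompE didE. Qed.

Lemma dcompf1 k l (f : dhom k l) : dcomp f (did k) = f.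
Proof. by apply: dhom_eq => a; rewrite dcompE didE. Qed.

Record darrow := DArrow { dsrc : nat; dtgt : nat; dmap : dhom dsrc dtgt }.

Definition dcmp (f g : darrow) (E : dtgt f = dsrc g) : darrow :=
  DArrow (dcomp (dmap g) (dcomp (dcast E) (dmap f))).

Definition Delta_str : cat_on nat darrow.
Proof.
refine (@CatOn nat darrow dsrc dtgt (fun k => DArrow (did k)) dcmp _ _ _ _ _ _ _)
  => //=.
- move=> k [k' l f] /= E; subst k'; rewrite /dcmp /=.
  by rewrite ?dcast_id !dcompf1.
- move=> l [k l' f] /= E; subst l; rewrite /dcmp /=.
  by rewrite ?dcast_id !dcomp1f.
- move=> [k l f] [l' m g] [m' p h] /= E1 E2; subst l' m'.
  by move=> E3 E4; rewrite /dcmp /= ?dcast_id !dcomp1f dcompA.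
Defined.

Definition Delta : small_cat := SmallCat Delta_str.

(* The category [k]; its arrows are the pairs a <= b. *)
Definition ordarrow (k : nat) : Type :=
  {ab : 'I_k.+1 * 'I_k.+1 | (ab.1 <= ab.2)%N}.

Definition mkordarrow k (a b : 'I_k.+1) (ab : (a <= b)%N) : ordarrow k :=
  exist (fun ab : 'I_k.+1 * 'I_k.+1 => (ab.1 <= ab.2)%N) (a, b) ab.

Lemma ordarrow_eq k (f g : ordarrow k) :
  (val f).1 = (val g).1 -> (val f).2 = (val g).2 -> f = g.
Proof.
by move=> E1 E2; apply: val_inj; move: E1 E2; case: (val f) (val g) => [a b] [c d] /= -> ->.
Qed.

Lemma ordcmp_subproof k (f g : ordarrow k) :
  (val f).2 = (val g).1 -> ((val f).1 <= (val g).2)%N.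
Proof. by move=> E; apply: leq_trans (valP f) _; rewrite E; exact: (valP g). Qed.

Definition ordcat_str (k : nat) : cat_on 'I_k.+1 (ordarrow k).
Proof.
refine (@CatOn 'I_k.+1 (ordarrow k) (fun f => (val f).1) (fun f => (val f).2)
  (fun a => mkordarrow (leqnn a))
  (fun f g E => mkordarrow (ordcmp_subproof E)) _ _ _ _ _ _ _) => //=.
- by move=> a f E; apply: ordarrow_eq.
- by move=> a f E; apply: ordarrow_eq.
- by move=> f g h E1 E2 E3 E4; apply: ordarrow_eq.
Defined.

Definition ordcat (k : nat) : small_cat := SmallCat (ordcat_str k).

Lemma ordmap_functor k l (f : dhom k l) :
  functor_on (ordcat_str k) (ordcat_str l) f
    (fun u => mkordarrow (dhomP f (valP u))).
Proof. by split=> //= *; apply: ordarrow_eq. Qed.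

Definition ordmap k l (f : dhom k l) : cat_functor (ordcat k) (ordcat l) :=
  @CatFunctor (ordcat k) (ordcat l) f
    (fun u => mkordarrow (dhomP f (valP u))) (ordmap_functor f).

Record msset (n : nat) := MSSet {
  mob :> ('I_n -> nat) -> Type;
  mact : forall k l, (forall j, dhom (k j) (l j)) -> mob l -> mob k;
  mact_id : forall k x, @mact k k (fun j => did (k j)) x = x;
  mact_comp : forall k l m (f : forall j, dhom (k j) (l j))
    (g : forall j, dhom (l j) (m j)) x,
    mact (fun j => dcomp (g j) (f j)) x = mact f (mact g x)
}.
Arguments mact {n} Y {k l} f x : rename.

Record msmap n (X Y : msset n) := MSMap {
  mfun :> forall k, X k -> Y k;
  mnat : forall k l (f : forall j, dhom (k j) (l j)) (x : X l),
    mfun (mact X f x) = mact Y f (mfun x)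
}.

Definition obox n (p : 'I_n -> nat) : nfold_cat n := box (fun j => ordcat (p j)).

Lemma ord_bcell_id k b (x : bcell (ordcat k) b) :
  bmap (ordmap (did k)) x = x.
Proof.
case: b x => x /=; last by rewrite didE.
by apply: ordarrow_eq; rewrite /= didE.
Qed.

Lemma ord_bcell_comp k l m (g : dhom l m) (f : dhom k l) b
    (x : bcell (ordcat k) b) :
  bmap (ordmap (dcomp g f)) x = bmap (ordmap g) (bmap (ordmap f) x).
Proof.
case: b x => x /=; last by rewrite dcompE.
by apply: ordarrow_eq; rewrite /= dcompE.
Qed.

Definition nerve n (D : nfold_cat n) : msset n.
Proof.
refine (@MSSet n (fun p => nfunctor (obox p) D)
  (fun p q f y => nfunctor_comp y (box_map (fun j => ordmap (f j)))) _ _).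
- move=> p y; apply: nfunctor_eq => e x /=; apply: (congr1 (y e)).
  by apply: fext => j; exact: ord_bcell_id.
- move=> p q r f g y; apply: nfunctor_eq => e x /=; apply: (congr1 (y e)).
  by apply: fext => j; exact: ord_bcell_comp.
Defined.

Lemma nerve_map_subproof n (C D : nfold_cat n) (F : nfunctor C D) p q
    (f : forall j, dhom (p j) (q j)) (y : nerve C q) :
  nfunctor_comp F (mact (nerve C) f y) =
  mact (nerve D) f (nfunctor_comp F y : nerve D q).
Proof. exact: nfunctor_eq. Qed.

Definition nerve_map n (C D : nfold_cat n) (F : nfunctor C D) :
    msmap (nerve C) (nerve D) :=
  @MSMap n (nerve C) (nerve D) (fun p y => nfunctor_comp F y)
    (@nerve_map_subproof n C D F).

Section Groth.
Variables (n : nat) (Y : msset n).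

Notation DBox := (box (fun _ : 'I_n => Delta)).

(* The last vertex of one coordinate of a cube. *)
Definition blast (b : bool) : bcell Delta b -> nat :=
  match b return bcell Delta b -> nat with
  | true => dtgt
  | false => id
  end.

Definition bdommap b b' (h : b ==> b') :
    forall c : bcell Delta b', dhom (blast (dom (bdir Delta h) c)) (blast c) :=
  match b, b' return forall (h : b ==> b') (c : bcell Delta b'),
      dhom (blast (dom (bdir Delta h) c)) (blast c) with
  | false, true => fun _ c => dmap c
  | false, false => fun _ c => did c
  | true, true => fun _ c => did (dtgt c)
  | true, false => fun h => False_rect _ (notF h)
  end h.

Lemma blast_cod b b' (h : b ==> b') (c : bcell Delta b') :
  blast (cod (bdir Delta h) c) = blast c.
Proof. by case: b b' h c => [] []. Qed.

Lemma blast_idc b b' (h : b ==> b') (c : bcell Delta b) :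
  blast (idc (bdir Delta h) c) = blast c.
Proof. by case: b b' h c => [] []. Qed.

Lemma blast_cmp b b' (h : b ==> b') (c d : bcell Delta b')
    (H : cod (bdir Delta h) c = dom (bdir Delta h) d) :
  blast (cmp H) = blast d.
Proof. by case: b b' h c d H => [] []. Qed.

(* The e-cubes: tuples consisting, in coordinate j, of a morphism f_j of Delta
   if e j = 1 and of an object (standing for f_j = id) if e j = 0, together
   with an element of Y over the last vertex. *)
Definition gcell (e : 'I_n -> bool) : Type :=
  {x : cell DBox e & Y (fun j => blast (x j))}.

Lemma gcell_eq e (c d : gcell e) (E : projT1 c = projT1 d) :
  (forall E' : forall j, blast (projT1 c j) = blast (projT1 d j),
     projT2 c = mact Y (fun j => dcast (E' j)) (projT2 d)) ->
  c = d.
Proof.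
case: c d E => [x z] [x' z'] /= E; subst x' => /(_ (fun=> erefl)) ->.
congr existT; rewrite -[RHS]mact_id.
by congr mact; apply: fext => j; exact: dcast_id.
Qed.

Lemma gcell_eqP e (c d : gcell e) : c = d ->
  forall E : forall j, blast (projT1 c j) = blast (projT1 d j),
  projT2 c = mact Y (fun j => dcast (E j)) (projT2 d).
Proof.
move=> -> E; rewrite -[LHS]mact_id.
by congr mact; apply: fext => j; rewrite ?dcast_id.
Qed.

Section Dir.
Variables (i : 'I_n) (e e' : 'I_n -> bool) (h : edge i e e').

Definition gdom (c : gcell e') : gcell e :=
  existT _ (dom (dir DBox h) (projT1 c))
    (mact Y (fun j => bdommap (edge_le h j) (projT1 c j)) (projT2 c)).

Definition gcod (c : gcell e') : gcell e :=
  existT _ (cod (dir DBox h) (projT1 c))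
    (mact Y (fun j => dcast (blast_cod (edge_le h j) (projT1 c j))) (projT2 c)).

Definition gidc (c : gcell e) : gcell e' :=
  existT _ (idc (dir DBox h) (projT1 c))
    (mact Y (fun j => dcast (blast_idc (edge_le h j) (projT1 c j))) (projT2 c)).

Definition gcmp (c d : gcell e') (H : gcod c = gdom d) : gcell e' :=
  let H1 := f_equal (@projT1 _ _) H in
  existT _ (cmp (c := dir DBox h) H1)
    (mact Y (fun j => dcast (blast_cmp (f_equal (fun u => u j) H1)))
      (projT2 d)).

End Dir.

Lemma bdommap_idc b b' (h : b ==> b') (c : bcell Delta b) a :
  bdommap h (idc (bdir Delta h) c) a = a :> nat.
Proof. by case: b b' h c a => [] [] h //= c a; rewrite didE. Qed.

Lemma bdommap_cmp b b' (h : b ==> b') (c d : bcell Delta b')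
    (H : cod (bdir Delta h) c = dom (bdir Delta h) d)
    (E : blast c = blast (dom (bdir Delta h) d))
    (a : 'I_(blast (dom (bdir Delta h) (cmp H))).+1)
    (a' : 'I_(blast (dom (bdir Delta h) c)).+1) :
  a = a' :> nat ->
  bdommap h (cmp H) a = bdommap h d (dcast E (bdommap h c a')) :> nat.
Proof.
case: b b' h c d H E a a' => [] [] h //=.
- move=> c d H E a a' Ha; subst d.
  by rewrite !didE dcastE.
- move=> [k l f] [l' m g] /= H; subst l'; move=> E a a' Ha.
  by rewrite /dcmp /= ?dcast_id (val_inj Ha) !ffunE.
- move=> c d H E a a' Ha; subst d.
  by rewrite !didE dcastE.
Qed.

Section GSquare.
Variables b00 b10 b01 b11 : bool.
Variables (i0 : b00 ==> b10) (i1 : b01 ==> b11).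
Variables (j0 : b00 ==> b01) (j1 : b10 ==> b11).
Hypothesis sq : (b00 == b10) && (b01 == b11) || (b00 == b01) && (b10 == b11).

Ltac bcases := move: b00 b10 b01 b11 i0 i1 j0 j1 sq; do 4!case=> //=.

Lemma bdommap_dom (c : bcell Delta b11)
    (a : 'I_(blast (dom (bdir Delta j0) (dom (bdir Delta i1) c))).+1)
    (a' : 'I_(blast (dom (bdir Delta i0) (dom (bdir Delta j1) c))).+1) :
  a = a' :> nat ->
  bdommap i1 c (bdommap j0 (dom (bdir Delta i1) c) a) =
  bdommap j1 c (bdommap i0 (dom (bdir Delta j1) c) a') :> nat.
Proof.
move: c a a'; bcases=> i0' i1' j0' j1' _ c a a' /val_inj ->; by rewrite ?didE.
Qed.

Lemma bdommap_cod (c : bcell Delta b11)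
    (a : 'I_(blast (dom (bdir Delta i1) c)).+1)
    (a' : 'I_(blast (dom (bdir Delta i0) (cod (bdir Delta j1) c))).+1) :
  a = a' :> nat ->
  bdommap i1 c a = bdommap i0 (cod (bdir Delta j1) c) a' :> nat.
Proof.
move: c a a'; bcases=> i0' i1' j0' j1' _ c a a' /val_inj ->; by rewrite ?didE.
Qed.

Lemma bdommap_idcf (c : bcell Delta b10)
    (a : 'I_(blast (dom (bdir Delta i1) (idc (bdir Delta j1) c))).+1)
    (a' : 'I_(blast (dom (bdir Delta i0) c)).+1) :
  a = a' :> nat ->
  bdommap i1 (idc (bdir Delta j1) c) a = bdommap i0 c a' :> nat.
Proof.
move: c a a'; bcases=> i0' i1' j0' j1' _ c a a' /val_inj ->; by rewrite ?didE.
Qed.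

Lemma bdommap_cmpf (c d : bcell Delta b11)
    (H : cod (bdir Delta j1) c = dom (bdir Delta j1) d)
    (a : 'I_(blast (dom (bdir Delta i1) (cmp H))).+1)
    (a' : 'I_(blast (dom (bdir Delta i1) d)).+1) :
  a = a' :> nat ->
  bdommap i1 (cmp H) a = bdommap i1 d a' :> nat.
Proof.
move: c d H a a'.
bcases=> i0' i1' j0' j1' _ c d H a a' /val_inj ->; by rewrite ?didE.
Qed.

End GSquare.

Lemma gcmp_snd i e e' (h : edge i e e') (c d : gcell e')
    (H : gcod h c = gdom h d) :
  exists E : forall j, blast (projT1 c j) =
                       blast (dom (bdir Delta (edge_le h j)) (projT1 d j)),
  projT2 c = mact Y (fun j => dcomp (bdommap (edge_le h j) (projT1 d j))
                                    (dcast (E j))) (projT2 d).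
Proof.
have E1 j := esym (blast_cod (edge_le h j) (projT1 c j)).
have E2 j : blast (cod (bdir Delta (edge_le h j)) (projT1 c j)) =
            blast (dom (bdir Delta (edge_le h j)) (projT1 d j)).
  by rewrite (f_equal (fun u => u j) (f_equal (@projT1 _ _) H) :
    cod (bdir Delta (edge_le h j)) (projT1 c j) = _).
exists (fun j => etrans (E1 j) (E2 j)).
have := gcell_eqP H E2 => /= /(congr1 (mact Y (fun j => dcast (E1 j)))).
rewrite -!mact_comp => K; rewrite -[LHS]mact_id; move: K.
set u := mact _ _ _; move=> K; set v := LHS; have -> : v = u.
  rewrite /u /v; congr mact; apply: fext => j; apply: dhom_eq => a.
  by rewrite didE dcompE !dcastE.
rewrite {u v}K; congr mact; apply: fext => j; apply: dhom_eq => a.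
rewrite !dcompE; congr (nat_of_ord (bdommap _ _ _)).
by apply: val_inj; rewrite /= !dcastE.
Qed.

Ltac gmact :=
  rewrite /= -?mact_comp; congr mact; apply: fext => ?; apply: dhom_eq => ?.

Definition gdir i e e' (h : edge i e e') : cat_on (gcell e) (gcell e').
Proof.
refine (@CatOn _ _ (gdom h) (gcod h) (gidc h) (@gcmp i e e' h) _ _ _ _ _ _ _).
- move=> c; apply: gcell_eq; first exact: (dom_idc (dir DBox h)).
  by move=> E; gmact; rewrite dcompE !dcastE bdommap_idc.
- move=> c; apply: gcell_eq; first exact: (cod_idc (dir DBox h)).
  by move=> E; gmact; rewrite dcompE !dcastE.
- move=> f g H; apply: gcell_eq; first exact: (dom_cmp (c := dir DBox h)).
  case: (gcmp_snd H) => E1 Ez E; rewrite /= Ez; gmact.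
  rewrite !dcompE dcastE; apply: bdommap_cmp.
  by rewrite dcastE.
- move=> f g H; apply: gcell_eq; first exact: (cod_cmp (c := dir DBox h)).
  by move=> E; gmact; rewrite !dcompE !dcastE.
- move=> x f H; apply: gcell_eq; first exact: (cmp_idl (c := dir DBox h)).
  by move=> E; gmact; rewrite !dcastE.
- move=> x f H; apply: gcell_eq; first exact: (cmp_idr (c := dir DBox h)).
  case: (gcmp_snd H) => E1 Ez E; rewrite /= Ez; gmact.
  by rewrite !dcompE !dcastE /= bdommap_idc !dcastE.
- move=> f g k Hfg Hgk H1 H2; apply: gcell_eq.
    exact: (cmpA (c := dir DBox h)).
  by move=> E; gmact; rewrite !dcompE !dcastE.
Defined.

Ltac gside sq := first
  [ by apply: edge_le; eassumption | exact: sq | by rewrite orbC; exact: sq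
  | by rewrite !dcastE ].

Lemma gdom_functor i j e00 e10 e01 e11 (i0 : edge i e00 e10)
    (i1 : edge i e01 e11) (j0 : edge j e00 e01) (j1 : edge j e10 e11) :
  functor_on (gdir j1) (gdir j0) (gdom i0) (gdom i1).
Proof.
have sq := edge_sq i0 i1 j0 j1; have B := @dom_functor n DBox i j _ _ _ _ i0 i1 j0 j1.
split=> [f|f|x|f g H H'] /=; apply: gcell_eq.
- exact: (fun_dom B).
- move=> E; gmact; rewrite !dcompE; apply: bdommap_dom; gside sq.
- exact: (fun_cod B).
- move=> E; gmact; rewrite !dcompE dcastE; apply: bdommap_cod; gside sq.
- exact: (fun_idc B).
- move=> E; gmact; rewrite !dcompE dcastE; apply: bdommap_idcf; gside sq.
- exact: (fun_cmp B).
- move=> E; gmact; rewrite !dcompE dcastE; apply: bdommap_cmpf; gside sq.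
Qed.

Lemma gcod_functor i j e00 e10 e01 e11 (i0 : edge i e00 e10)
    (i1 : edge i e01 e11) (j0 : edge j e00 e01) (j1 : edge j e10 e11) :
  functor_on (gdir j1) (gdir j0) (gcod i0) (gcod i1).
Proof.
have sq := edge_sq i0 i1 j0 j1; have B := @cod_functor n DBox i j _ _ _ _ i0 i1 j0 j1.
split=> [f|f|x|f g H H'] /=; apply: gcell_eq.
- exact: (fun_dom B).
- move=> E; gmact; rewrite !dcompE dcastE; apply: esym; apply: bdommap_cod; gside sq.
- exact: (fun_cod B).
- by move=> E; gmact; rewrite !dcompE !dcastE.
- exact: (fun_idc B).
- by move=> E; gmact; rewrite !dcompE !dcastE.
- exact: (fun_cmp B).
- by move=> E; gmact; rewrite !dcompE !dcastE.
Qed.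

Lemma gidc_functor i j e00 e10 e01 e11 (i0 : edge i e00 e10)
    (i1 : edge i e01 e11) (j0 : edge j e00 e01) (j1 : edge j e10 e11) :
  functor_on (gdir j0) (gdir j1) (gidc i0) (gidc i1).
Proof.
have sq := edge_sq i0 i1 j0 j1; have B := @idc_functor n DBox i j _ _ _ _ i0 i1 j0 j1.
split=> [f|f|x|f g H H'] /=; apply: gcell_eq.
- exact: (fun_dom B).
- move=> E; gmact; rewrite !dcompE dcastE; apply: bdommap_idcf; gside sq.
- exact: (fun_cod B).
- by move=> E; gmact; rewrite !dcompE !dcastE.
- exact: (fun_idc B).
- by move=> E; gmact; rewrite !dcompE !dcastE.
- exact: (fun_cmp B).
- by move=> E; gmact; rewrite !dcompE !dcastE.
Qed.

Definition groth : nfold_cat n.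
Proof.
refine (@NFoldCat n gcell gdir gdom_functor gcod_functor gidc_functor _).
move=> i j e00 e10 e01 e11 i0 i1 j0 j1 a b c d Hab Hcd Hac Hbd Hj Hi.
apply: gcell_eq; first exact: (@interchange n DBox i j _ _ _ _ i0 i1 j0 j1).
by move=> E; gmact; rewrite !dcompE !dcastE.
Defined.

End Groth.

(* On a morphism f : [k] -> [l] of Delta, the arrow f(k) <= l of [l]; on an
   object [k], the object k of [k]. *)
Definition blastcell (b : bool) :
    forall c : bcell Delta b, bcell (ordcat (blast c)) b :=
  match b return forall c : bcell Delta b, bcell (ordcat (blast c)) b with
  | true => fun c => mkordarrow (leq_ord (dmap c ord_max) :
                                  (dmap c ord_max <= @ord_max (dtgt c))%N)
  | false => fun k => @ord_max k
  end.

Lemma dcast_max k l (E : k = l) : dcast E ord_max = ord_max.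
Proof. by subst l; rewrite dcast_id didE. Qed.

Section BLast.
Variables (b b' : bool) (h : b ==> b').

Lemma blastcell_dom (c : bcell Delta b') :
  dom (bdir (ordcat _) h) (blastcell c) =
  bmap (ordmap (bdommap h c)) (blastcell (dom (bdir Delta h) c)).
Proof.
move: h c; case: b b' => [] [] //= h' c; last by rewrite didE.
by apply: ordarrow_eq; rewrite /= didE.
Qed.

Lemma blastcell_cod (c : bcell Delta b') :
  cod (bdir (ordcat _) h) (blastcell c) =
  bmap (ordmap (dcast (blast_cod h c))) (blastcell (cod (bdir Delta h) c)).
Proof.
move: h c; case: b b' => [] [] //= h' c; rewrite ?dcast_max //.
by apply: ordarrow_eq; apply: val_inj; rewrite /= dcastE.
Qed.

Lemma blastcell_idc (c : bcell Delta b) :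
  bmap (ordmap (dcast (blast_idc h c))) (blastcell (idc (bdir Delta h) c)) =
  idc (bdir (ordcat _) h) (blastcell c).
Proof.
move: h c; case: b b' => [] [] //= h' c; rewrite ?dcast_max //.
  by apply: ordarrow_eq; apply: val_inj; rewrite /= dcastE.
by apply: ordarrow_eq; apply: val_inj; rewrite /= dcastE ?ffunE.
Qed.

Variables (c d : bcell Delta b').
Hypothesis H : cod (bdir Delta h) c = dom (bdir Delta h) d.
Variable E : blast c = blast (dom (bdir Delta h) d).

Lemma blastcell_cmp0 :
  cod (bdir (ordcat _) h)
    (bmap (ordmap (dcomp (bdommap h d) (dcast E))) (blastcell c)) =
  dom (bdir (ordcat _) h) (blastcell d).
Proof.
move: h c d H E; case: b b' => [] [] //= h' c' d' H' E'.
- by subst d'; apply: ordarrow_eq; apply: val_inj; rewrite /= !ffunE dcastE.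
- by rewrite !ffunE dcast_max.
- by subst d'; rewrite !ffunE dcast_max.
Qed.

Lemma blastcell_cmp
    (P : cod (bdir (ordcat _) h)
      (bmap (ordmap (dcomp (bdommap h d) (dcast E))) (blastcell c)) =
      dom (bdir (ordcat _) h) (blastcell d)) :
  bmap (ordmap (dcast (blast_cmp H))) (blastcell (cmp H)) = cmp P.
Proof.
move: h c d H E P; case: b b' => [] [] //= h' c' d' H' E' P.
- by apply: ordarrow_eq; apply: val_inj; rewrite /= dcastE.
- apply: ordarrow_eq; apply: val_inj; rewrite /= dcastE //.
  case: c' d' H' E' P => [k l f] [l' m g] /= H'; subst l' => E' P.
  by rewrite !ffunE ?dcast_id !didE.
- by rewrite dcast_max.
Qed.

End BLast.

Section Lambda.
Variables (n : nat) (D : nfold_cat n).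

Definition lambda_cell (e : 'I_n -> bool) (c : cell (groth (nerve D)) e) :
    cell D e :=
  fcell (projT2 c : nfunctor (obox (fun j => blast (projT1 c j))) D)
    e (fun j => blastcell (projT1 c j)).

Lemma lambda_functor i e e' (h : edge i e e') :
  functor_on (dir (groth (nerve D)) h) (dir D h)
    (@lambda_cell e) (@lambda_cell e').
Proof.
split.
- move=> c; rewrite (fun_dom (fdir (projT2 c : nfunctor _ _) h)).
  apply: (congr1 (fcell (projT2 c : nfunctor _ _) e)).
  by apply: fext => j; exact: blastcell_dom.
- move=> c; rewrite (fun_cod (fdir (projT2 c : nfunctor _ _) h)).
  apply: (congr1 (fcell (projT2 c : nfunctor _ _) e)).
  by apply: fext => j; exact: blastcell_cod.
- move=> c; rewrite -(fun_idc (fdir (projT2 c : nfunctor _ _) h)).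
  apply: (congr1 (fcell (projT2 c : nfunctor _ _) e')).
  by apply: fext => j; exact: blastcell_idc.
- move=> c d H H'; case: (gcmp_snd H) => E Ez.
  pose u : cell (obox (fun j => blast (projT1 d j))) e' := fun j =>
    bmap (ordmap (dcomp (bdommap (edge_le h j) (projT1 d j)) (dcast (E j))))
      (blastcell (projT1 c j)).
  have Ec : lambda_cell c = fcell (projT2 d : nfunctor _ _) e' u.
    by rewrite /lambda_cell Ez.
  have P : cod (dir (obox _) h) u =
           dom (dir (obox _) h) (fun j => blastcell (projT1 d j)).
    by apply: fext => j; apply: blastcell_cmp0;
       exact: (f_equal (fun u => u j) (f_equal (@projT1 _ _) H)).
  move: H'; rewrite Ec => H'.
  rewrite -(fun_cmp (fdir (projT2 d : nfunctor _ _) h) P H').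
  apply: (congr1 (fcell (projT2 d : nfunctor _ _) e')).
  by apply: fext => j; exact: blastcell_cmp.
Qed.

Definition lambda : nfunctor (groth (nerve D)) D := NFunctor lambda_functor.

End Lambda.

(* A cell of one coordinate obtained from an arrow: the arrow itself if b = 1,
   and its target or source (according to s) if b = 0. *)
Definition bface (C : small_cat) (a : ar C) (b s : bool) : bcell C b :=
  match b return bcell C b with
  | true => a
  | false => if s then cod (str C) a else dom (str C) a
  end.

(* Objects of Delta are regarded as identities. *)
Definition barrow (b : bool) : bcell Delta b -> darrow :=
  match b return bcell Delta b -> darrow with
  | true => id
  | false => fun k => DArrow (did k)
  end.

Definition no_dir n : 'I_n -> bool := fun _ => false.
Definition one_dir n (j : 'I_n) : 'I_n -> bool := fun m => m == j.
Definition all_dir n : 'I_n -> bool := fun _ => true.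

Lemma edge_one n (j : 'I_n) : edge j (@no_dir n) (one_dir j).
Proof.
rewrite /edge /one_dir eqxx /=; apply/forallP => m; apply/implyP.
by move=> /negbTE ->.
Qed.

Lemma blast_barrow b (c : bcell Delta b) : dtgt (barrow c) = blast c.
Proof. by case: b c. Qed.

Section Rho.
Variables (n : nat) (Y : msset n).

Section Paths.
Variables (p : 'I_n -> nat) (F : nerve (groth Y) p).
Notation Fc := (fcell (F : nfunctor (obox p) (groth Y))).

Definition last_pt : cell (obox p) (@no_dir n) := fun j => @ord_max (p j).

Definition last_cell : gcell Y (@no_dir n) := Fc (@no_dir n) last_pt.

Definition last_k : 'I_n -> nat := projT1 last_cell.

Definition path_arrows (j : 'I_n) (u : ordarrow (p j)) :
    forall m, ordarrow (p m) :=
  eqtype.dfwith (fun m => mkordarrow (leqnn (@ord_max (p m)))) u.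

Lemma path_arrows_in j (u : ordarrow (p j)) : path_arrows u j = u.
Proof. exact: (eqtype.dfwith_in (fun m => mkordarrow (leqnn (@ord_max (p m)))) u). Qed.

Lemma path_arrows_out j (u : ordarrow (p j)) m : m != j ->
  path_arrows u m = mkordarrow (leqnn (@ord_max (p m))).
Proof. by move=> ne; rewrite /path_arrows dfwith_out // eq_sym. Qed.

(* The morphism in direction j from (p_1, .., a, .., p_n) to
   (p_1, .., b, .., p_n), for a <= b in [p_j]. *)
Definition path_cell (j : 'I_n) (u : ordarrow (p j)) :
    cell (obox p) (one_dir j) :=
  fun m => bface (C := ordcat (p m)) (path_arrows u m) (one_dir j m) true.

(* The j-th path of F, as a functor [p_j] -> Delta, on the arrow u. *)
Definition path_arrow (j : 'I_n) (u : ordarrow (p j)) : darrow :=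
  barrow (projT1 (Fc (one_dir j) (path_cell u)) j).

Definition to_max k (a : 'I_k.+1) : ordarrow k :=
  mkordarrow (leq_ord a : (a <= @ord_max k)%N).

Lemma path_cell_cod j (u : ordarrow (p j)) : (val u).2 = ord_max ->
  cod (dir (obox p) (edge_one j)) (path_cell u) = last_pt.
Proof.
move=> Hu; apply: fext => m; rewrite /= /path_cell /last_pt.
have : (val (path_arrows u m)).2 = ord_max.
  case: (eqVneq m j) => [->|ne]; first by rewrite path_arrows_in.
  by rewrite path_arrows_out.
by move: (edge_le _ _); case: (one_dir _ _).
Qed.

Lemma path_arrow_tgt j (u : ordarrow (p j)) : (val u).2 = ord_max ->
  dtgt (path_arrow u) = last_k j.
Proof.
move=> Hu; rewrite /path_arrow blast_barrow /last_k /last_cell.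
rewrite -(path_cell_cod Hu) -(fun_cod (fdir (F : nfunctor _ _) _)) /=.
by rewrite -(blast_cod (edge_le (edge_one j) j)).
Qed.

(* g_j(a) is the image of the last element of k^j_a under the composite
   k^j_a -> .. -> k^j_(p_j) of the j-th path, that is, under the image of the
   arrow a <= p_j by the path. *)
Definition path_last (j : 'I_n) (a : 'I_(p j).+1) : 'I_(last_k j).+1 :=
  dcast (path_arrow_tgt (erefl : (val (to_max a)).2 = ord_max))
    (dmap (path_arrow (to_max a)) ord_max).

Lemma path_arrow_cmp j (u v w : ordarrow (p j)) :
  (val u).2 = (val v).1 -> (val w).1 = (val u).1 -> (val w).2 = (val v).2 ->
  exists E, path_arrow w = @dcmp (path_arrow u) (path_arrow v) E.
Proof.
move=> Huv Hw1 Hw2.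
have P : cod (dir (obox p) (edge_one j)) (path_cell u) =
         dom (dir (obox p) (edge_one j)) (path_cell v).
  apply: fext => m; rewrite /= /path_cell.
  move: (edge_le _ _); rewrite /one_dir.
  case: (eqVneq m j) => [->|ne] h /=.
    by rewrite !path_arrows_in.
  by rewrite !path_arrows_out.
have W : cmp P = path_cell w.
  apply: fext => m; rewrite /path_cell /=; move: (f_equal _ _); rewrite /path_cell.
  move: (edge_le _ _); rewrite /one_dir.
  case: (eqVneq m j) => [->|ne] h /=.
    rewrite !path_arrows_in => Q.
    by apply: ordarrow_eq => /=.
  by rewrite !path_arrows_out.
have P' : cod (dir (groth Y) (edge_one j)) (Fc _ (path_cell u)) =
          dom (dir (groth Y) (edge_one j)) (Fc _ (path_cell v)).
  by rewrite (fun_cod (fdir (F : nfunctor _ _) _)) P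
             (fun_dom (fdir (F : nfunctor _ _) _)).
have := fun_cmp (fdir (F : nfunctor _ _) _) P P'; rewrite W => EW.
rewrite /path_arrow EW /=; move: (f_equal _ _).
move: (projT1 _) (projT1 _) => c d.
move: (edge_le _ _) (c j) (d j); rewrite /one_dir eqxx => h {}c {}d /= Q.
by exists Q.
Qed.

Lemma path_last_mono j (a b : 'I_(p j).+1) :
  (a <= b)%N -> (path_last a <= path_last b)%N.
Proof.
move=> ab; rewrite /path_last !dcastE.
have [E ->] := @path_arrow_cmp j (mkordarrow ab) (to_max b) (to_max a)
  erefl erefl erefl.
by rewrite /dcmp /= !ffunE; apply: dhomP; exact: leq_ord.
Qed.

Definition path_map (j : 'I_n) : dhom (p j) (last_k j) :=
  mkdhom (@path_last_mono j).

Definition rho_fun : Y p := mact Y path_map (projT2 last_cell).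

End Paths.

Definition bface_incl (f : darrow) (b s : bool) :
    dhom (blast (bface (C := Delta) f b s)) (dtgt f) :=
  match b return dhom (blast (bface (C := Delta) f b s)) (dtgt f) with
  | true => did (dtgt f)
  | false => match s return dhom (if s then dtgt f else dsrc f) (dtgt f) with
             | true => did (dtgt f)
             | false => dmap f
             end
  end.

Definition gface (f : 'I_n -> darrow) (z : Y (fun j => dtgt (f j)))
    (e s : 'I_n -> bool) : gcell Y e :=
  existT _ (fun j => bface (C := Delta) (f j) (e j) (s j))
    (mact Y (fun j => bface_incl (f j) (e j) (s j)) z).

Lemma bface_cod (C : small_cat) (a : ar C) b b' (h : b ==> b') s :
  (b == b') || s -> cod (bdir C h) (bface a b' s) = bface a b s.
Proof. by case: b b' h s => [] [] h []. Qed.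

Lemma bface_dom (C : small_cat) (a : ar C) b b' (h : b ==> b') s :
  (b == b') || ~~ s -> dom (bdir C h) (bface a b' s) = bface a b s.
Proof. by case: b b' h s => [] [] h []. Qed.

Lemma edge_eq (i : 'I_n) e e' (h : edge i e e') j : (e j == e' j) || (j == i).
Proof. by case/and3P: h => _ _ /forallP /(_ j); case: eqVneq; rewrite ?orbT ?orbF. Qed.

Lemma gface_cod f z i e e' (h : edge i e e') (s : 'I_n -> bool) : s i ->
  gcod h (@gface f z e' s) = gface z e s.
Proof.
move=> si; have C j : (e j == e' j) || s j.
  by case/orP: (edge_eq h j) => [->//|/eqP ->]; rewrite si orbT.
apply: gcell_eq; first by apply: fext => j; exact: bface_cod.
move=> E; rewrite /= -!mact_comp; congr mact; apply: fext => j; apply: dhom_eq => a.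
rewrite !dcompE; move: (E j) a (blast_cod _ _) (C j) => /=.
move: (edge_le h j); case: (e j) (e' j) (s j) => [] [] [] //= h' E1 a E2 _;
  by rewrite ?didE ?(dcast_id, dcastE) ?didE ?dcastE.
Qed.

Lemma gface_dom f z i e e' (h : edge i e e') (s : 'I_n -> bool) : ~~ s i ->
  gdom h (@gface f z e' s) = gface z e s.
Proof.
move=> si; have C j : (e j == e' j) || ~~ s j.
  by case/orP: (edge_eq h j) => [->//|/eqP ->]; rewrite si orbT.
apply: gcell_eq; first by apply: fext => j; exact: bface_dom.
move=> E; rewrite /= -!mact_comp; congr mact; apply: fext => j; apply: dhom_eq => a.
rewrite !dcompE; move: (E j) a (C j) => /=.
move: (edge_le h j); case: (e j) (e' j) (s j) => [] [] [] //= h' E1 a _;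
  by rewrite ?didE ?(dcast_id, dcastE) ?didE ?dcastE.
Qed.

Lemma gface_all f z s : @gface f z (@all_dir n) s = existT _ f z.
Proof.
rewrite /gface; congr existT.
exact: mact_id.
Qed.

(* An n-fold functor is determined on all the faces of a cube by its value on
   the cube. *)
Lemma fcell_face p (F : nfunctor (obox p) (groth Y))
    (a : forall j, ordarrow (p j)) e s :
  F e (fun j => bface (C := ordcat (p j)) (a j) (e j) (s j)) =
  gface (projT2 (F (@all_dir n) a)) e s.
Proof.
have [N] := ubnP #|[pred j | ~~ e j]|; elim: N e => // N IH e; rewrite ltnS => HN.
case: (pickP [pred j | ~~ e j]) => [i /= ei|He]; last first.
  have -> : e = @all_dir n by apply: fext => j; have /negbFE := He j.
  rewrite gface_all; by case: (F _ _).
pose e' := fun j => (j == i) || e j.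
have h : edge i e e'.
  rewrite /edge ei /e' eqxx /=; apply/forallP => j; apply/implyP.
  by move=> /negbTE ->.
have {HN}/IH E' : (#|[pred j | ~~ e' j]| < N)%N.
  apply: leq_trans HN; apply: proper_card; apply/fintype.properP; split.
    by apply/fintype.subsetP => j; rewrite !inE negb_or => /andP [].
  by exists i; rewrite !inE ?ei // /e' eqxx.
have C j : (e j == e' j) || (j == i) := edge_eq h j.
case: (boolP (s i)) => si.
- rewrite -(gface_cod _ h si) -E' -[gcod h _]/(cod (dir (groth Y) h) _).
  rewrite (fun_cod (fdir F h)); congr (F _ _); apply: fext => j /=.
  by rewrite bface_cod //; case/orP: (C j) => [->//|/eqP ->]; rewrite si orbT.
- rewrite -(gface_dom _ h si) -E' -[gdom h _]/(dom (dir (groth Y) h) _).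
  rewrite (fun_dom (fdir F h)); congr (F _ _); apply: fext => j /=.
  by rewrite bface_dom //; case/orP: (C j) => [->//|/eqP ->]; rewrite si orbT.
Qed.

Lemma barrow_bface f (b s : bool) : b -> barrow (bface (C := Delta) f b s) = f.
Proof. by case: b. Qed.

Lemma path_arrow_face p (F : nfunctor (obox p) (groth Y)) j
    (a : forall m, ordarrow (p m)) s :
  (forall m, m != j -> (val (a m)).2 = ord_max) ->
  barrow (projT1 (F (one_dir j) (fun m =>
    bface (C := ordcat (p m)) (a m) (one_dir j m) (s m))) j) =
  path_arrow F (a j).
Proof.
move=> Ha; rewrite fcell_face /= barrow_bface ?/one_dir //.
have -> : path_arrow F (a j) = barrow (projT1 (F (one_dir j) (fun m =>
    bface (C := ordcat (p m)) (a m) (one_dir j m) true)) j).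
  rewrite /path_arrow; congr (barrow (projT1 (F _ _) j)); apply: fext => m.
  rewrite /path_cell /one_dir; case: (eqVneq m j) => [->|ne] /=.
    by rewrite path_arrows_in.
  by rewrite path_arrows_out //= Ha.
by rewrite fcell_face /= barrow_bface ?/one_dir.
Qed.

Lemma cube_arrow p (F : nfunctor (obox p) (groth Y)) j
    (a : forall m, ordarrow (p m)) :
  (forall m, m != j -> (val (a m)).2 = ord_max) ->
  projT1 (F (@all_dir n) a) j = path_arrow F (a j).
Proof.
move=> Ha; rewrite -(path_arrow_face F (fun=> true) Ha) fcell_face /=.
by rewrite barrow_bface ?/one_dir.
Qed.

Lemma darrow_val (f g : darrow) (x : 'I_(dsrc f).+1) (y : 'I_(dsrc g).+1) :
  f = g -> x = y :> nat -> dmap f x = dmap g y :> nat.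
Proof. by move=> E; subst g => /val_inj ->. Qed.

Lemma darrow_max (f g : darrow) :
  f = g -> dmap f ord_max = dmap g ord_max :> nat.
Proof. by move=> E; subst g. Qed.

Lemma rho_natural p q (f : forall j, dhom (p j) (q j))
    (F : nerve (groth Y) q) :
  rho_fun (mact (nerve (groth Y)) f F) = mact Y f (rho_fun F).
Proof.
pose v j : 'I_(q j).+1 := f j ord_max.
pose a j := to_max (v j).
pose Q := fcell (F : nfunctor (obox q) (groth Y)) (@all_dir n) a.
have Qa j : projT1 Q j = path_arrow F (a j) by exact: cube_arrow.
have E0 : last_cell (mact (nerve (groth Y)) f F) =
    gface (projT2 Q) (@no_dir n) (fun=> false).
  exact: (fcell_face F a (@no_dir n) (fun=> false)).
have E1 : last_cell F = gface (projT2 Q) (@no_dir n) (fun=> true).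
  exact: (fcell_face F a (@no_dir n) (fun=> true)).
have K0 j : last_k (mact (nerve (groth Y)) f F) j = dsrc (projT1 Q j).
  by rewrite /last_k E0.
have K1 j : last_k F j = dtgt (projT1 Q j) by rewrite /last_k E1.
rewrite /rho_fun (gcell_eqP E0 K0) (gcell_eqP E1 K1) /= -!mact_comp.
congr mact; apply: fext => j; apply: dhom_eq => i.
rewrite !dcompE didE dcastE; rewrite [in RHS]ffunE /path_last dcastE.
pose G := mact (nerve (groth Y)) f F.
have EG : path_arrow G (to_max i) =
    path_arrow F (mkordarrow (dhomP (f j) (leq_ord i : (i <= @ord_max (p j))%N))).
  pose A := eqtype.dfwith a
    (mkordarrow (dhomP (f j) (leq_ord i : (i <= @ord_max (p j))%N))).
  have <- : A j = mkordarrow (dhomP (f j) (leq_ord i : (i <= @ord_max (p j))%N)).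
    by rewrite /A dfwith_in.
  rewrite -(@path_arrow_face _ F j A (fun=> false)); last first.
    by move=> m ne; rewrite /A dfwith_out 1?eq_sym.
  rewrite /path_arrow /G /=; congr (barrow (projT1 (fcell F _ _) j)).
  apply: fext => m; rewrite /path_cell /A /one_dir.
  case: (eqVneq m j) => [->|ne] /=.
    by rewrite dfwith_in path_arrows_in; apply: ordarrow_eq.
  by rewrite dfwith_out 1?eq_sym // path_arrows_out.
have [E ->] := @path_arrow_cmp _ F j
  (mkordarrow (dhomP (f j) (leq_ord i : (i <= @ord_max (p j))%N)))
  (a j) (to_max (f j i)) erefl erefl erefl.
rewrite /dcmp /= !ffunE.
apply: (darrow_val (Qa j)).
apply: etrans (dcastE (K0 j) _) _; apply: etrans (esym (dcastE E _)).
by apply: etrans (dcastE _ _) _; exact: darrow_max EG.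
Qed.

Definition rho : msmap (nerve (groth Y)) Y := MSMap rho_natural.

End Rho.

Record sset := SSet {
  sob :> nat -> Type;
  sact : forall k l, dhom k l -> sob l -> sob k;
  sact_id : forall k x, @sact k k (did k) x = x;
  sact_comp : forall k l m (f : dhom k l) (g : dhom l m) x,
    sact (dcomp g f) x = sact f (sact g x)
}.
Arguments sact X {k l} f x : rename.

Record smap (X Y : sset) := SMap {
  sfun :> forall k, X k -> Y k;
  snat : forall k l (f : dhom k l) (x : X l),
    sfun (sact X f x) = sact Y f (sfun x)
}.

Definition diag n (Y : msset n) : sset :=
  @SSet (fun k => Y (fun=> k)) (fun k l f => mact Y (fun=> f))
    (fun k x => mact_id x)
    (fun k l m f g x => mact_comp (fun=> f) (fun=> g) x).

Definition diag_map n (X Y : msset n) (F : msmap X Y) :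
    smap (diag X) (diag Y) :=
  @SMap (diag X) (diag Y) (fun k => F (fun=> k))
    (fun k l f x => mnat F (fun=> f) x).

Local Open Scope ring_scope.
Local Open Scope classical_set_scope.

Section WeakHomotopy.
Variable R : realType.

Definition cube (n : nat) : set 'rV[R]_n := [set t | forall i, 0 <= t ord0 i <= 1].

Arguments cube n : clear implicits.

Definition cube_boundary (n : nat) : set 'rV[R]_n :=
  [set t | cube n t /\ exists i, t ord0 i = 0 \/ t ord0 i = 1].

Arguments cube_boundary n : clear implicits.

(* The elements of pi_n(A, a) are the classes, for the relation
   [sphere_homotopic], of the functions satisfying [is_sphere]. For n = 0 the
   cube is a point with empty boundary, and one gets the path components. *)
Definition is_sphere (A : topologicalType) (a : A) n (u : 'rV[R]_n -> A) :=
  {within cube n, continuous u} /\ forall t, cube_boundary n t -> u t = a.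

Definition sphere_homotopic (A : topologicalType) (a : A) n
    (u v : 'rV[R]_n -> A) :=
  exists H : R * 'rV[R]_n -> A,
    [/\ {within `[0, 1] `*` cube n, continuous H},
        forall t, cube n t -> H (0, t) = u t,
        forall t, cube n t -> H (1, t) = v t &
        forall s t, s \in `[0, 1] -> cube_boundary n t -> H (s, t) = a].

Definition pi_injective (A B : topologicalType) (f : A -> B) n (a : A) :=
  forall u v : 'rV[R]_n -> A, is_sphere a u -> is_sphere a v ->
    sphere_homotopic (f a) (f \o u) (f \o v) -> sphere_homotopic a u v.

Definition pi_surjective (A B : topologicalType) (f : A -> B) n (a : A) :=
  forall v : 'rV[R]_n -> B, is_sphere (f a) v ->
    exists2 u, is_sphere a u & sphere_homotopic (f a) (f \o u) v.

(* Bijectivity on pi_0 at a base point does not see the case where A is empty,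
   whence the first clause. *)
Definition weak_homotopy_equiv (A B : topologicalType) (f : A -> B) :=
  [/\ continuous f,
      B -> inhabited A,
      forall n a, pi_injective f n a &
      forall n a, pi_surjective f n a].

End WeakHomotopy.

Section Realization.
Variable R : realType.

Definition simplex (m : nat) : set 'rV[R]_m.+1 :=
  [set t | (forall i, 0 <= t ord0 i) /\ \sum_i t ord0 i = 1].

Arguments simplex m : clear implicits.

Definition push k l (f : dhom k l) (t : 'rV[R]_k.+1) : 'rV[R]_l.+1 :=
  \row_b \sum_(a | f a == b) t ord0 a.

Lemma push_subproof k l (f : dhom k l) (t : simplex k) :
  push f (val t) \in simplex l.
Proof.
case: t => t /= /set_mem [t0 t1]; apply/mem_set; split=> [b|].
  by rewrite mxE; exact: sumr_ge0.
under eq_bigr do rewrite mxE.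
by rewrite -t1 [RHS](partition_big f predT).
Qed.

Definition simplex_map k l (f : dhom k l) (t : simplex k) : simplex l :=
  exist _ (push f (val t)) (push_subproof f t).

Section Space.
Variable X : sset.

(* The disjoint union of the X_k * simplex k, with X_k discrete. *)
Definition cells : Type := {classic {k & X k}}.
HB.instance Definition _ := Choice.on cells.

Definition prerealize : Type :=
  {c : cells & simplex (projT1 (c : {k & X k}))}.
HB.instance Definition _ := Topological.on prerealize.

Definition point_of k (x : X k) (t : simplex k) : prerealize :=
  existT _ (existT _ k x : cells) t.

Inductive glue : prerealize -> prerealize -> Prop :=
  Glue k l (f : dhom k l) (x : X l) (t : simplex k) :
    glue (point_of (sact X f x) t) (point_of x (simplex_map f t)).

Definition glued (p q : prerealize) : bool :=
  `[< clos_refl_sym_trans prerealize glue p q >].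

Lemma glued_equiv : equiv_class_of glued.
Proof.
split.
- by move=> p; apply/asboolP; exact: rst_refl.
- by move=> p q; apply/asboolP/asboolP => H; exact: rst_sym.
- move=> q p r /asboolP H1 /asboolP H2; apply/asboolP; exact: rst_trans H1 H2.
Qed.

Canonical glued_rel := EquivRelPack glued_equiv.

Definition realization : topologicalType :=
  quotient_topology {eq_quot glued_rel}%qT.

Definition realization_pi (p : prerealize) : realization :=
  \pi_({eq_quot glued_rel}%qT)%qT p.

End Space.

Section Map.
Variables (X Y : sset) (F : smap X Y).

Definition prerealize_map (p : prerealize X) : prerealize Y :=
  point_of (F _ (projT2 (projT1 p : {k & X k}))) (projT2 p).

Definition realize_map (q : realization X) : realization Y :=
  realization_pi (prerealize_map (repr q)).

Lemma realize_map_pi (p : prerealize X) :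
  realize_map (realization_pi p) = realization_pi (prerealize_map p).
Proof.
have H (u v : prerealize X) : clos_refl_sym_trans _ (@glue X) u v ->
    realization_pi (prerealize_map u) = realization_pi (prerealize_map v).
  elim=> // [_ _ [k l f x t]|u' v' w' _ -> _ ->] //.
  apply/eqmodP; apply/asboolP; apply: rst_step.
  by rewrite /prerealize_map /= snat; exact: Glue.
apply: H; apply/asboolP; apply: (introT (b := glued _ _) idP).
apply/(@eqmodP _ (glued_rel X)); exact: reprK.
Qed.

Lemma realize_map_continuous : continuous realize_map.
Proof.
apply/quotient_continuous.
have -> : realize_map \o \pi_(realization X)%qT =
          @realization_pi Y \o prerealize_map.
  by apply: fext => p; exact: realize_map_pi.
move=> p; apply: continuous_comp; last exact: pi_continuous.
by case: p => c t U /= H; exact: H.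
Qed.

End Map.
End Realization.

(* [R] is the field of real numbers used for geometric realization. *)
Definition sset_weq (R : realType) (X Y : sset) (F : smap X Y) : Prop :=
  weak_homotopy_equiv R (@realize_map R X Y F).

Definition nfold_weq (R : realType) n (C D : nfold_cat n) (F : nfunctor C D) :
    Prop :=
  sset_weq R (diag_map (nerve_map F)).

(* Main.v *)
Require Import Defs.
From mathcomp Require Import all_boot all_order all_algebra.
From mathcomp Require Import all_classical all_reals all_analysis.
From mathcomp Require Import zify ring lra.
From Stdlib Require Import Relation_Operators.

(* The identity of maps is a computation: both sides restrict the array of
   cubes z along the maps g_j.

   For the weak equivalence let Y = N^n(D), let X be the nerve of the category
   of elements of Y over Delta^n, which is the diagonal of N^n of the
   Grothendieck construction, and let Z be the diagonal of Y, so that rho induces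
   a map X -> Z. It factors through a collage M whose simplices are those of Z,
   and the chains consisting of some vertices of a simplex of Z followed by
   composable morphisms of the category of elements. The map M -> Z
   sends a chain to the simplex of Y given by its last vertices; it is a
   retraction of Z -> M, and its composite with X -> M is rho.

   Both X -> M and Z -> M are anodyne: the nondegenerate simplices of M outside
   of X (respectively Z) are matched in pairs (tau, d_i tau), in a well-founded
   way, so that M is obtained by successively filling horns. For Z, one
   inserts or removes a last vertex mapped to the top of the first object. For X,
   one inserts or removes an object over (l, ..., l) which is a quotient of the
   simplex of vertices, found by an Eilenberg-Zilber decomposition.

   Hence the realizations of X and Z are deformation retracts of that of M,
   and |rho| is a homotopy equivalence. It is a weak equivalence by the usual
   change of base point along the path traced by a homotopy. *)

Set Implicit Arguments.
Unset Strict Implicit.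
Unset Printing Implicit Defensive.

(** The evident lift of a simplex of Y to the source, the chain [0] -> ... -> [m] of initial
    segments in each coordinate, does not commute with the simplicial operators. No inverse of [rho]
    is therefore written on simplices; it comes from retractions constructed after realization.
    Filling horns requires no fibrancy of the simplicial sets involved: lifts are taken in the
    simplicial set [deformations], whose simplices are cells with a deformation into the subcomplex,
    and where every horn has an explicit lift. Combinatorics and topology meet in [anodyne_section].
    In the matching relative to the source, the vertices span a simplex of the product of the
    standard simplices given by the next object, or of the diagonal of Y if no object follows.
    Uniqueness of its Eilenberg-Zilber decomposition is what lets a quotient be recovered after its
    removal. Diagonal maps are read on one chosen coordinate, which is where 1 <= n enters. Stages
    are natural numbers and cells of lower dimension come before all others, so ranks must be
    bounded in each dimension; this is the origin of the bound [(m + 4) ^ 2]. *)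

Local Notation dcomp := Defs.dcomp.

(** * Monotone maps *)

(* A morphism [k] -> [l] of Delta is encoded by a map on nat, extended beyond k
   by its value at k; composition is then composition of functions, and the
   identity of [k] is [minn^~ k]. *)
Definition clamped (k l : nat) (f : nat -> nat) : Prop :=
  [/\ {homo f : x y / x <= y}, forall x, f x <= l & forall x, f (minn x k) = f x].

Lemma clamped_id k : clamped k k (minn^~ k).
Proof. by split=> [x y|x|x]; lia. Qed.

Lemma clamped_comp k l m f g :
  clamped k l f -> clamped l m g -> clamped k m (g \o f).
Proof.
case=> f1 f2 f3 [g1 g2 g3]; split=> [x y xy|x|x] /=.
- by apply: g1; apply: f1.
- exact: g2.
- by rewrite f3.
Qed.

Lemma clamped_const k l a : a <= l -> clamped k l (fun=> a).
Proof. by split. Qed.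

Lemma clamped_minl k l f x : clamped k l f -> minn (f x) l = f x.
Proof. by case=> _ H _; apply/minn_idPl. Qed.

Definition of_hom k l (f : dhom k l) (x : nat) : nat := f (inord (minn x k)).

Lemma of_homE k l (f : dhom k l) (a : 'I_k.+1) : of_hom f a = f a.
Proof.
rewrite /of_hom; congr (nat_of_ord (f _)); apply: val_inj => /=.
by have := ltn_ord a; rewrite inordK; lia.
Qed.

Lemma of_hom_val k l (f : dhom k l) (x : nat) (a : 'I_k.+1) :
  x = a -> of_hom f x = f a.
Proof. by move=> ->; exact: of_homE. Qed.

Lemma of_hom_clamped k l (f : dhom k l) : clamped k l (of_hom f).
Proof.
split=> [x y xy|x|x].
- by apply: dhomP; rewrite !inordK; lia.
- by rewrite -ltnS; exact: ltn_ord.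
- by rewrite /of_hom -minnA minnn.
Qed.

Definition to_fun k l (f : nat -> nat) (a : 'I_k.+1) : 'I_l.+1 :=
  inord (minn (\max_(x < k.+1 | x <= a) f x) l).

Lemma to_fun_mono k l f (a b : 'I_k.+1) : a <= b -> to_fun l f a <= to_fun l f b.
Proof.
move=> ab; rewrite /to_fun !inordK; [|lia|lia].
suff : \max_(x < k.+1 | x <= a) f x <= \max_(x < k.+1 | x <= b) f x by lia.
apply/bigmax_leqP => i ia; apply: (leq_bigmax_cond (F := fun x : 'I__ => f x)).
exact: leq_trans ab.
Qed.

(* The running maximum makes [to_hom] total; it is only used on clamped maps. *)
Definition to_hom k l (f : nat -> nat) : dhom k l := mkdhom (@to_fun_mono k l f).

Lemma to_homE k l f (a : 'I_k.+1) : clamped k l f -> to_hom k l f a = f a :> nat.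
Proof.
case=> f1 f2 f3; rewrite ffunE /to_fun inordK; last by lia.
rewrite [\max_(_ < _ | _) _](_ : _ = f a); first by have := f2 a; lia.
apply/eqP; rewrite eqn_leq; apply/andP; split.
  by apply/bigmax_leqP => i /f1.
exact: (leq_bigmax_cond (F := fun x : 'I__ => f x)).
Qed.

Lemma of_to_hom k l f : clamped k l f -> of_hom (to_hom k l f) = f.
Proof.
move=> H; apply: funext => x; rewrite /of_hom to_homE //.
by case: H => _ _ H; rewrite inordK ?H //; lia.
Qed.

Lemma to_of_hom k l (f : dhom k l) : to_hom k l (of_hom f) = f.
Proof. by apply: dhom_eq => a; rewrite to_homE ?of_homE //; exact: of_hom_clamped. Qed.

Lemma of_hom_id k : of_hom (did k) = minn^~ k.
Proof. by apply: funext => x; rewrite /of_hom didE inordK; lia. Qed.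

Lemma of_hom_comp k l m (g : dhom l m) (f : dhom k l) :
  of_hom (dcomp g f) = of_hom g \o of_hom f.
Proof. by apply: funext => x; rewrite /of_hom dcompE /= -of_homE. Qed.

Lemma to_hom_id k : to_hom k k (minn^~ k) = did k.
Proof. by rewrite -of_hom_id to_of_hom. Qed.

Lemma to_hom_comp k l m f g : clamped k l f -> clamped l m g ->
  to_hom k m (g \o f) = dcomp (to_hom l m g) (to_hom k l f).
Proof.
move=> Hf Hg; apply: dhom_eq => a.
by rewrite to_homE ?dcompE ?to_homE //; exact: clamped_comp Hg.
Qed.

(** * Restriction of multisimplices along coded maps *)

Section Pull.
Variables (n : nat) (Y : msset n).
Implicit Types (k l : 'I_n -> nat) (z : {k & Y k}).

(** The element comes with its dimensions as a dependent pair, since these are often known only up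
    to a propositional equality. As [f] is a family of maps of nat, restrictions along composites
    are compared without transport. *)
Definition pull k (f : 'I_n -> nat -> nat) z : Y k :=
  mact Y (fun j => to_hom (k j) (projT1 z j) (f j)) (projT2 z).

Lemma pull_id z : pull (projT1 z) (fun j => minn^~ (projT1 z j)) z = projT2 z.
Proof.
rewrite /pull -[RHS]mact_id; congr mact; apply: fext => j; exact: to_hom_id.
Qed.

Lemma pull_comp k l f g z : (forall j, clamped (k j) (l j) (f j)) ->
  (forall j, clamped (l j) (projT1 z j) (g j)) ->
  pull k (fun j => g j \o f j) z = pull k f (existT _ l (pull l g z)).
Proof.
move=> Hf Hg; rewrite /pull /= -mact_comp; congr mact.
by apply: fext => j; exact: to_hom_comp.
Qed.

Lemma mact_pull k l (f : forall j, dhom (k j) (l j)) g z :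
  (forall j, clamped (l j) (projT1 z j) (g j)) ->
  mact Y f (pull l g z) = pull k (fun j => g j \o of_hom (f j)) z.
Proof.
move=> Hg; rewrite (@pull_comp _ l) //; last by move=> j; exact: of_hom_clamped.
by congr mact; apply: fext => j; rewrite to_of_hom.
Qed.

Lemma mact_to_pull k l (f : forall j, dhom (k j) (l j)) (y : Y l) :
  mact Y f y = pull k (fun j => of_hom (f j)) (existT _ l y).
Proof. by congr mact; apply: fext => j; rewrite to_of_hom. Qed.

Lemma mact_projT2 k z (f : forall j, dhom (k j) (projT1 z j)) :
  mact Y f (projT2 z) = pull k (fun j => of_hom (f j)) z.
Proof. by congr mact; apply: fext => j; rewrite to_of_hom. Qed.

Lemma cell_pull k l f g z (E : k = l) : f = g ->
  existT (fun k => Y k) k (pull k f z) = existT (fun k => Y k) l (pull l g z).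
Proof. by move=> ->; subst l. Qed.

End Pull.

(** * The nerve of the last vertex functor *)

Definition idarrow m (a : 'I_m.+1) : ordarrow m := mkordarrow (leqnn a).

Lemma of_hom_dcast k l (E : k = l) : of_hom (dcast E) = minn^~ k.
Proof. by subst l; rewrite dcast_id of_hom_id. Qed.

Lemma of_hom_dcmp (f g : darrow) (E : dtgt f = dsrc g) :
  of_hom (dmap (dcmp E)) = of_hom (dmap g) \o of_hom (dmap f).
Proof.
rewrite /dcmp /= !of_hom_comp of_hom_dcast; apply: funext => x /=.
by rewrite (clamped_minl _ (of_hom_clamped (dmap f))).
Qed.

Definition btgt m b : bcell (ordcat m) b -> 'I_m.+1 :=
  match b with true => fun u => (val u).2 | false => id end.

(** * Functors from [m] to Delta, and the multisimplices that they define *)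

Section Chain.
Variables (m : nat) (K : cat_functor (ordcat m) Delta).

Definition chain_map (u : ordarrow m) : nat -> nat := of_hom (dmap (far K u)).

Lemma chain_src u : dsrc (far K u) = fob K (val u).1.
Proof. exact: (fun_dom (fstr K)). Qed.

Lemma chain_tgt u : dtgt (far K u) = fob K (val u).2.
Proof. exact: (fun_cod (fstr K)). Qed.

Lemma chain_map_clamped (u : ordarrow m) :
  clamped (fob K (val u).1) (fob K (val u).2) (chain_map u).
Proof. by rewrite -chain_src -chain_tgt; exact: of_hom_clamped. Qed.

Lemma chain_map_comp u v w : (val u).2 = (val v).1 ->
  (val w).1 = (val u).1 -> (val w).2 = (val v).2 ->
  chain_map w = chain_map v \o chain_map u.
Proof.
move=> uv wu wv.
have E : dtgt (far K u) = dsrc (far K v) by rewrite chain_src chain_tgt uv.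
have -> : w = cmp (c := str (ordcat m)) uv by apply: ordarrow_eq.
by rewrite /chain_map (fun_cmp (fstr K) uv E) /= of_hom_dcmp.
Qed.

Lemma chain_map_id a : chain_map (idarrow a) = minn^~ (fob K a).
Proof.
rewrite /chain_map.
have -> : far K (idarrow a) = DArrow (did (fob K a)) := fun_idc (fstr K) a.
exact: of_hom_id.
Qed.

Definition last_map b (x : bcell (ordcat m) b) := chain_map (to_max (btgt x)).

Lemma blast_bmap b (x : bcell (ordcat m) b) : blast (bmap K x) = fob K (btgt x).
Proof. by case: b x => //= u; rewrite chain_tgt. Qed.

Lemma last_map_clamped b (x : bcell (ordcat m) b) :
  clamped (blast (bmap K x)) (fob K ord_max) (last_map x).
Proof. by rewrite blast_bmap; exact: chain_map_clamped. Qed.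

Lemma last_map_min b (x : bcell (ordcat m) b) a : a = blast (bmap K x) ->
  last_map x \o minn^~ a = last_map x.
Proof.
by move=> ->; apply: funext => y /=; case: (last_map_clamped x) => _ _ ->.
Qed.

Variables (b b' : bool) (h : b ==> b').

Lemma last_map_dom (x : bcell (ordcat m) b') :
  last_map x \o of_hom (bdommap h (bmap K x)) = last_map (dom (bdir (ordcat m) h) x).
Proof.
rewrite /last_map; move: h x; case: b b' => [] [] //= h' x.
- by rewrite of_hom_id; apply: (@last_map_min true).
- rewrite -/(chain_map x); apply: esym; exact: chain_map_comp.
- by rewrite of_hom_id; apply: (@last_map_min false).
Qed.

Lemma last_map_cod (x : bcell (ordcat m) b') :
  last_map (cod (bdir (ordcat m) h) x) = last_map x.
Proof. by move: h x; case: b b' => [] []. Qed.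

Lemma last_map_idc (x : bcell (ordcat m) b) :
  last_map (idc (bdir (ordcat m) h) x) = last_map x.
Proof. by move: h x; case: b b' => [] []. Qed.

Lemma last_map_cmp (x y : bcell (ordcat m) b')
    (H : cod (bdir (ordcat m) h) x = dom (bdir (ordcat m) h) y) :
  last_map (cmp H) = last_map y.
Proof. by move: h x y H; case: b b' => [] []. Qed.

End Chain.

Section Chains.
Variables (n : nat) (Y : msset n) (p : 'I_n -> nat).
Variables (K : forall j, cat_functor (ordcat (p j)) Delta) (zz : {k & Y k}).
Hypothesis zzE : forall j, projT1 zz j = fob (K j) ord_max.

(** Normal form of a multisimplex of the nerve: n functors to Delta and one element over their last
    objects, from which all other elements are restricted. That every multisimplex has this form is
    [nerve_cellE]. *)
Definition chains_cell e (x : cell (obox p) e) : gcell Y e :=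
  existT _ (fun j => bmap (K j) (x j))
    (pull (fun j => blast (bmap (K j) (x j))) (fun j => last_map (K j) (x j)) zz).

Lemma gcell_pull e (c d : cell (box (fun _ : 'I_n => Delta)) e) f g :
  c = d -> (forall j, f j = g j) ->
  existT (fun c => Y (fun j => blast (c j))) c (pull (fun j => blast (c j)) f zz) =
  existT _ d (pull (fun j => blast (d j)) g zz).
Proof. by move=> -> /funext ->. Qed.

Lemma last_map_clamped' e (x : cell (obox p) e) j :
  clamped (blast (bmap (K j) (x j))) (projT1 zz j) (last_map (K j) (x j)).
Proof. by rewrite zzE; exact: last_map_clamped. Qed.

Lemma chains_functor i e e' (h : edge i e e') :
  functor_on (dir (obox p) h) (dir (groth Y) h) (@chains_cell e) (@chains_cell e').
Proof.
pose B j := bmap_functor (K j) (edge_le h j).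
split=> [x|x|x|x y H H'].
- rewrite /= /gdom /= mact_pull; last exact: last_map_clamped'.
  apply: gcell_pull => [|j]; first by apply: fext => j; exact: (fun_dom (B j)).
  exact: last_map_dom.
- rewrite /= /gcod /= mact_pull; last exact: last_map_clamped'.
  apply: gcell_pull => [|j]; first by apply: fext => j; exact: (fun_cod (B j)).
  by rewrite of_hom_dcast last_map_cod last_map_min // blast_cod.
- rewrite /= /gidc /= mact_pull; last exact: last_map_clamped'.
  apply: gcell_pull => [|j]; first by apply: fext => j; exact: (fun_idc (B j)).
  by rewrite of_hom_dcast last_map_idc last_map_min // blast_idc.
- rewrite /= /gcmp /= mact_pull; last exact: last_map_clamped'.
  apply: gcell_pull => [|j]; first by apply: fext => j; exact: (fun_cmp (B j)).
  by rewrite of_hom_dcast last_map_cmp last_map_min // blast_cmp.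
Qed.

Definition chains_nfunctor : nerve (groth Y) p := NFunctor chains_functor.

End Chains.

(** * A multisimplex of the nerve is recovered from its paths and its last vertex *)

Section Paths.
Variables (n : nat) (Y : msset n) (p : 'I_n -> nat) (F : nerve (groth Y) p).
Notation Fc := (fcell (F : nfunctor (obox p) (groth Y))).

(** The cell read by [path_arrow] is an identity in direction [j], and [F] preserves identities. *)
Lemma path_arrow_id j (a : 'I_(p j).+1) :
  exists k, path_arrow F (idarrow a) = DArrow (did k).
Proof.
pose c : cell (obox p) (@no_dir n) :=
  fun m => bface (C := ordcat (p m)) (path_arrows (idarrow a) m) false true.
have -> : path_arrow F (idarrow a) =
    barrow (projT1 (Fc (one_dir j)
      (idc (dir (obox p) (edge_one j)) c)) j).
  rewrite /path_arrow; congr (barrow (projT1 (Fc _ _) j)).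
  apply: fext => m; rewrite /path_cell /c /=.
  move: (edge_le _ _); rewrite /no_dir /one_dir.
  case: (eqVneq m j) => [->|ne] h //=.
  by rewrite path_arrows_in; apply: ordarrow_eq.
rewrite (fun_idc (fdir (F : nfunctor _ _) _)) /=.
move: (edge_le _ _); rewrite /no_dir /one_dir eqxx => h /=.
by eexists.
Qed.

Definition path_ob j (a : 'I_(p j).+1) : nat := dsrc (path_arrow F (idarrow a)).

Lemma path_arrow_dom j (u : ordarrow (p j)) :
  dsrc (path_arrow F u) = path_ob (val u).1.
Proof.
have [E _] := @path_arrow_cmp _ _ _ F j (idarrow (val u).1) u u erefl erefl erefl.
by rewrite -E /path_ob; have [k ->] := path_arrow_id (val u).1.
Qed.

Lemma path_arrow_cod j (u : ordarrow (p j)) :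
  dtgt (path_arrow F u) = path_ob (val u).2.
Proof.
by have [] := @path_arrow_cmp _ _ _ F j u (idarrow (val u).2) u erefl erefl erefl.
Qed.

Lemma path_functor_on j :
  functor_on (str (ordcat (p j))) (str Delta) (@path_ob j) (@path_arrow _ _ _ F j).
Proof.
split=> [u|u|a|u v H H'].
- exact: path_arrow_dom.
- exact: path_arrow_cod.
- by rewrite /path_ob /= -/(idarrow a); have [k ->] := path_arrow_id a.
- have [E ->] := @path_arrow_cmp _ _ _ F j u v (cmp H) H erefl erefl.
  by congr dcmp; exact: Prop_irrelevance.
Qed.

Definition path_functor j : cat_functor (ordcat (p j)) Delta :=
  @CatFunctor (ordcat (p j)) Delta _ _ (path_functor_on j).

(* The j-th coordinate of the cube at (a_m) is read off on its edge in direction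
   j, which is also an edge of the cube with a_m replaced by a_m.2 <= p_m. *)
Lemma cube_path (a : forall j, ordarrow (p j)) j :
  projT1 (Fc (@all_dir n) a) j = path_arrow F (a j).
Proof.
pose A m := if m == j then a m else to_max (val (a m)).2.
have Aj : A j = a j by rewrite /A eqxx.
rewrite -Aj -(@path_arrow_face _ _ _ F j A (fun=> false)); last first.
  by move=> m /negbTE ne; rewrite /A ne.
have -> : (fun m => bface (C := ordcat (p m)) (A m) (one_dir j m) false) =
    (fun m => bface (C := ordcat (p m)) (a m) (one_dir j m) true).
  apply: fext => m; rewrite /A /one_dir; by case: eqVneq.
by rewrite fcell_face /= barrow_bface ?/one_dir.
Qed.

Lemma last_k_path j : last_k F j = path_ob (@ord_max (p j)).
Proof.
by rewrite -(@path_arrow_tgt _ _ _ F j (idarrow ord_max)) // path_arrow_cod.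
Qed.

Lemma of_hom_bface_tgt (f : darrow) b :
  of_hom (bface_incl f b true) = minn^~ (dtgt f).
Proof. by case: b; exact: of_hom_id. Qed.

(** The cell is a face of the cube [a1] obtained by completing [x] with identities. The terminal
    vertex of [a1] is the initial vertex of the cube [a2] that joins the target of [x] to the last
    vertex of the array, and the terminal vertex of [a2] is [last_cell F]. Following the element of
    Y through these two cubes gives its restriction along [last_map]. *)
Lemma nerve_cellE e (x : cell (obox p) e) :
  Fc e x = chains_cell path_functor (last_cell F) x.
Proof.
pose a1 j : ordarrow (p j) :=
  match e j as b return bcell (ordcat (p j)) b -> ordarrow (p j) with
  | true => id | false => fun v => idarrow v end (x j).
pose a2 j := to_max (btgt (x j)).
have Ex : x = fun j => bface (C := ordcat (p j)) (a1 j) (e j) true.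
  by apply: fext => j; rewrite /a1; case: (e j) (x j).
have E1 : Fc e x = gface (projT2 (Fc (@all_dir n) a1)) e (fun=> true).
  by rewrite {1}Ex; exact: fcell_face.
have E2 : gface (projT2 (Fc (@all_dir n) a1)) (@no_dir n) (fun=> true) =
          gface (projT2 (Fc (@all_dir n) a2)) (@no_dir n) (fun=> false).
  rewrite -[LHS](fcell_face F a1 (@no_dir n) (fun=> true)).
  rewrite -[RHS](fcell_face F a2 (@no_dir n) (fun=> false)).
  congr (Fc _ _); apply: fext => j /=; rewrite /a1.
  by case: (e j) (x j).
have E3 : last_cell F = gface (projT2 (Fc (@all_dir n) a2)) (@no_dir n) (fun=> true).
  exact: (fcell_face F a2 (@no_dir n) (fun=> true)).
move: E1 E2 E3; rewrite /gface /= mact_id mact_id.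
move: (cube_path a1) (cube_path a2).
case: (Fc (@all_dir n) a1) => f1 z1; case: (Fc (@all_dir n) a2) => f2 z2 /= F1 F2.
move=> -> E2 E3; rewrite mact_to_pull.
rewrite (E2 : existT (fun k => Y k) _ z1 = _) mact_to_pull.
rewrite -(E3 : _ = existT (fun k => Y k) _ z2).
have E4 j : dtgt (f1 j) = dsrc (f2 j) by move/(congr1 (fun c => projT1 c j)): E2.
have E5 j : dtgt (f2 j) = projT1 (last_cell F) j by rewrite E3.
rewrite -pull_comp => [|j|j]; last first.
- by rewrite -E5; exact: of_hom_clamped.
- by rewrite -E4; exact: of_hom_clamped.
apply: gcell_pull => [|j].
  apply: fext => j; rewrite F1 /= /a1; case: (e j) (x j) => //= v.
  by rewrite path_arrow_cod.
rewrite of_hom_bface_tgt E4 F2 /last_map /chain_map -/(a2 j) /=.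
apply: funext => y /=; by case: (of_hom_clamped (dmap (path_arrow F (a2 j)))).
Qed.

End Paths.

Section LambdaRho.
Variables (n : nat) (D : nfold_cat n).

(** One coordinate of the identity of maps. For an arrow a <= b, [blastcell] joins the image of the
    last element of K(a) to the last element of K(b); by functoriality of [K], the transition to the
    last object turns this into the arrow g(a) <= g(b). *)
Lemma blastcell_last m (K : cat_functor (ordcat m) Delta) b (x : bcell (ordcat m) b)
    (l : nat) (g : dhom m l) : fob K ord_max = l ->
  (forall a : 'I_m.+1, g a = chain_map K (to_max a) (fob K a) :> nat) ->
  bmap (ordmap (to_hom (blast (bmap K x)) l (last_map K x))) (blastcell (bmap K x)) =
  bmap (ordmap g) x.
Proof.
move=> E Hg; subst l; have Hx := last_map_clamped K x.
case: b x Hx => x Hx; last first.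
  by apply: val_inj; rewrite /= to_homE // Hg.
apply: ordarrow_eq; apply: val_inj; rewrite /= to_homE // Hg /=.
  rewrite -[X in last_map K (b := true) x X]of_homE -/(chain_map K x).
  rewrite (@chain_map_comp _ K x (to_max (val x).2) (to_max (val x).1)) //=.
  by congr (last_map K x (chain_map K x _)); exact: chain_src.
by congr (last_map K x _); exact: chain_tgt.
Qed.

Lemma nerve_map_lambda : nerve_map (lambda D) = rho (nerve D).
Proof.
suff E : Defs.mfun (nerve_map (lambda D)) = Defs.mfun (rho (nerve D)).
  move: E; case: (nerve_map _) => f Hf; case: (rho _) => g Hg /= E.
  by subst g; congr MSMap; exact: Prop_irrelevance.
apply: fext => p; apply: funext => F; apply: nfunctor_eq => e x /=.
rewrite /lambda_cell nerve_cellE /=.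
congr (fcell _ _ _); apply: fext => j.
have E : fob (path_functor F j) ord_max = last_k F j by rewrite last_k_path.
apply: (blastcell_last _ E) => a.
rewrite ffunE /path_last dcastE /chain_map /=.
by apply/esym/of_hom_val; rewrite path_arrow_dom.
Qed.

End LambdaRho.

(** * Anodyne extensions *)

(** The simplices, degenerate ones included, of the horn of the standard m-simplex that omits the
    face opposite to [i]. *)
Definition in_horn m (i : 'I_m.+1) k (theta : dhom k m) : Prop :=
  exists2 j, j != i & forall a, theta a != j.

Lemma in_horn_comp m (i : 'I_m.+1) k l (f : dhom k l) (theta : dhom l m) :
  in_horn i theta -> in_horn i (dcomp theta f).
Proof. by case=> j ji H; exists j => // a; rewrite dcompE. Qed.

Section Anodyne.
Variable M : sset.

(* M is obtained from A by filling, in stages, horns of the upper cells tau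
   which omit the face opposite to i. *)
Record anodyne (A : forall m, M m -> Prop) := Anodyne {
  upper : forall m, M m.+1 -> 'I_m.+2 -> Prop;
  upper_rank : forall m, M m.+1 -> nat;
  stage : forall m, M m -> nat;
  stage_eq0 : forall m (x : M m), stage x = 0 <-> A m x;
  stage_upper : forall m (x : M m), stage x <> 0 ->
    exists l (tau : M l.+1) i (theta : dhom m l.+1),
      [/\ upper tau i, ~ in_horn i theta & x = sact M theta tau];
  stage_full : forall m (tau : M m.+1) i k (theta : dhom k m.+1), upper tau i ->
    ~ in_horn i theta -> stage (sact M theta tau) = (upper_rank tau).+1;
  stage_horn : forall m (tau : M m.+1) i k (theta : dhom k m.+1), upper tau i ->
    in_horn i theta -> stage (sact M theta tau) <= upper_rank tau;
  upper_inj : forall k m (tau : M m.+1) i (theta : dhom k m.+1)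
    m' (tau' : M m'.+1) i' (theta' : dhom k m'.+1),
    upper tau i -> upper tau' i' -> ~ in_horn i theta -> ~ in_horn i' theta' ->
    sact M theta tau = sact M theta' tau' ->
    existT (fun m => M m.+1 * 'I_m.+2 * dhom k m.+1)%type m (tau, i, theta) =
    existT _ m' (tau', i', theta')
}.

Variables (A : forall m, M m -> Prop) (an : anodyne A).
Hypothesis A_act : forall k l (f : dhom k l) x, A x -> A (sact M f x).

(** Makes the simplices of stage at most N a simplicial subset, on which partial sections can be
    defined. *)
Lemma stage_act k l (f : dhom k l) (x : M l) : stage an (sact M f x) <= stage an x.
Proof.
have [x0|xN0] := pselect (stage an x = 0).
  by rewrite ((stage_eq0 an _).2 _) //; apply/A_act/(stage_eq0 an).
have [m [tau [i [theta [U H ->]]]]] := stage_upper xN0.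
rewrite -sact_comp (stage_full U H).
have [H'|H'] := pselect (in_horn i (dcomp theta f)).
  exact: leqW (stage_horn U H').
by rewrite (stage_full U H').
Qed.

Variables (T : sset) (p : smap T M).
Variable a : forall m (x : M m), A x -> T m.
Hypothesis pa : forall m (x : M m) (Ax : A x), p m (a Ax) = x.
Hypothesis a_act : forall k l (f : dhom k l) (x : M l) Ax Ax',
  @a k (sact M f x) Ax' = sact T f (@a l x Ax).
Hypothesis horn_lift : forall m (tau : M m.+1) (i : 'I_m.+2)
  (phi : forall k (theta : dhom k m.+1), in_horn i theta -> T k),
  (forall k theta H, p k (phi k theta H) = sact M theta tau) ->
  (forall k l (f : dhom k l) theta H H',
     phi k (dcomp theta f) H' = sact T f (phi l theta H)) ->
  exists2 xi, p m.+1 xi = tau & forall k theta H, sact T theta xi = phi k theta H.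

Record psection (N : nat) := PSection {
  psec : forall m (x : M m), stage an x <= N -> T m;
  p_psec : forall m (x : M m) H, p m (@psec m x H) = x;
  psec_act : forall k l (f : dhom k l) (x : M l) H H',
    @psec k (sact M f x) H' = sact T f (@psec l x H);
  psec_a : forall m (x : M m) (Ax : A x) H, @psec m x H = a Ax
}.

Lemma psec_irr N (s : psection N) m (x y : M m) H H' :
  x = y -> @psec N s m x H = @psec N s m y H'.
Proof. by move=> E; subst y; congr psec; exact: bool_irrelevance. Qed.

Lemma psection0 : inhabited (psection 0).
Proof.
have Ax m (x : M m) : stage an x <= 0 -> A x.
  by rewrite leqn0 => /eqP /(stage_eq0 an).
constructor; exists (fun m x H => a (Ax m x H)).
- by move=> *; exact: pa.
- by move=> *; exact: a_act.
- by move=> m x Ax' H; congr a; exact: Prop_irrelevance.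
Qed.

Record decomp m (x : M m) := Decomp {
  dec_dim : nat;
  dec_tau : M dec_dim.+1;
  dec_i : 'I_dec_dim.+2;
  dec_theta : dhom m dec_dim.+1;
  dec_upper : upper an dec_tau dec_i;
  dec_full : ~ in_horn dec_i dec_theta;
  decE : x = sact M dec_theta dec_tau
}.

Lemma decomp_ex m (x : M m) : stage an x <> 0 -> inhabited (decomp x).
Proof. by case/stage_upper => l [tau [i [theta [U H E]]]]; constructor; exists l tau i theta. Qed.

(** Over an upper cell of rank at most [N] the section is already defined on the horn, and
    [horn_lift] provides a lift [xi] of the whole cell. A simplex of stage [N.+1] is
    [sact M theta tau] for a unique full [theta], by [upper_inj]; its value is [sact T theta xi]. *)
Lemma psectionS N (s : psection N) : inhabited
  {s' : psection N.+1 | forall m (x : M m) H H',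
    @psec N.+1 s' m x H' = @psec N s m x H}.
Proof.
have xi_ex m (tau : M m.+1) i : upper an tau i -> upper_rank an tau <= N ->
    exists xi, p m.+1 xi = tau /\
      forall k (theta : dhom k m.+1) (_ : in_horn i theta) H, sact T theta xi = @psec N s k (sact M theta tau) H.
  move=> U rN.
  have HN k (theta : dhom k m.+1) (H : in_horn i theta) :
      stage an (sact M theta tau) <= N by exact: leq_trans (stage_horn U H) rN.
  have [k theta H|k l f theta H H'|xi E Hxi] :=
    @horn_lift m tau i (fun k theta H => psec s (HN k theta H)).
  - exact: p_psec.
  - have E : sact M (dcomp theta f) tau = sact M f (sact M theta tau).
      exact: sact_comp.
    have H2 : stage an (sact M f (sact M theta tau)) <= N by rewrite -E; exact: HN.
    by rewrite -(psec_act s (HN l theta H) H2); exact: psec_irr.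
  - exists xi; split=> // k theta H H'; rewrite (Hxi _ _ H); exact: psec_irr.
pose xi m tau i U rN := projT1 (cid (@xi_ex m tau i U rN)).
have p_xi m tau i U rN : p m.+1 (xi m tau i U rN) = tau.
  by rewrite /xi; case: cid => ? /= [].
have xi_horn m tau i U rN k (theta : dhom k m.+1) : in_horn i theta ->
    forall H, sact T theta (xi m tau i U rN) = @psec N s k (sact M theta tau) H.
  by rewrite /xi; case: cid => ? /= [_]; exact.
have nz m (x : M m) : ~ (stage an x <= N) -> stage an x <> 0 by move=> + E; rewrite E.
pose dec m (x : M m) (H : ~ (stage an x <= N)) : decomp x :=
  projT1 (cid (let: inhabits d := decomp_ex (nz m x H) in ex_intro (fun=> True) d I)).
have decN m (x : M m) (H : stage an x <= N.+1) (d : decomp x) :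
    upper_rank an (dec_tau d) <= N.
  have := H; rewrite {1}(decE d) (stage_full (dec_upper d)) //; exact: dec_full.
pose val m (x : M m) (H : stage an x <= N.+1) : T m :=
  match pselect (stage an x <= N) with
  | left H' => psec s H'
  | right H' => let d := dec m x H' in
      sact T (dec_theta d) (xi _ _ _ (dec_upper d) (decN m x H d))
  end.
have valN m (x : M m) H H' : val m x H = @psec N s m x H'.
  by rewrite /val; case: pselect => // H''; exact: psec_irr.
(* The formula is wanted for every [theta], including those in the horn, because a simplicial
   operator may send a new simplex into the horn. *)
have val_full k m (tau : M m.+1) i (U : upper an tau i) rN (theta : dhom k m.+1) H :
    upper_rank an tau = N ->
    val k (sact M theta tau) H = sact T theta (xi m tau i U rN).
  move=> rE; have [Hh|Hf] := pselect (in_horn i theta).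
    have H' := leq_trans (stage_horn U Hh) rN.
    by rewrite (valN _ _ _ H') (xi_horn _ _ _ _ _ _ _ Hh H').
  rewrite /val; case: pselect => [H'|H'].
    by exfalso; move: H'; rewrite (stage_full U Hf) rE ltnn.
  move: (dec _ _ _) (decN _ _ _ _) => -[m' tau' i' theta' U' Hf' E'] /= rN'.
  have := upper_inj U U' Hf Hf' E'.
  move: U' rN' {E' Hf'}; move: Hf => _; move: tau' i' theta'.
  move=> tau' i' theta' U' rN' E.
  have Em := projT1_eq E; rewrite /= in Em; subst m'.
  have := projT2_eq E; rewrite (Prop_irrelevance (projT1_eq E) erefl) /=.
  case=> E1 E2 E3; subst tau' i' theta'.
  by rewrite (Prop_irrelevance U' U) (bool_irrelevance rN' rN).
have val_p m x H : p m (val m x H) = x.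
  rewrite /val; case: pselect => H'; first exact: p_psec.
  by rewrite snat p_xi -decE.
have val_act k l (f : dhom k l) x H H' : val k (sact M f x) H' = sact T f (val l x H).
  rewrite [in RHS]/val; case: pselect => H1.
    by rewrite (valN _ _ _ (leq_trans (stage_act f x) H1)); exact: psec_act.
  move: (dec _ _ _) (decN _ _ _ _) => -[m tau i theta U Hf E] /= rN.
  have rE : upper_rank an tau = N.
    apply/eqP; rewrite eqn_leq rN /= -ltnS -(stage_full U Hf) -E ltnNge; exact/negP.
  rewrite -sact_comp -(val_full _ _ _ _ _ _ _ _ rE).
    by subst x; rewrite sact_comp.
  by move=> H2; move: H'; subst x => H'; move: H2; rewrite sact_comp => H2; congr val; exact: bool_irrelevance.
have val_a m (x : M m) (Ax : A x) H : val m x H = a Ax.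
  have H' : stage an x <= N by rewrite (stage_eq0 an x).2.
  by rewrite (valN _ _ _ H') psec_a.
by constructor; exists (@PSection N.+1 val val_p val_act val_a) => m x H H'; exact: valN.
Qed.

(** Each simplex is evaluated by the partial section of its own stage; [S_le] identifies this with
    its value at all later stages, which gives compatibility with the operators. *)
Lemma anodyne_section : exists s : forall m, M m -> T m,
  [/\ forall m x, p m (s m x) = x,
      forall k l (f : dhom k l) x, s k (sact M f x) = sact T f (s l x) &
      forall m x (Ax : A x), s m x = a Ax].
Proof.
have [s0] := psection0.
have next N (s : psection N) := cid (let: inhabits d := psectionS s in
  ex_intro (fun s' => forall m (x : M m) H H', @psec N.+1 s' m x H' = @psec N s m x H)
    (sval d) (svalP d)).
pose S := fix S N : psection N :=
  if N is N'.+1 then projT1 (next N' (S N')) else s0.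
have S_le N N' m (x : M m) H H' : N <= N' ->
    @psec N' (S N') m x H' = @psec N (S N) m x H.
  elim: N' H' => [|N' IH] H' NN'.
    have E : N = 0 by lia.
    by subst N; congr psec; exact: bool_irrelevance.
  have [E|ne] := eqVneq N N'.+1; first by subst N; congr psec; exact: bool_irrelevance.
  have NN : N <= N' by lia.
  have H2 := leq_trans H NN.
  by rewrite -(IH H2 NN) /=; case: (next _ _) => s' /= ->.
exists (fun m x => psec (S (stage an x)) (leqnn (stage an x))); split.
- by move=> m x; exact: p_psec.
- move=> k l f x.
  have H := leq_trans (stage_act f x) (leqnn _).
  by rewrite -(S_le _ _ _ _ _ H (stage_act f x)); exact: psec_act.
- by move=> m x Ax; exact: psec_a.
Qed.

End Anodyne.

(** * Eilenberg-Zilber decompositions *)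

Definition dsurj k l (f : dhom k l) : Prop := forall b, exists a, f a = b.

Lemma dface_mono m (j : 'I_m.+2) (a b : 'I_m.+1) : a <= b -> lift j a <= lift j b.
Proof. by rewrite /= leq_bump2. Qed.

Definition dface m (j : 'I_m.+2) : dhom m m.+1 := mkdhom (@dface_mono m j).

Lemma dfaceE m (j : 'I_m.+2) a : dface j a = lift j a.
Proof. by rewrite ffunE. Qed.

Lemma miss_factor k m (theta : dhom k m.+1) (j : 'I_m.+2) :
  (forall a, theta a != j) -> exists theta', theta = dcomp (dface j) theta'.
Proof.
move=> H; pose f (a : 'I_k.+1) : 'I_m.+1 := inord (unbump j (theta a)).
have fE a : f a = unbump j (theta a) :> nat.
  have := H a; rewrite -val_eqE /= => ne; rewrite /f inordK // /unbump.
  have := ltn_ord (theta a); have := ltn_ord j; lia.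
have fm (a b : 'I_k.+1) : a <= b -> f a <= f b.
  by move=> /(dhomP theta) ab; rewrite !fE /unbump; lia.
exists (mkdhom fm); apply: dhom_eq => a.
rewrite dcompE dfaceE ffunE /= fE /bump /unbump.
by have := H a; rewrite -val_eqE /=; lia.
Qed.

(** Any choice of preimages is monotone. The section is made to pass through a prescribed [a0] so
    that sections separate surjections, as [ez_unique] requires. *)
Lemma dsurj_section k l (s : dhom k l) : dsurj s -> forall a0, exists d : dhom l k,
  dcomp s d = did l /\ d (s a0) = a0.
Proof.
move=> sS a0; pose g b := if b == s a0 then a0 else projT1 (cid (sS b)).
have sg b : s (g b) = b by rewrite /g; case: eqP => [->//|_]; case: cid.
have gm (b c : 'I_l.+1) : b <= c -> g b <= g c.
  move=> bc; have [->//|ne] := eqVneq b c.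
  rewrite leqNgt; apply/negP => /ltnW /(dhomP s); rewrite !sg => cb.
  by move/eqP: ne; apply; apply: val_inj; apply/eqP; rewrite eqn_leq bc cb.
exists (mkdhom gm); split; last by rewrite ffunE /g eqxx.
by apply: dhom_eq => b; rewrite dcompE ffunE sg didE.
Qed.

Lemma dmono_strict k l (f : dhom k l) :
  (forall a b : 'I_k.+1, b = a.+1 :> nat -> f a != f b) ->
  forall a : 'I_k.+1, a <= f a.
Proof.
move=> H [a]; elim: a => [//|a IH] Ha /=.
have Ha' : a < k.+1 by lia.
have := IH Ha'; have := H (Ordinal Ha') (Ordinal Ha) erefl; rewrite -val_eqE /=.
by have : (Ordinal Ha' <= Ordinal Ha)%N by []; move=> /(dhomP f); lia.
Qed.

(** A section [g] of [f] is injective, hence bijective, so [f] is injective too. Injective monotone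
    endomorphisms lie above the identity, and the inequalities for [f] and [g] squeeze [f a] to
    [a]. *)
Lemma dsurj_endo k (f : dhom k k) : dsurj f -> f = did k.
Proof.
move=> fS.
have surj_le (g : dhom k k) : injective g -> forall a : 'I_k.+1, a <= g a.
  move=> gI; apply: dmono_strict => a b E; apply: contraPneq E => /gI ->; lia.
have [g [fg _]] := dsurj_section fS ord0.
have gK b : f (g b) = b.
  by have := congr1 (fun h : dhom k k => h b) fg; rewrite dcompE didE.
have gI : injective g by exact: can_inj gK.
have [h gh hg] := injF_bij gI.
have fI : injective f.
  have fh a : f a = h a by rewrite -{1}(hg a) gK.
  by move=> a b; rewrite !fh; exact: (can_inj hg).
apply: dhom_eq => a; rewrite didE; apply/eqP; rewrite eqn_leq surj_le // andbT.
have := surj_le g gI (f a).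
have -> : g (f a) = a; last by [].
by apply: fI; rewrite gK.
Qed.

Section EilenbergZilber.
Variable X : sset.

Definition nondeg m (x : X m) : Prop :=
  forall k (s : dhom m k) (y : X k), k < m -> x <> sact X s y.

(** The dimension [k] is taken minimal: a vertex missed by [s] would let [y] be replaced by one of
    its faces. *)
Lemma ez_exists m (x : X m) : exists k (s : dhom m k) (y : X k),
  [/\ x = sact X s y, dsurj s, nondeg y & k <= m].
Proof.
pose P k := `[< exists (s : dhom m k) (y : X k), x = sact X s y >].
have exP : exists k, P k.
  by exists m; apply/asboolP; exists (did m), x; rewrite sact_id.
case: (ex_minnP exP) => k /asboolP [s [y xE]] kmin.
exists k, s, y; split=> //; last first.
- by apply: kmin; apply/asboolP; exists (did m), x; rewrite sact_id.
- move=> l t z lk yE; have : P l by apply/asboolP; exists (dcomp t s), z; rewrite sact_comp -yE.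
  by move/kmin; lia.
move=> b; apply: contrapT => Hb.
have miss a : s a != b by apply/eqP => E; apply: Hb; exists a.
case: k s y xE kmin b Hb miss => [|k] s y xE kmin b Hb miss.
  by have := miss ord0; rewrite (ord1 (s ord0)) (ord1 b) eqxx.
have [s' sE] := miss_factor miss.
have : P k by apply/asboolP; exists s', (sact X (dface b) y); rewrite -sact_comp -sE.
by move/kmin; lia.
Qed.

(** By means of sections, [y] and [y'] are each obtained from the other, so nondegeneracy forces
    equal dimensions, and then makes s' e the identity for every section e of [s]. Sections through
    a given point yield s = s'. *)
Lemma ez_unique m k (s : dhom m k) (y : X k) k' (s' : dhom m k') (y' : X k') :
  dsurj s -> dsurj s' -> nondeg y -> nondeg y' -> sact X s y = sact X s' y' ->
  existT (fun k => dhom m k * X k)%type k (s, y) = existT _ k' (s', y').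
Proof.
move=> sS s'S yN y'N E.
have section_eq l (t : dhom m l) (z : X l) l' (t' : dhom m l') (z' : X l') (d : dhom l m) :
    dcomp t d = did l -> sact X t z = sact X t' z' -> z = sact X (dcomp t' d) z'.
  by move=> td E'; rewrite sact_comp -E' -sact_comp td sact_id.
have [d [sd _]] := dsurj_section sS ord0.
have [d' [s'd' _]] := dsurj_section s'S ord0.
have kk' : k = k'.
  apply/eqP; rewrite eqn_leq (leqNgt k) (leqNgt k'); apply/andP; split; apply/negP => lt.
  - exact: (yN _ _ _ lt (section_eq _ _ _ _ _ _ _ sd E)).
  - exact: (y'N _ _ _ lt (section_eq _ _ _ _ _ _ _ s'd' (esym E))).
subst k'.
have comp_id (e : dhom k m) : dcomp s e = did k -> dcomp s' e = did k.
  move=> se; apply: dsurj_endo => b; apply: contrapT => Hb.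
  have miss a : dcomp s' e a != b by apply/eqP => Ea; apply: Hb; exists a.
  case: k s y s' y' e b yN y'N se E Hb miss {section_eq sS s'S d sd d' s'd'} =>
    [|k] s y s' y' e b yN y'N se E Hb miss.
    by have := miss ord0; rewrite (ord1 (dcomp s' e ord0)) (ord1 b) eqxx.
  have [h hE] := miss_factor miss.
  apply: (yN k h (sact X (dface b) y') (ltnSn k)).
  by rewrite -sact_comp -hE sact_comp -E -sact_comp se sact_id.
have yE : y = y'.
  by rewrite (section_eq _ _ _ _ _ _ _ sd E) comp_id // sact_id.
have sE : s = s'.
  apply: dhom_eq => a; have [e [se ea]] := dsurj_section sS a.
  have := congr1 (fun h : dhom k k => h (s a)) (comp_id e se).
  by rewrite dcompE didE ea => ->.
by rewrite sE yE.
Qed.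

Lemma ez_nondeg k l (s : dhom k l) (y : X l) :
  dsurj s -> nondeg y -> nondeg (sact X s y) -> forall a, s a = a :> nat.
Proof.
move=> sS yN sN; have [d [sd _]] := dsurj_section sS ord0.
have kl : k = l.
  apply/eqP; rewrite eqn_leq (leqNgt k) (leqNgt l); apply/andP; split; apply/negP => lt.
    exact: (sN l s y lt erefl).
  by apply: (yN k d (sact X s y) lt); rewrite -sact_comp sd sact_id.
by subst l => a; rewrite (dsurj_endo sS) didE.
Qed.

End EilenbergZilber.

Section Merge.
Variable m : nat.

(** The idempotent d_a s_a of [m], or the identity if m <= a. For a < m, the simplices that it fixes
    are the images of the a-th degeneracy, so that degeneracy is tested without leaving dimension
    m. *)
Definition merge_fun (a : nat) (b : 'I_m.+1) : 'I_m.+1 :=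
  if (b == a :> nat) && (a < m) then inord a.+1 else b.

Lemma merge_val a b :
  merge_fun a b = (if (b == a :> nat) && (a < m) then a.+1 else b) :> nat.
Proof. by rewrite /merge_fun; case: ifP => // /andP [_ am]; rewrite inordK. Qed.

Lemma merge_mono a (b c : 'I_m.+1) : b <= c -> merge_fun a b <= merge_fun a c.
Proof. by rewrite !merge_val; do !case: ifP; lia. Qed.

Definition merge a : dhom m m := mkdhom (@merge_mono a).

Lemma mergeE a b :
  merge a b = (if (b == a :> nat) && (a < m) then a.+1 else b) :> nat.
Proof. by rewrite ffunE merge_val. Qed.

End Merge.

(** By [dmono_strict], a map to a smaller ordinal identifies some [a] with its successor, and then
    absorbs [merge m a]. Conversely [merge m a] misses [a], hence factors through a face. *)
Lemma nondegP (X : sset) m (x : X m) :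
  nondeg x <-> forall a, a < m -> x <> sact X (merge m a) x.
Proof.
split=> [xN a am E|H k s y km xE].
  case: m x xN a am E => // m x xN a am E.
  have miss b : merge m.+1 a b != inord a.
    by rewrite -val_eqE /= mergeE inordK; last lia; case: ifP; lia.
  have [t tE] := miss_factor miss.
  apply: (xN m t (sact X (dface (inord a)) x) (ltnSn m)).
  by rewrite -sact_comp -tE.
have [a [b [ba sab]]] : exists a b : 'I_m.+1, b = a.+1 :> nat /\ s a = s b.
  apply: contrapT => Hn; have := @dmono_strict _ _ s _ ord_max => /=.
  have sk := ltn_ord (s ord_max); suff K : forall a b : 'I_m.+1, b = a.+1 :> nat -> s a != s b.
    by move=> /(_ K); lia.
  by move=> a b ba; apply/eqP => sab; apply: Hn; exists a, b.
have am : a < m by have := ltn_ord b; lia.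
apply: (H a am); rewrite xE -sact_comp; congr sact; apply: dhom_eq => c.
rewrite dcompE; have [ca|ca] := eqVneq (c : nat) a; last first.
  by congr (nat_of_ord (s _)); apply: val_inj; rewrite /= mergeE (negbTE ca).
have -> : merge m a c = b by apply: val_inj; rewrite /= mergeE ca eqxx am ba.
by rewrite -sab; congr (nat_of_ord (s _)); exact: val_inj.
Qed.

(* An acyclic matching: [U tau i] pairs the upper cell tau with its i-th face. *)
Section Matching.
Variables (M : sset) (A : forall m, M m -> Prop).
Hypothesis A_act : forall k l (f : dhom k l) x, A x -> A (sact M f x).
Variable U : forall m, M m.+1 -> 'I_m.+2 -> Prop.
Variable rk : forall m, M m.+1 -> nat.

Hypothesis matched : forall m (x : M m), nondeg x -> ~ A x ->
  (exists (tau : M m.+1) i, U tau i /\ x = sact M (dface i) tau) \/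
  (exists k (tau : M k.+1) i, U tau i /\ existT (fun m => M m) m x = existT _ k.+1 tau).
Hypothesis upper_nondeg : forall m (tau : M m.+1) i, U tau i -> nondeg tau.
Hypothesis lower_nondeg : forall m (tau : M m.+1) i, U tau i -> nondeg (sact M (dface i) tau).
Hypothesis lowerNA : forall m (tau : M m.+1) i, U tau i -> ~ A (sact M (dface i) tau).
Hypothesis upper_face : forall m (tau : M m.+1) i i', U tau i -> U tau i' -> i = i'.
Hypothesis lower_inj : forall m (tau tau' : M m.+1) i i', U tau i -> U tau' i' ->
  sact M (dface i) tau = sact M (dface i') tau' -> tau = tau'.
Hypothesis lower_upper : forall m (tau : M m.+2) i, U tau i ->
  forall i', ~ U (sact M (dface i) tau) i'.
Hypothesis rk_bound : forall m (tau : M m.+1), rk tau <= (m + 4) ^ 2.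
Hypothesis rk_lt : forall m (tau tau' : M m.+1) i i' j, U tau i -> U tau' i' -> j != i ->
  sact M (dface j) tau = sact M (dface i') tau' -> rk tau' < rk tau.

(** By [rk_bound], the offset of a dimension exceeds every [match_rank] of lower dimension; upper
    cells are thus ordered by dimension, then by [rk]. *)
Fixpoint rank_offset m := if m is m'.+1 then rank_offset m' + ((m' + 4) ^ 2).+1 else 0.

Lemma rank_offset_lt k m : k < m -> rank_offset k + (k + 4) ^ 2 < rank_offset m.
Proof.
elim: m => // m IH km /=; have [->|ne] := eqVneq k m; first by rewrite ltn_add2l.
by have := IH ltac:(lia); lia.
Qed.

Definition match_rank m (tau : M m.+1) := rank_offset m + rk tau.

Lemma match_rank_lt k m (tau' : M k.+1) (tau : M m.+1) :
  k < m -> match_rank tau' < match_rank tau.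
Proof. by rewrite /match_rank => /rank_offset_lt; have := rk_bound tau'; lia. Qed.

Lemma upperNA m (tau : M m.+1) i : U tau i -> ~ A tau.
Proof. by move=> /lowerNA H At; apply: H; exact: A_act. Qed.

Lemma dsurj_full k m (i : 'I_m.+2) (s : dhom k m.+1) : dsurj s -> ~ in_horn i s.
Proof. by move=> sS [j _ Hj]; have [a E] := sS j; have := Hj a; rewrite E eqxx. Qed.

Lemma dface_full k m (i : 'I_m.+2) (s : dhom k m) :
  dsurj s -> ~ in_horn i (dcomp (dface i) s).
Proof.
move=> sS [j ji Hj]; case: (unliftP i j) ji Hj => [b ->|->]; last by rewrite eqxx.
by have [a E] := sS b; move=> _ /(_ a); rewrite dcompE dfaceE E eqxx.
Qed.

(** Outside of the horn, [theta] can miss no vertex other than [i]. So filling the horn of tau adds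
    exactly tau, its i-th face, and their degeneracies. *)
Lemma full_cases k m (i : 'I_m.+2) (theta : dhom k m.+1) : ~ in_horn i theta ->
  dsurj theta \/ exists2 s, dsurj s & theta = dcomp (dface i) s.
Proof.
move=> H; have [[a Ha]|Hn] := pselect (exists a, theta a = i).
  left=> b; apply: contrapT => Hb; apply: H; exists b.
    by apply/eqP => E; apply: Hb; exists a; rewrite Ha E.
  by move=> c; apply/eqP => E; apply: Hb; exists c.
right; have miss a : theta a != i by apply/eqP => E; apply: Hn; exists a.
have [s sE] := miss_factor miss; exists s => // b.
apply: contrapT => Hb; apply: H; exists (lift i b); first by rewrite eq_sym neq_lift.
move=> c; rewrite sE dcompE dfaceE; apply/eqP => /lift_inj E.
by apply: Hb; exists c.
Qed.

Lemma core_ex m (x : M m) : ~ A x -> exists l (tau : M l.+1) i (theta : dhom m l.+1),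
  [/\ U tau i, ~ in_horn i theta & x = sact M theta tau].
Proof.
have [k [s [y [-> sS yN _]]]] := ez_exists x => xA.
have yA : ~ A y by move=> Ay; apply: xA; exact: A_act.
have [[tau [i [Ut yE]]]|[l [tau [i [Ut E]]]]] := matched yN yA.
  exists k, tau, i, (dcomp (dface i) s); split=> //; first exact: dface_full.
  by rewrite yE sact_comp.
have Ek := projT1_eq E; rewrite /= in Ek; subst k.
have yE : y = tau by have := projT2_eq E; rewrite (Prop_irrelevance (projT1_eq E) erefl).
by exists l, tau, i, s; rewrite yE; split=> //; exact: dsurj_full.
Qed.

Lemma coreNA k m (tau : M m.+1) i (theta : dhom k m.+1) :
  U tau i -> ~ in_horn i theta -> ~ A (sact M theta tau).
Proof.
move=> Ut /full_cases [tS|[s sS ->]].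
  have [d [td _]] := dsurj_section tS ord0.
  by move=> /(A_act d); rewrite -sact_comp td sact_id; exact: upperNA Ut.
have [d [sd _]] := dsurj_section sS ord0.
by move=> /(A_act d); rewrite sact_comp -[X in A X]sact_comp sd sact_id; exact: lowerNA.
Qed.

(** By [full_cases] both sides are in Eilenberg-Zilber form, over an upper cell or over its lower
    face, so their nondegenerate parts agree. An upper cell equal to a lower one is excluded by
    [lower_upper]; otherwise [upper_face] and [lower_inj] recover the pair. *)
Lemma core_unique k m (tau : M m.+1) i (theta : dhom k m.+1)
    m' (tau' : M m'.+1) i' (theta' : dhom k m'.+1) :
  U tau i -> U tau' i' -> ~ in_horn i theta -> ~ in_horn i' theta' ->
  sact M theta tau = sact M theta' tau' ->
  existT (fun m => M m.+1 * 'I_m.+2 * dhom k m.+1)%type m (tau, i, theta) =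
  existT _ m' (tau', i', theta').
Proof.
move=> Ut Ut' H H' E.
have split_pair l l' (s : dhom k l) (y : M l) (s' : dhom k l') (y' : M l') :
    dsurj s -> dsurj s' -> nondeg y -> nondeg y' -> sact M s y = sact M s' y' ->
    exists e : l = l', ecast l (dhom k l) e s = s' /\ ecast l (M l) e y = y'.
  move=> sS s'S yN y'N E'; have := ez_unique sS s'S yN y'N E' => E2.
  have e := projT1_eq E2; rewrite /= in e; subst l'.
  have := projT2_eq E2; rewrite (Prop_irrelevance (projT1_eq E2) erefl) /= => -[-> ->].
  by exists erefl.
have [tS|[s sS thE]] := full_cases H; have [t'S|[s' s'S th'E]] := full_cases H'.
- have [e [E1 E2]] := split_pair _ _ _ _ _ _ tS t'S (upper_nondeg Ut) (upper_nondeg Ut') E.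
  case: e (e) E1 E2 => e; subst m' => e'; rewrite (Prop_irrelevance e' erefl) /= => <- E2.
  by subst tau'; rewrite (upper_face Ut Ut').
- move: E; rewrite th'E sact_comp => E.
  have [e [E1 E2]] := split_pair _ _ _ _ _ _ tS s'S (upper_nondeg Ut) (lower_nondeg Ut') E.
  subst m'; move: E2 => /= E2; subst tau.
  by case: (lower_upper Ut' Ut).
- move: E; rewrite thE sact_comp => E.
  have [e [E1 E2]] := split_pair _ _ _ _ _ _ sS t'S (lower_nondeg Ut) (upper_nondeg Ut') E.
  subst m; move: E2 => /= E2; subst tau'.
  by case: (lower_upper Ut Ut').
- move: E; rewrite thE th'E !sact_comp => E.
  have [e [E1 E2]] := split_pair _ _ _ _ _ _ sS s'S (lower_nondeg Ut) (lower_nondeg Ut') E.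
  subst m'; move: E1 E2 => /= E1 E2; subst s'.
  have Et := lower_inj Ut Ut' E2; subst tau'.
  by rewrite (upper_face Ut Ut').
Qed.

Definition match_stage m (x : M m) : nat :=
  match pselect (A x) with
  | left _ => 0
  | right H => (match_rank (projT1 (cid (projT2 (cid (core_ex H)))))).+1
  end.

Lemma match_stage0 m (x : M m) : A x -> match_stage x = 0.
Proof. by rewrite /match_stage; case: pselect. Qed.

Lemma match_stage_eq0 m (x : M m) : match_stage x = 0 <-> A x.
Proof. by split=> [|/match_stage0//]; rewrite /match_stage; case: pselect. Qed.

Lemma match_stage_full m (tau : M m.+1) i k (theta : dhom k m.+1) : U tau i ->
  ~ in_horn i theta -> match_stage (sact M theta tau) = (match_rank tau).+1.
Proof.
move=> Ut H; rewrite /match_stage; case: pselect => [/(coreNA Ut H)//|NA].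
congr _.+1; case: cid => l /= Hl; case: cid => tau' /= [i' [theta' [Ut' H' E]]].
have E2 := core_unique Ut Ut' H H' E.
have e := projT1_eq E2; rewrite /= in e; subst l.
by have := projT2_eq E2; rewrite (Prop_irrelevance (projT1_eq E2) erefl) /= => -[->].
Qed.

(** The simplex comes from a face of [tau] other than the i-th. The nondegenerate part of that face
    is in A or belongs to a pair whose upper cell has smaller rank: by [rk_lt] in the same
    dimension, by the offset in lower ones. The simplex is full in that cell or in its horn, where
    induction applies. *)
Lemma match_stage_horn m (tau : M m.+1) i k (theta : dhom k m.+1) : U tau i ->
  in_horn i theta -> match_stage (sact M theta tau) <= match_rank tau.
Proof.
have [N] := ubnP (match_rank tau); elim: N m tau i k theta => // N IH m tau i k theta tN Ut.
case=> j ji Hj; have [t ->] := miss_factor Hj; rewrite sact_comp.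
have [xA|xA] := pselect (A (sact M t (sact M (dface j) tau))).
  by rewrite match_stage0.
have [l [s [y [yE sS yN lm]]]] := ez_exists (sact M (dface j) tau).
have yA : ~ A y by move=> Ay; apply: xA; rewrite yE; do 2 apply: A_act.
suff [l' [tau' [i' [f [Ut' yE' lt]]]]] : exists l' (tau' : M l'.+1) i' (f : dhom l l'.+1),
    [/\ U tau' i', y = sact M f tau' & match_rank tau' < match_rank tau].
  rewrite yE yE' -!sact_comp; have [Hf|Hf] := pselect (in_horn i' (dcomp f (dcomp s t))).
    exact: leq_trans (IH _ _ _ _ _ (leq_trans lt tN) Ut' Hf) (ltnW lt).
  by rewrite (match_stage_full Ut' Hf).
have [[tau' [i' [Ut' E]]]|[l' [tau' [i' [Ut' E]]]]] := matched yN yA.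
  exists l, tau', i', (dface i'); split=> //.
  have [e|ne] := eqVneq l m; last by apply: match_rank_lt; lia.
  subst l; rewrite /match_rank ltn_add2l; apply: (rk_lt Ut Ut' ji).
  by rewrite -E yE (dsurj_endo sS) sact_id.
have e := projT1_eq E; rewrite /= in e; subst l.
have E' : y = tau' by have := projT2_eq E; rewrite (Prop_irrelevance (projT1_eq E) erefl).
exists l', tau', i', (did l'.+1); rewrite sact_id; split=> //.
by apply: match_rank_lt; lia.
Qed.

Definition match_anodyne : anodyne A :=
  @Anodyne M A U match_rank match_stage match_stage_eq0
    (fun m x H => core_ex (fun Ax => H (match_stage0 Ax)))
    match_stage_full match_stage_horn core_unique.

End Matching.

(** * The collage of rho *)

Lemma le_max m (a : 'I_m.+1) : a <= @ord_max m.
Proof. exact: leq_ord. Qed.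

Section Collage.
Variables (n : nat) (Y : msset n).

(* A chain of vertices of a simplex followed by objects of the category of
   elements of Y: the index a is an object if [is_ob a], and a vertex otherwise.
   The map [mp a b] is the transition map if a is an object, and the constant
   map at the image of the vertex a in the object b if a is a vertex. *)
Record chain m := Chain {
  is_ob : 'I_m.+1 -> bool;
  dim : 'I_m.+1 -> 'I_n -> nat;
  mp : 'I_m.+1 -> 'I_m.+1 -> 'I_n -> nat -> nat;
  lastz : {k & Y k}
}.

(** A vertex is treated as having dimension 0, so that [mp] out of it is constant. Composites are
    imposed only through objects, since passing through a vertex would forget the source; for
    vertices, [mp_vtx] requires that their images be in order. The value of [mp] for b < a is fixed
    by [mp_gt] so that equality of chains only involves the meaningful values. *)
Record chain_ok m (c : chain m) : Prop := ChainOk {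
  ob_max : is_ob c ord_max;
  ob_le : forall a b : 'I_m.+1, a <= b -> is_ob c a -> is_ob c b;
  dim_vtx : forall a j, ~~ is_ob c a -> dim c a j = 0;
  dim_last : projT1 (lastz c) = dim c ord_max;
  mp_clamped : forall (a b : 'I_m.+1) j, a <= b -> clamped (dim c a j) (dim c b j) (mp c a b j);
  mp_id : forall a j, mp c a a j = minn^~ (dim c a j);
  mp_comp : forall (a b d : 'I_m.+1) j, a <= b -> b <= d -> is_ob c b ->
    mp c a d j = mp c b d j \o mp c a b j;
  mp_vtx : forall (a b d : 'I_m.+1) j, a <= b -> b <= d -> ~~ is_ob c b ->
    mp c a d j 0 <= mp c b d j 0;
  mp_gt : forall (a b : 'I_m.+1) j, b < a -> mp c a b j = fun=> 0
}.

Record vchain m := VChain { vch :> chain m; vchP : chain_ok vch }.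

Lemma vchain_eq m (c d : vchain m) : is_ob c = is_ob d -> dim c = dim d ->
  (forall (a b : 'I_m.+1) j, a <= b -> mp c a b j = mp d a b j) -> lastz c = lastz d -> c = d.
Proof.
case: c d => [[b k f z] P] [[b' k' f' z'] P'] /= E1 E2 E3 E4; subst b' k' z'.
have E : f = f'.
  apply: funext => a; apply: funext => d; apply: funext => j.
  have [ad|da] := leqP a d; first exact: E3.
  exact: etrans (mp_gt P j da) (esym (mp_gt P' j da)).
by subst f'; congr VChain; exact: Prop_irrelevance.
Qed.

Lemma inord_minn m (a : 'I_m.+1) : inord (minn a m) = a :> 'I_m.+1.
Proof. by apply: val_inj => /=; have := ltn_ord a; rewrite inordK; lia. Qed.

(** The evaluation point [dim] serves both kinds of indices: it is the last element of an object,
    and 0, the only element, for a vertex. *)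
Definition last_vtx m (c : chain m) (j : 'I_n) (a : nat) : nat :=
  mp c (inord (minn a m)) ord_max j (dim c (inord (minn a m)) j).

Lemma last_vtxE m (c : chain m) j (a : 'I_m.+1) :
  last_vtx c j a = mp c a ord_max j (dim c a j).
Proof. by rewrite /last_vtx inord_minn. Qed.

Lemma last_vtx_clamped m (c : vchain m) j :
  clamped m (projT1 (lastz c) j) (last_vtx c j).
Proof.
have P := vchP c; split=> [x y xy|x|x]; last first.
- by rewrite /last_vtx -minnA minnn.
- rewrite /last_vtx dim_last //.
  by have [_ + _] := mp_clamped P j (le_max (inord (minn x m))); apply.
rewrite /last_vtx; set a := inord (minn x m); set b := inord (minn y m).
have ab : a <= b by rewrite /a /b !inordK; lia.
have [bb|bb] := boolP (is_ob c b).
  rewrite (mp_comp P j ab (le_max b) bb) /=.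
  have [Hm _ _] := mp_clamped P j (le_max b); apply: Hm.
  by have [_ + _] := mp_clamped P j ab; apply.
have ba : ~~ is_ob c a by apply: contra bb => /(ob_le P ab).
by rewrite !dim_vtx //; exact: (mp_vtx P j ab (le_max b) bb).
Qed.

Definition realize_chain m (c : chain m) : Y (fun=> m) :=
  pull (fun=> m) (last_vtx c) (lastz c).

Section ChainAct.
Variables (k m : nat) (f : dhom k m) (c : vchain m).

Definition chain_act : chain k := Chain
  (fun a => is_ob c (f a)) (fun a => dim c (f a))
  (fun a b j => if a <= b then mp c (f a) (f b) j else fun=> 0)
  (existT _ (dim c (f ord_max)) (pull (dim c (f ord_max)) (mp c (f ord_max) ord_max) (lastz c))).

Hypothesis fob : is_ob c (f ord_max).

Lemma chain_act_ok : chain_ok chain_act.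
Proof.
have P := vchP c; split=> //=.
- by move=> a b /(dhomP f); exact: ob_le.
- by move=> a j; exact: dim_vtx.
- by move=> a b j ab; rewrite ab; exact: (mp_clamped P j (dhomP f ab)).
- by move=> a j; rewrite leqnn mp_id.
- move=> a b d j ab bd bb; rewrite ab bd (leq_trans ab bd).
  by apply: (mp_comp P j _ _ bb); exact: dhomP.
- move=> a b d j ab bd bb; rewrite bd (leq_trans ab bd).
  by apply: (mp_vtx P j _ _ bb); exact: dhomP.
- by move=> a b j ba; rewrite leqNgt ba.
Qed.

Definition vchain_act : vchain k := VChain chain_act_ok.

Lemma mp_last_clamped (a : 'I_m.+1) j :
  clamped (dim c a j) (projT1 (lastz c) j) (mp c a ord_max j).
Proof. by rewrite (dim_last (vchP c)); exact: (mp_clamped (vchP c) j (le_max a)). Qed.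

Lemma realize_chain_act :
  realize_chain chain_act = mact Y (fun=> f) (realize_chain c).
Proof.
rewrite /realize_chain mact_pull; last by move=> j; exact: last_vtx_clamped.
rewrite /= -pull_comp; last by move=> j; exact: mp_last_clamped.
  congr pull; apply: funext => j; apply: funext => a /=.
  rewrite /of_hom last_vtxE /last_vtx /= leq_ord.
  set b := inord (minn a k).
  by rewrite (mp_comp (vchP c) j (dhomP f (le_max b)) (le_max _) fob).
by move=> j; have := last_vtx_clamped vchain_act j.
Qed.

End ChainAct.

Definition collage_ob m : Type := (Y (fun=> m) + vchain m)%type.

(** If [f] sends the last index to a vertex, it hits only vertices. No object is left, and the
    result is the simplex of Y that these vertices span. *)
Definition collage_act k m (f : dhom k m) (x : collage_ob m) : collage_ob k :=
  match x with
  | inl y => inl (mact Y (fun=> f) y)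
  | inr c => match pselect (is_ob c (f ord_max)) with
             | left H => inr (vchain_act H)
             | right _ => inl (mact Y (fun=> f) (realize_chain c))
             end
  end.

Lemma collage_act_ob k m (f : dhom k m) (c : vchain m) (H : is_ob c (f ord_max)) :
  collage_act f (inr c) = inr (vchain_act H).
Proof.
by rewrite /=; case: pselect => // H'; congr (inr (vchain_act _)); exact: bool_irrelevance.
Qed.

Lemma collage_act_vtx k m (f : dhom k m) (c : vchain m) : ~~ is_ob c (f ord_max) ->
  collage_act f (inr c) = inl (mact Y (fun=> f) (realize_chain c)).
Proof. by move=> /negP H /=; case: pselect. Qed.

Lemma collage_act_id m (x : collage_ob m) : collage_act (did m) x = x.
Proof.
case: x => [y|c]; first by rewrite /= mact_id.
have H : is_ob c (did m ord_max) by rewrite didE; exact: ob_max (vchP c).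
rewrite (collage_act_ob H); congr inr; apply: vchain_eq => /= [||a b j ->|].
- by apply: funext => a; rewrite didE.
- by apply: funext => a; rewrite didE.
- by rewrite !didE.
- rewrite didE; rewrite -(dim_last (vchP c)).
  have -> : mp c ord_max ord_max = fun j => minn^~ (projT1 (lastz c) j).
    by apply: funext => j; rewrite (mp_id (vchP c)) (dim_last (vchP c)).
  by rewrite pull_id; case: (lastz c).
Qed.

Lemma collage_act_comp k l m (f : dhom k l) (g : dhom l m) (x : collage_ob m) :
  collage_act (dcomp g f) x = collage_act f (collage_act g x).
Proof.
case: x => [y|c]; first by rewrite /= -mact_comp.
have [gm|gm] := boolP (is_ob c (g ord_max)); last first.
  rewrite (collage_act_vtx gm) collage_act_vtx; first by rewrite /= -mact_comp.
  by rewrite dcompE; apply: contra gm; exact: (ob_le (vchP c) (dhomP g (le_max _))).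
rewrite (collage_act_ob gm).
have [fm|fm] := boolP (is_ob c (g (f ord_max))); last first.
  rewrite (@collage_act_vtx _ _ f (vchain_act gm)) // collage_act_vtx ?dcompE //.
  by congr inl; rewrite [realize_chain (vchain_act gm)]realize_chain_act // -mact_comp.
have H : is_ob c (dcomp g f ord_max) by rewrite dcompE.
rewrite (collage_act_ob H) (@collage_act_ob _ _ f (vchain_act gm) fm).
congr inr; apply: vchain_eq => /= [||a b j ab|].
- by apply: funext => a; rewrite dcompE.
- by apply: funext => a; rewrite dcompE.
- by rewrite ab (dhomP f ab) !dcompE.
- rewrite dcompE leq_ord; congr existT.
  rewrite -pull_comp; last by move=> j; exact: mp_last_clamped.
    congr pull; apply: funext => j.
    exact: (mp_comp (vchP c) j (dhomP g (le_max _)) (le_max _) gm).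
  by move=> j; exact: (mp_clamped (vchP c) _ (dhomP g (le_max _))).
Qed.

Definition collage : sset :=
  @SSet collage_ob collage_act collage_act_id collage_act_comp.

Definition collage_simplex : smap (diag Y) collage :=
  @SMap (diag Y) collage (fun m => inl) (fun k l f y => erefl).

Definition collage_ret_fun m (x : collage m) : diag Y m :=
  match x with inl y => y | inr c => realize_chain c end.

Lemma collage_ret_act k l (f : dhom k l) (x : collage l) :
  collage_ret_fun (sact collage f x) = sact (diag Y) f (collage_ret_fun x).
Proof.
case: x => [y|c] //=; case: pselect => //= H.
exact: realize_chain_act.
Qed.

Definition collage_ret : smap collage (diag Y) := SMap collage_ret_act.

End Collage.

(** * The nerve of the Grothendieck construction as the chains without vertices *)

Definition ordarr m (a b : 'I_m.+1) : ordarrow m :=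
  if (a <= b) =P true is ReflectT ab then mkordarrow ab else idarrow a.

Lemma ordarrE m (a b : 'I_m.+1) (ab : a <= b) : ordarr a b = mkordarrow ab.
Proof.
rewrite /ordarr; case: eqP => [H|//].
by apply: ordarrow_eq.
Qed.

Lemma ordarr_val m (u : ordarrow m) : ordarr (val u).1 (val u).2 = u.
Proof. by rewrite (ordarrE (valP u)); apply: ordarrow_eq. Qed.

Lemma ordarr1 m (a b : 'I_m.+1) (ab : a <= b) : (val (ordarr a b)).1 = a.
Proof. by rewrite (ordarrE ab). Qed.

Lemma ordarr2 m (a b : 'I_m.+1) (ab : a <= b) : (val (ordarr a b)).2 = b.
Proof. by rewrite (ordarrE ab). Qed.

Section Object.
Variables (n : nat) (Y : msset n) (m : nat).

Section ToChain.
Variables (K : 'I_n -> cat_functor (ordcat m) Delta) (zz : {k & Y k}).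
Hypothesis zzE : forall j, projT1 zz j = fob (K j) ord_max.

Definition functors_chain : chain Y m := Chain (fun=> true)
  (fun a j => fob (K j) a)
  (fun a b j => if a <= b then chain_map (K j) (ordarr a b) else fun=> 0) zz.

Lemma functors_chain_ok : chain_ok functors_chain.
Proof.
split=> //= [|a b j ab|a j|a b d j ab bd _|a b j ba].
- by apply: funext.
- by have := chain_map_clamped (K j) (ordarr a b); rewrite ab ordarr1 ?ordarr2.
- by rewrite leqnn (ordarrE (leqnn a)) chain_map_id.
- rewrite ab bd (leq_trans ab bd); apply: chain_map_comp; rewrite ?ordarr1 ?ordarr2 //.
    exact: leq_trans bd.
  exact: leq_trans bd.
- by rewrite leqNgt ba.
Qed.

Definition functors_vchain := VChain functors_chain_ok.

End ToChain.

Section FromChain.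
Variable c : vchain Y m.
Hypothesis c_ob : forall a, is_ob c a.

Lemma chain_functor_on j : functor_on (str (ordcat m)) (str Delta)
  (fun a => dim c a j) (fun u => DArrow (to_hom (dim c (val u).1 j)
     (dim c (val u).2 j) (mp c (val u).1 (val u).2 j))).
Proof.
have P := vchP c; split=> [//|//|a|[[a b] ab] [[b' d] bd] H H'] /=.
  by rewrite (mp_id P) to_hom_id.
rewrite /= in ab bd H H' *; subst b'; rewrite /dcmp /= dcast_id dcomp1f -to_hom_comp.
- by congr (DArrow (to_hom _ _ _)); exact: (mp_comp P j ab bd).
- exact: (mp_clamped P j ab).
- exact: (mp_clamped P j bd).
Qed.

Definition chain_functor j : cat_functor (ordcat m) Delta :=
  @CatFunctor (ordcat m) Delta _ _ (chain_functor_on j).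

Lemma chain_lastE j : projT1 (lastz c) j = fob (chain_functor j) ord_max.
Proof. by rewrite (dim_last (vchP c)). Qed.

Lemma functors_chainK : functors_vchain chain_lastE = c.
Proof.
apply: vchain_eq => //= [|a b j ab].
  by apply: funext => a; rewrite c_ob.
rewrite ab /chain_map /= of_to_hom; rewrite ?ordarr1 ?ordarr2 //.
exact: (mp_clamped (vchP c)).
Qed.

End FromChain.

Section Nerve.
Variable F : diag (nerve (groth Y)) m.

Lemma nerve_lastE j : projT1 (last_cell F) j = fob (path_functor F j) ord_max.
Proof. exact: last_k_path. Qed.

Definition nerve_chain := functors_vchain nerve_lastE.

End Nerve.

Lemma path_cell_in p (j : 'I_n) (u : ordarrow (p j)) (K : cat_functor (ordcat (p j)) Delta) :
  barrow (bmap K (path_cell u j)) = far K u.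
Proof.
rewrite /path_cell path_arrows_in; have : one_dir j j = true by rewrite /one_dir eqxx.
by case: (one_dir j j).
Qed.

Lemma functor_eq (C D : small_cat) (F G : cat_functor C D) :
  fob F = fob G -> far F = far G -> F = G.
Proof.
case: F G => [f g H] [f' g' H'] /= E1 E2; subst f' g'.
by congr CatFunctor; exact: Prop_irrelevance.
Qed.

End Object.

Section Injection.
Variables (n : nat) (Y : msset n).

Lemma nerve_chain_act k m (f : dhom k m) (F : diag (nerve (groth Y)) m) :
  (inr (nerve_chain (sact (diag (nerve (groth Y))) f F)) : collage Y k) =
  sact (collage Y) f (inr (nerve_chain F)).
Proof.
rewrite [RHS](@collage_act_ob _ _ _ _ f (nerve_chain F)) //; congr inr.
have path_act (j : 'I_n) (u : ordarrow k) :
    @path_arrow n Y (fun=> k) (sact (diag (nerve (groth Y))) f F) j u =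
    @path_arrow n Y (fun=> m) F j (far (ordmap f) u).
  pose x : cell (obox (fun=> m)) (one_dir j) := fun i =>
    bmap (ordmap f) (path_cell (p := fun=> k) (j := j) u i).
  have E := nerve_cellE F (e := one_dir j) x.
  transitivity (barrow (projT1 (chains_cell (path_functor F) (last_cell F) x) j)).
    by rewrite -E.
  rewrite /= /x /path_cell path_arrows_in; have : one_dir j j = true by rewrite /one_dir eqxx.
  by case: (one_dir j j).
have ordarr_act (a b : 'I_k.+1) : a <= b -> far (ordmap f) (ordarr a b) = ordarr (f a) (f b).
  by move=> ab; rewrite (ordarrE ab) (ordarrE (dhomP f ab)); apply: ordarrow_eq.
have path_ob_act (j : 'I_n) a : 
    @path_ob n Y (fun=> k) (sact (diag (nerve (groth Y))) f F) j a =
    @path_ob n Y (fun=> m) F j (f a).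
  rewrite /path_ob (path_act j); congr (dsrc (@path_arrow n Y (fun=> m) F j _)).
  exact: ordarrow_eq.
apply: vchain_eq => [//||a b j ab|] /=.
- by apply: funext => a; apply: funext => j; exact: path_ob_act.
- rewrite ab (dhomP f ab) /chain_map /= -(ordarr_act _ _ ab).
  by rewrite (path_act j).
- rewrite /last_cell /=.
  have := nerve_cellE F (e := @no_dir n) (fun j => f (@ord_max k)).
  rewrite /chains_cell /= => E.
  apply: etrans E _; congr existT; congr pull; apply: funext => j.
  rewrite leq_ord /last_map; congr chain_map.
  by rewrite (ordarrE (le_max (f ord_max))); apply: ordarrow_eq.
Qed.

Definition collage_nerve : smap (diag (nerve (groth Y))) (collage Y) :=
  @SMap (diag (nerve (groth Y))) (collage Y) (fun m F => inr (nerve_chain F)) nerve_chain_act.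

Lemma collage_ret_nerve m (F : diag (nerve (groth Y)) m) :
  collage_ret Y m (collage_nerve m F) = rho Y (fun=> m) F.
Proof.
apply: etrans _ (esym (mact_projT2 (Y := Y) (z := last_cell F) (Defs.path_map F))).
congr pull; apply: funext => j; apply: funext => a; rewrite /last_vtx /of_hom /=.
rewrite ffunE /path_last dcastE leq_ord (ordarrE (le_max (inord (minn a m)))).
rewrite (_ : mkordarrow _ = to_max (inord (minn a m))); last exact: ordarrow_eq.
by rewrite /chain_map /=; apply: of_hom_val; rewrite path_arrow_dom.
Qed.

(** With [nerve_chain_inj], this identifies the source of rho with the simplicial subset of chains
    of objects. *)
Lemma nerve_chain_ob m (c : vchain Y m) : (forall a, is_ob c a) ->
  exists F : diag (nerve (groth Y)) m, nerve_chain F = c.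
Proof.
move=> c_ob; pose K := chain_functor c_ob.
pose F : diag (nerve (groth Y)) m :=
  @chains_nfunctor n Y (fun=> m) K (lastz c) (chain_lastE c_ob).
have path_F (j : 'I_n) (u : ordarrow m) : @path_arrow n Y (fun=> m) F j u = far (K j) u.
  exact: (@path_cell_in n (fun=> m) j u (K j)).
exists F; rewrite -[RHS](functors_chainK c_ob).
have KE : path_functor F = K.
  apply: fext => j; apply: functor_eq.
    apply: funext => a; rewrite /= /path_ob path_F; exact: (fun_dom (fstr (K j))).
  by apply: funext => u; exact: path_F.
have zE : last_cell F = lastz c.
  rewrite /last_cell /= /chains_cell /=.
  rewrite (_ : (fun j => last_map (K j) (@last_pt n (fun=> m) j)) =
    fun j => minn^~ (projT1 (lastz c) j)).
    transitivity (existT (fun k => Y k) (projT1 (lastz c))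
      (pull (projT1 (lastz c)) (fun j => minn^~ (projT1 (lastz c) j)) (lastz c))).
      apply: cell_pull => //; apply: funext => j; exact: esym (chain_lastE c_ob j).
    by rewrite pull_id; case: (lastz c).
  apply: funext => j; rewrite chain_lastE /last_map.
  by rewrite -(chain_map_id (K j)); congr chain_map; apply: ordarrow_eq.
apply: vchain_eq => [//||a b j ab|] //=.
  exact: (congr1 (fun (L : 'I_n -> cat_functor (ordcat m) Delta) a j => fob (L j) a) KE).
rewrite ab.
exact: (congr1 (fun L : 'I_n -> cat_functor (ordcat m) Delta => chain_map (L j) (ordarr a b)) KE).
Qed.

Lemma darrow_eq (f g : darrow) : dsrc f = dsrc g -> dtgt f = dtgt g ->
  of_hom (dmap f) = of_hom (dmap g) -> f = g.
Proof.
case: f g => [k l f] [k' l' g] /= E1 E2; subst k' l' => E.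
by rewrite -(to_of_hom f) E to_of_hom.
Qed.

Lemma nerve_chain_inj m (F G : diag (nerve (groth Y)) m) :
  nerve_chain F = nerve_chain G -> F = G.
Proof.
move=> E; have obE j : fob (path_functor F j) = fob (path_functor G j).
  by apply: funext => a; exact: (congr1 (fun c : vchain Y m => dim c a j) E).
have KE : path_functor F = path_functor G.
  apply: fext => j; apply: functor_eq => //; apply: funext => u.
  apply: darrow_eq; rewrite ?chain_src ?chain_tgt ?obE //.
  have := congr1 (fun c : vchain Y m => mp c (val u).1 (val u).2 j) E.
  by rewrite /= (valP u) ordarr_val.
have zE : last_cell F = last_cell G := congr1 (fun c : vchain Y m => lastz c) E.
by apply: nfunctor_eq => e x; rewrite !nerve_cellE KE zE.
Qed.

End Injection.

(** * Nondegenerate chains *)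

Lemma clamped0 k f : clamped k 0 f -> f = fun=> 0.
Proof. by case=> _ H _; apply: funext => x; have := H x; rewrite leqn0 => /eqP. Qed.

Lemma clamped_cst l f : clamped 0 l f -> f = fun=> f 0.
Proof. by case=> _ _ H; apply: funext => x; rewrite -(H x) minn0. Qed.

Lemma clamped_comp_id k l f : clamped k l f -> f \o minn^~ k = f.
Proof. by case=> _ _ H; apply: funext => x /=; rewrite H. Qed.

Lemma clamped_id_comp k l f : clamped k l f -> minn^~ l \o f = f.
Proof. by move=> H; apply: funext => x /=; rewrite (clamped_minl _ H). Qed.

Lemma lift_leq m (i : 'I_m.+2) (a b : 'I_m.+1) : (lift i a <= lift i b) = (a <= b).
Proof. by rewrite /= leq_bump2. Qed.

Lemma lift_leql m (i : 'I_m.+2) (a : 'I_m.+1) : (lift i a <= i) = (a < i).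
Proof. by rewrite /= /bump; lia. Qed.

Lemma lift_leqr m (i : 'I_m.+2) (a : 'I_m.+1) : (i <= lift i a) = (i <= a).
Proof. by rewrite /= /bump; lia. Qed.

Lemma lift_max m (i : 'I_m.+2) : i != ord_max -> lift i ord_max = ord_max.
Proof.
rewrite -val_eqE /= => ne; apply: val_inj => /=; have := ltn_ord i.
rewrite /bump; lia.
Qed.

Section Chains.
Variables (n : nat) (Y : msset n).

Section OneChain.
Variables (m : nat) (c : vchain Y m).
Let P := vchP c.

Lemma vtx_le (a b : 'I_m.+1) : a <= b -> ~~ is_ob c b -> ~~ is_ob c a.
Proof. by move=> ab; apply: contra; exact: (ob_le P). Qed.

Lemma mp_to_vtx (a b : 'I_m.+1) j : ~~ is_ob c b -> mp c a b j = fun=> 0.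
Proof.
move=> bv; have [ab|ba] := leqP a b; last exact: (mp_gt P).
by have := mp_clamped P j ab; rewrite (dim_vtx P j bv) => /clamped0.
Qed.

Lemma mp_vtx_cst (a b : 'I_m.+1) j : ~~ is_ob c a -> a <= b ->
  mp c a b j = fun=> mp c a b j 0.
Proof.
by move=> av ab; have := mp_clamped P j ab; rewrite (dim_vtx P j av) => /clamped_cst.
Qed.

Definition deg_ob (a b : 'I_m.+1) : Prop :=
  dim c a = dim c b /\ forall j, mp c a b j = minn^~ (dim c b j).

Definition deg_vtx (a b : 'I_m.+1) : Prop :=
  forall d j, is_ob c d -> mp c a d j 0 = mp c b d j 0.

Lemma deg_act (a b : 'I_m.+1) : b = a.+1 :> nat ->
  (is_ob c a /\ deg_ob a b) \/ (~~ is_ob c b /\ deg_vtx a b) ->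
  (inr c : collage Y m) = sact (collage Y) (merge m a) (inr c).
Proof.
move=> ba H; have am : a < m by have := ltn_ord b; lia.
have ab : a <= b by lia.
have mE x : merge m a x = if x == a then b else x.
  by apply: val_inj; rewrite /= mergeE -val_eqE /= am andbT; case: eqP.
have maxE : merge m a ord_max = ord_max.
  by rewrite mE; case: eqP => // /(congr1 val) /=; lia.
have obE : is_ob c a = is_ob c b.
  case: H => [[oa _]|[nb _]]; first by rewrite oa (ob_le P ab oa).
  by rewrite (negbTE nb) (negbTE (vtx_le ab nb)).
have dimE : dim c a = dim c b.
  case: H => [[_ []]//|[nb _]].
  by apply: funext => j; rewrite !(dim_vtx P) // (vtx_le ab nb).
have inE (x : 'I_m.+1) j : x <= a -> mp c x a j = mp c x b j.
  move=> xa; case: H => [[oa [_ Hf]]|[nb _]]; last first.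
    by rewrite !mp_to_vtx // (vtx_le ab nb).
  by rewrite (mp_comp P j xa ab oa) Hf -dimE (clamped_id_comp (mp_clamped P j xa)).
have outE (y : 'I_m.+1) j : b <= y -> mp c a y j = mp c b y j.
  move=> yb; case: H => [[oa [_ Hf]]|[nb Hv]].
    by rewrite (mp_comp P j ab yb) -?obE // Hf (clamped_comp_id (mp_clamped P j yb)).
  have [oy|ny] := boolP (is_ob c y); last by rewrite !mp_to_vtx.
  rewrite (mp_vtx_cst j nb yb) (mp_vtx_cst j (vtx_le ab nb) (leq_trans ab yb)).
  by rewrite Hv.
have H1 : is_ob c (merge m a ord_max) by rewrite maxE; exact: ob_max P.
rewrite [RHS](collage_act_ob H1); congr inr; apply: vchain_eq => /= [||x y j xy|].
- by apply: funext => x; rewrite mE; case: eqP => // ->.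
- by apply: funext => x; rewrite mE; case: eqP => // ->.
- rewrite xy !mE; have [xa|xa] := eqVneq x a; have [ya|ya] := eqVneq y a => //.
  + by subst x y; rewrite !(mp_id P) dimE.
  + subst x; apply: outE; move: ya; rewrite -val_eqE /=; lia.
  + by subst y; apply: inE.
- rewrite maxE -(dim_last P).
  have -> : mp c ord_max ord_max = fun j => minn^~ (projT1 (lastz c) j).
    by apply: funext => j; rewrite (mp_id P) (dim_last P).
  by rewrite pull_id; case: (lastz c).
Qed.

Lemma act_deg (a b : 'I_m.+1) : b = a.+1 :> nat ->
  (inr c : collage Y m) = sact (collage Y) (merge m a) (inr c) ->
  (is_ob c a -> deg_ob a b) /\ (~~ is_ob c b -> deg_vtx a b).
Proof.
move=> ba; have am : a < m by have := ltn_ord b; lia.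
have ab : a <= b by lia.
have mE x : merge m a x = if x == a then b else x.
  by apply: val_inj; rewrite /= mergeE -val_eqE /= am andbT; case: eqP.
have maxE : merge m a ord_max = ord_max.
  by rewrite mE; case: eqP => // /(congr1 val) /=; lia.
have H1 : is_ob c (merge m a ord_max) by rewrite maxE; exact: ob_max P.
rewrite [X in _ = X](collage_act_ob H1) => -[E].
have Eob : is_ob c = fun x => is_ob c (merge m a x) := congr1 (fun d : vchain Y m => is_ob d) E.
have Edim : dim c = fun x => dim c (merge m a x) := congr1 (fun d : vchain Y m => dim d) E.
have Emp (x y : 'I_m.+1) j : x <= y -> mp c x y j = mp c (merge m a x) (merge m a y) j.
  by move=> xy; have := congr1 (fun d : vchain Y m => mp d x y j) E; rewrite /= xy.
have outE (y : 'I_m.+1) j : b <= y -> mp c a y j = mp c b y j.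
  move=> yb; rewrite Emp; last by lia.
  by rewrite !mE eqxx; case: eqP => // /(congr1 val) /=; lia.
split=> [oa|nb].
  split; first by rewrite Edim mE eqxx mE; case: eqP => // /(congr1 val) /=; lia.
  by move=> j; rewrite outE // (mp_id P).
move=> d j od; rewrite outE //; rewrite leqNgt; apply/negP => db.
by move: nb; rewrite (ob_le P (ltnW db) od).
Qed.

(** By [nondegP], degeneracy is invariance under some [merge], which replaces an index by its
    successor. A vertex followed by an object imposes no condition, since [merge] would then change
    [is_ob]. *)
Lemma nondeg_chainP : nondeg (inr c : collage Y m) <->
  forall a b : 'I_m.+1, b = a.+1 :> nat ->
    (is_ob c a -> ~ deg_ob a b) /\ (~~ is_ob c b -> ~ deg_vtx a b).
Proof.
split=> [/nondegP N a b ba|H].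
  have am : a < m by have := ltn_ord b; lia.
  by split=> h D; apply: (N a am); apply: (deg_act ba); [left | right].
apply/nondegP => a am E.
have a1 : a < m.+1 by lia.
have b1 : a.+1 < m.+1 by lia.
have [D1 D2] := @act_deg (Ordinal a1) (Ordinal b1) erefl E.
have [N1 N2] := H (Ordinal a1) (Ordinal b1) erefl.
have [oa|na] := boolP (is_ob c (Ordinal a1)); first exact: N1 (D1 oa).
have [ob|nb] := boolP (is_ob c (Ordinal b1)); last exact: N2 (D2 nb).
have maxE : merge m a ord_max = ord_max.
  by apply: val_inj; rewrite /= mergeE am andbT; case: eqP => [/= E'|//]; lia.
have H1 : is_ob c (merge m a ord_max) by rewrite maxE; exact: ob_max P.
move: E; rewrite [X in _ = X](collage_act_ob H1) => -[E].
have := congr1 (fun d : vchain Y m => is_ob d (Ordinal a1)) E.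
rewrite /= (_ : merge m a _ = Ordinal b1) ?(negbTE na) ?ob //.
by apply: val_inj; rewrite /= mergeE eqxx am.
Qed.

End OneChain.

Section Face.
Variables (m : nat).
Implicit Types (c : vchain Y m.+1) (i : 'I_m.+2).

Lemma face_ob c i : i != ord_max -> is_ob c (dface i ord_max).
Proof. by move=> ne; rewrite dfaceE lift_max //; exact: ob_max (vchP c). Qed.

Lemma face_act_eq c i (d : vchain Y m) :
  sact (collage Y) (dface i) (inr c) = inr d ->
  [/\ forall a, is_ob d a = is_ob c (lift i a),
      forall a, dim d a = dim c (lift i a),
      forall (a b : 'I_m.+1) j, a <= b -> mp d a b j = mp c (lift i a) (lift i b) j &
      i != ord_max -> lastz d = lastz c].
Proof.
have [H|H] := boolP (is_ob c (dface i ord_max)); last first.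
  by rewrite [LHS](collage_act_vtx H).
rewrite [LHS](collage_act_ob H) => -[<-]; split=> /= [a|a|a b j ab|ne]; rewrite ?dfaceE //.
- by rewrite ab.
- rewrite lift_max //; have P := vchP c; rewrite -(dim_last P).
  have -> : mp c ord_max ord_max = fun j => minn^~ (projT1 (lastz c) j).
    by apply: funext => j; rewrite (mp_id P) (dim_last P).
  by rewrite pull_id; case: (lastz c).
Qed.

End Face.

(** * Insertion of an index in a chain, and nondegeneracy of faces *)

Section Insert.
Variables (m : nat) (c : vchain Y m) (i : 'I_m.+2) (bi : bool) (ki : 'I_n -> nat).
Variables (inm outm : 'I_m.+1 -> 'I_n -> nat -> nat) (zz : {k & Y k}).
Let P := vchP c.

(** The new index sits at position [i] and is an object or a vertex according to [bi]; [inm] gives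
    the maps into it and [outm] those out of it. The element [zz] can differ from that of [c] only
    if the new index is the last one. *)
Definition insert_chain : chain Y m.+1 := Chain
  (fun a => if unlift i a is Some a' then is_ob c a' else bi)
  (fun a => if unlift i a is Some a' then dim c a' else ki)
  (fun a b j => if a <= b then
     match unlift i a, unlift i b with
     | Some a', Some b' => mp c a' b' j
     | Some a', None => inm a' j
     | None, Some b' => outm b' j
     | None, None => minn^~ (ki j)
     end else fun=> 0) zz.

Hypothesis ob_before : forall a : 'I_m.+1, a < i -> is_ob c a -> bi.
Hypothesis ob_after : forall a : 'I_m.+1, i <= a -> bi -> is_ob c a.
Hypothesis ob_last : i = ord_max -> bi.
Hypothesis ki_vtx : forall j, ~~ bi -> ki j = 0.
Hypothesis zz_last : if i == ord_max then projT1 zz = ki else zz = lastz c.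
Hypothesis in_clamped : forall (a : 'I_m.+1) j, a < i -> clamped (dim c a j) (ki j) (inm a j).
Hypothesis out_clamped : forall (a : 'I_m.+1) j, i <= a -> clamped (ki j) (dim c a j) (outm a j).
Hypothesis in_comp : forall (a b : 'I_m.+1) j, a <= b -> b < i -> is_ob c b ->
  inm a j = inm b j \o mp c a b j.
Hypothesis out_comp : forall (a b : 'I_m.+1) j, i <= a -> a <= b -> is_ob c a ->
  outm b j = mp c a b j \o outm a j.
Hypothesis in_out : forall (a b : 'I_m.+1) j, a < i -> i <= b -> bi ->
  mp c a b j = outm b j \o inm a j.
Hypothesis in_vtx : forall (a b : 'I_m.+1) j, a <= b -> b < i -> ~~ is_ob c b ->
  inm a j 0 <= inm b j 0.
Hypothesis out_vtx : forall (a b : 'I_m.+1) j, i <= a -> a <= b -> ~~ is_ob c a ->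
  outm b j 0 <= mp c a b j 0.
Hypothesis in_out_vtx : forall (a b : 'I_m.+1) j, a < i -> i <= b -> ~~ bi ->
  mp c a b j 0 <= outm b j 0.

Lemma insert_ok : chain_ok insert_chain.
Proof.
split=> /=.
- have [iE|ne] := eqVneq i ord_max; first by rewrite iE unlift_none ob_last.
  by rewrite -(lift_max ne) liftK (ob_max P).
- move=> a b; case: (unliftP i a) => [a' ->|->]; case: (unliftP i b) => [b' ->|->] //.
  + by rewrite lift_leq; exact: ob_le.
  + by rewrite lift_leql; exact: ob_before.
  + by rewrite lift_leqr; exact: ob_after.
- move=> a j; case: (unliftP i a) => [a' _|_]; [exact: dim_vtx | exact: ki_vtx].
- have [iE|ne] := eqVneq i ord_max.
    by move: zz_last; rewrite iE eqxx unlift_none.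
  by move: zz_last; rewrite (negbTE ne) -(lift_max ne) liftK => ->; exact: dim_last P.
- move=> a b j ab; rewrite ab.
  move: ab; case: (unliftP i a) => [a' ->|->]; case: (unliftP i b) => [b' ->|->] //.
  + by rewrite lift_leq; exact: (mp_clamped P).
  + by rewrite lift_leql; exact: in_clamped.
  + by rewrite lift_leqr; exact: out_clamped.
  + by move=> _; exact: clamped_id.
- move=> a j; rewrite leqnn; case: (unliftP i a) => [a' _|_] //; exact: (mp_id P).
- move=> a b d j ab bd; rewrite ab bd (leq_trans ab bd).
  move: ab bd; case: (unliftP i a) => [a' ->|->]; case: (unliftP i b) => [b' ->|->];
    case: (unliftP i d) => [d' ->|->]; rewrite ?lift_leq ?lift_leql ?lift_leqr.
  + exact: (mp_comp P).
  + exact: in_comp.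
  + exact: in_out.
  + by move=> ai _ _; rewrite (clamped_id_comp (in_clamped j ai)).
  + exact: out_comp.
  + by move=> ib bi'; lia.
  + by move=> _ id _; rewrite (clamped_comp_id (out_clamped j id)).
  + by move=> _ _ _; apply: funext => x /=; rewrite -minnA minnn.
- move=> a b d j ab bd; rewrite bd (leq_trans ab bd).
  move: ab bd; case: (unliftP i a) => [a' ->|->]; case: (unliftP i b) => [b' ->|->];
    case: (unliftP i d) => [d' ->|->]; rewrite ?lift_leq ?lift_leql ?lift_leqr.
  + exact: (mp_vtx P).
  + exact: in_vtx.
  + exact: in_out_vtx.
  + move=> ai _ bv; have [_ H _] := in_clamped j ai.
    by have := H 0; rewrite ki_vtx.
  + exact: out_vtx.
  + by move=> ib bi'; lia.
  + by [].
  + by [].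
- by move=> a b j ba; rewrite leqNgt ba.
Qed.

Definition insert := VChain insert_ok.

Lemma insert_face : (i = ord_max -> bi ->
    is_ob c ord_max /\ existT _ (dim c ord_max) (pull (dim c ord_max) (inm ord_max) zz) = lastz c) ->
  sact (collage Y) (dface i) (inr insert) = inr c.
Proof.
move=> Hmax; have H : is_ob insert (dface i ord_max).
  by rewrite dfaceE /= liftK; exact: ob_max P.
rewrite [LHS](collage_act_ob H); congr inr; apply: vchain_eq => /= [||a b j ab|].
- by apply: funext => a; rewrite dfaceE liftK.
- by apply: funext => a; rewrite dfaceE liftK.
- by rewrite ab !dfaceE lift_leq ab !liftK.
- rewrite !dfaceE leq_ord liftK.
  have [iE|ne] := eqVneq i ord_max.
    have [_ <-] := Hmax iE (ob_last iE); congr existT; congr pull.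
    by apply: funext => j; rewrite iE unlift_none.
  have [z1 z2] : zz = lastz c /\ unlift i ord_max = Some ord_max.
    move: zz_last; rewrite (negbTE ne) => ->; split=> //.
    by rewrite -[X in unlift i X](lift_max ne) liftK.
  rewrite z1 -(dim_last P).
  rewrite (_ : (fun j => _) = fun j => minn^~ (projT1 (lastz c) j)).
    by rewrite pull_id; case: (lastz c).
  by apply: funext => j; rewrite z2 (mp_id P) (dim_last P).
Qed.

Lemma insert_ob_lift a : is_ob insert (lift i a) = is_ob c a.
Proof. by rewrite /= liftK. Qed.

Lemma insert_ob_self : is_ob insert i = bi.
Proof. by rewrite /= unlift_none. Qed.

Lemma insert_dim_self : dim insert i = ki.
Proof. by rewrite /= unlift_none. Qed.

Lemma insert_in (a : 'I_m.+1) j : a < i -> mp insert (lift i a) i j = inm a j.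
Proof. by move=> ai; rewrite /= lift_leql ai liftK unlift_none. Qed.

Lemma insert_out (a : 'I_m.+1) j : i <= a -> mp insert i (lift i a) j = outm a j.
Proof. by move=> ia; rewrite /= lift_leqr ia liftK unlift_none. Qed.

End Insert.
Lemma first_ob m (c : vchain Y m) :
  exists2 e : 'I_m.+1, is_ob c e & forall a, is_ob c a = (e <= a).
Proof.
case: (@arg_minnP _ ord_max (fun a => is_ob c a) (fun a => nat_of_ord a)).
  exact: ob_max (vchP c).
move=> e oe Hmin; exists e => // a; apply/idP/idP; first exact: Hmin.
by move=> ea; exact: (ob_le (vchP c) ea oe).
Qed.

Section FaceNondeg.
Variables (m : nat) (c : vchain Y m.+1) (i : 'I_m.+2) (d : vchain Y m).
Hypothesis cd : sact (collage Y) (dface i) (inr c) = inr d.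

Lemma lift_adj (a b : 'I_m.+1) : lift i b = (lift i a).+1 :> nat -> b = a.+1 :> nat.
Proof. by rewrite /= /bump; lia. Qed.

(** A degeneracy between two consecutive indices other than [i] survives in the face, so only the
    pairs containing [i] remain to be checked. *)
Lemma nondeg_unface : nondeg (inr d : collage Y m) ->
  (forall a b : 'I_m.+2, b = a.+1 :> nat -> (a == i) || (b == i) ->
     (is_ob c a -> ~ deg_ob c a b) /\ (~~ is_ob c b -> ~ deg_vtx c a b)) ->
  nondeg (inr c : collage Y m.+1).
Proof.
move=> /nondeg_chainP N H; apply/nondeg_chainP => a b ba.
have [ob_ dim_ mp_ _] := face_act_eq cd.
case: (unliftP i a) => [a' aE|aE]; last by apply: H => //; rewrite aE eqxx.
case: (unliftP i b) => [b' bE|bE]; last by apply: H => //; rewrite bE eqxx orbT.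
subst a b; have ba' := lift_adj ba; have ab' : a' <= b' by rewrite ba'.
have [N1 N2] := N a' b' ba'; split.
- rewrite -ob_ => oa [D1 D2]; apply: N1 => //.
  by split=> [|j]; rewrite ?mp_ ?dim_.
- rewrite -ob_ => ob D; apply: N2 => // x j ox.
  have bx : b' <= x by rewrite leqNgt; apply/negP => xb; move: ob; rewrite (ob_le (vchP d) (ltnW xb) ox).
  rewrite !mp_ //; last exact: leq_trans ab' bx.
  by apply: D; rewrite -ob_.
Qed.

(** Removing [i] can create a degeneracy in two ways: between its two neighbours, which become
    consecutive, or between two vertices that were separated only by the object [i]. The two
    hypotheses exclude these. *)
Lemma nondeg_face : nondeg (inr c : collage Y m.+1) ->
  (forall a b : 'I_m.+1, b = a.+1 :> nat -> b = i :> nat ->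
     (is_ob d a -> ~ deg_ob d a b) /\ (~~ is_ob d b -> ~ deg_vtx d a b)) ->
  (forall a b : 'I_m.+1, b = a.+1 :> nat -> b < i -> ~~ is_ob d b -> is_ob c i -> deg_vtx d a b ->
     forall j, mp c (lift i a) i j 0 = mp c (lift i b) i j 0) ->
  nondeg (inr d : collage Y m).
Proof.
move=> /nondeg_chainP N H1 H2; apply/nondeg_chainP => a b ba.
have [bi|bi] := eqVneq (b : nat) i; first exact: H1.
have [ob_ dim_ mp_ _] := face_act_eq cd; have ab : a <= b by rewrite ba.
have lba : lift i b = (lift i a).+1 :> nat by rewrite /= /bump; lia.
have [N1 N2] := N _ _ lba; split.
- rewrite ob_ => oa [D1 D2]; apply: N1 => //.
  by split=> [|j]; rewrite -?mp_ -?dim_ //.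
- move=> nb D; apply: N2; first by rewrite -ob_.
  move=> x j; case: (unliftP i x) => [x' ->|->] ox.
    have bx : b <= x'.
      by rewrite leqNgt; apply/negP => xb; move: nb; rewrite ob_ (ob_le (vchP c) _ ox) // lift_leq ltnW.
    rewrite -!mp_ //; last exact: leq_trans ab bx.
    by apply: D; rewrite ob_.
  have b_i : b < i.
    rewrite ltnNge; apply/negP => ib; move: nb; rewrite ob_ (ob_le (vchP c) _ ox) //.
    by rewrite lift_leqr.
  exact: H2.
Qed.

End FaceNondeg.
End Chains.

(** * The target is a deformation retract of the collage *)

Section TopVertex.
Variables (n : nat) (Y : msset n).

Definition in_base m (x : collage Y m) : Prop := exists y, x = inl y.

Lemma in_base_act k m (f : dhom k m) (x : collage Y m) :
  in_base x -> in_base (sact (collage Y) f x).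
Proof. by case=> y ->; eexists. Qed.

(** Here [a] is necessarily the last vertex and [b] the first object; [a] is the vertex that the
    matching removes. *)
Definition top_at m (c : chain Y m) (a b : 'I_m.+1) : Prop :=
  [/\ b = a.+1 :> nat, ~~ is_ob c a, is_ob c b & forall j, mp c a b j 0 = dim c b j].

Definition top_upper m (x : collage Y m.+1) (i : 'I_m.+2) : Prop :=
  exists (c : vchain Y m.+1) (i1 : 'I_m.+2),
    [/\ x = inr c, nondeg x & top_at c i i1].

Definition top_rank m (x : collage Y m.+1) : nat :=
  if x is inr c then \sum_(a < m.+2) is_ob c a else 0.

Lemma top_rank_bound m (x : collage Y m.+1) : top_rank x <= (m + 4) ^ 2.
Proof.
case: x => [//|c] /=; apply: (@leq_trans (\sum_(a < m.+2) 1)).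
  by apply: leq_sum => a _; case: is_ob.
by rewrite sum1_card card_ord; nia.
Qed.

Lemma top_upper_face m (x : collage Y m.+1) i i' : top_upper x i -> top_upper x i' -> i = i'.
Proof.
case=> c [i1 [-> _ [i1E ni oi _]]] [c' [i1' [[<-] _ [i1'E ni' oi' _]]]].
apply: val_inj => /=; have P := vchP c.
have H (a b : 'I_m.+2) : ~~ is_ob c a -> is_ob c b -> a < b.
  by move=> na ob; rewrite ltnNge; apply: contra na => ba; exact: (ob_le P ba ob).
by have := H _ _ ni oi'; have := H _ _ ni' oi; lia.
Qed.

Lemma top_ne_max m (c : chain Y m) (a b : 'I_m.+1) : top_at c a b -> a != ord_max.
Proof. by case=> bE _ _ _; rewrite -val_eqE /=; have := ltn_ord b; lia. Qed.

Lemma top_face m (c : vchain Y m.+1) (i i1 : 'I_m.+2) : top_at c i i1 ->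
  exists2 d, sact (collage Y) (dface i) (inr c) = inr d & forall a, is_ob d a = (i <= a).
Proof.
move=> T; have H := face_ob c (top_ne_max T); exists (vchain_act H); first exact: collage_act_ob.
have [i1E ni oi _] := T.
move=> a; rewrite /= dfaceE; apply/idP/idP.
  by rewrite -lift_leqr; move=> oa; rewrite leqNgt; apply: contra ni => ai;
     exact: (ob_le (vchP c) (ltnW ai) oa).
by move=> ia; apply: (ob_le (vchP c) _ oi); rewrite i1E /= /bump; lia.
Qed.

(** Another vertex at the top of the first object would have the same image there as the removed
    one, hence also in all later objects, and [c] would be degenerate. *)
Lemma top_notop m (c : vchain Y m.+1) (i i1 : 'I_m.+2) (d : vchain Y m) :
  nondeg (inr c : collage Y m.+1) -> top_at c i i1 ->
  sact (collage Y) (dface i) (inr c) = inr d -> forall a b, ~ top_at d a b.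
Proof.
move=> /nondeg_chainP N T cd a b [ba na ob tb].
have [d' cd' ob_] := top_face T; move: cd'; rewrite cd => -[E]; subst d'.
have [_ dim_ mp_ _] := face_act_eq cd; have [i1E ni oi ti] := T.
have bi : b = i :> nat by move: na ob; rewrite !ob_; lia.
have bE : lift i b = i1 by apply: val_inj; rewrite /= /bump; lia.
have aE : i = (lift i a).+1 :> nat by rewrite /= /bump; lia.
have [_ N2] := N _ _ aE; apply: N2 => // x j ox.
have ix : i1 <= x.
  by rewrite leqNgt; apply/negP => xi; move: ni; rewrite (ob_le (vchP c) _ ox) //; lia.
have ai : lift i a <= i1 by rewrite -bE lift_leq; lia.
have ii : i <= i1 by lia.
rewrite (mp_comp (vchP c) j ai ix oi) (mp_comp (vchP c) j ii ix oi) /=.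
by rewrite -bE -mp_ ?tb ?dim_ ?bE ?ti //; lia.
Qed.

Lemma top_lower_nondeg m (x : collage Y m.+1) i :
  top_upper x i -> nondeg (sact (collage Y) (dface i) x).
Proof.
case=> c [i1 [-> N T]]; have [d cd ob_] := top_face T; rewrite cd.
apply: (nondeg_face cd) => //.
- by move=> a b ba bi; rewrite !ob_; split; lia.
- by have [_ ni _ _] := T; move=> a b _ _ _ oi; rewrite oi in ni.
Qed.

(** The face determines the removed vertex: its position is that of the first object, and its images
    in all objects come from the top of that one. *)
Lemma top_lower_inj m (x x' : collage Y m.+1) i i' : top_upper x i -> top_upper x' i' ->
  sact (collage Y) (dface i) x = sact (collage Y) (dface i') x' -> x = x'.
Proof.
case=> c [i1 [-> N T]] [c' [i1' [-> N' T']]].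
have [d cd ob_] := top_face T; have [d' cd' ob'_] := top_face T'.
rewrite cd cd' => -[E]; subst d'.
have ii : i = i'.
  have [i1E _ _ _] := T; have [i1'E _ _ _] := T'; apply: val_inj => /=.
  have hi : i < m.+1 by have := ltn_ord i1; lia.
  have hi' : i' < m.+1 by have := ltn_ord i1'; lia.
  have := ob_ (Ordinal hi); rewrite ob'_ /= leqnn => H1.
  by have := ob_ (Ordinal hi'); rewrite ob'_ /= leqnn => H2; lia.
subst i'; have [H1 H2 H3 H4] := face_act_eq cd; have [H1' H2' H3' H4'] := face_act_eq cd'.
have [i1E ni oi ti] := T; have [i1'E ni' oi' ti'] := T'.
have e1 : i1' = i1 by apply: val_inj; rewrite /= i1E i1'E.
subst i1'; have ne := top_ne_max T.
have i1i : i <= i1 by lia.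
have hi : i < m.+1 by have := ltn_ord i1; lia.
have i1L : i1 = lift i (Ordinal hi) by apply: val_inj; rewrite /= /bump leqnn i1E.
congr inr; apply: vchain_eq => [||a b j|]; last by rewrite -H4 // -H4'.
- apply: funext => a; case: (unliftP i a) => [a' ->|->]; first by rewrite -H1 -H1'.
  by rewrite (negbTE ni) (negbTE ni').
- apply: funext => a; case: (unliftP i a) => [a' ->|->]; first by rewrite -H2 -H2'.
  by apply: funext => j; rewrite !(dim_vtx (vchP _)).
- case: (unliftP i b) => [b' ->|->]; last by move=> _; rewrite !mp_to_vtx.
  case: (unliftP i a) => [a' ->|->]; rewrite ?lift_leq => ab; first by rewrite -H3 // -H3'.
  have ib : i1 <= lift i b' by move: (neq_lift i b') ab; rewrite -val_eqE i1E /=; lia.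
  rewrite (mp_comp (vchP c) j i1i ib oi) (mp_comp (vchP c') j i1i ib oi').
  rewrite (mp_vtx_cst j ni i1i) (mp_vtx_cst j ni' i1i) ti ti' i1L.
  rewrite -H2 -H2' -H3 -?H3' //; move: ib; rewrite i1L lift_leq //.
Qed.

Lemma top_lower_upper m (x : collage Y m.+2) i : top_upper x i ->
  forall i', ~ top_upper (sact (collage Y) (dface i) x) i'.
Proof.
case=> c [i1 [-> N T]] i' [d [i1' [cd _ T']]].
exact: (top_notop N T cd T').
Qed.

(** If [j] were a vertex, the common face would still have the vertex at the top, which [top_notop]
    forbids. So [j] is an object, whereas [x'] only has one vertex more than the face: [x'] has one
    object fewer than [x]. *)
Lemma top_rank_lt m (x x' : collage Y m.+1) i i' j : top_upper x i -> top_upper x' i' ->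
  j != i -> sact (collage Y) (dface j) x = sact (collage Y) (dface i') x' ->
  top_rank x' < top_rank x.
Proof.
case=> c [i1 [-> N T]] [c' [i1' [-> N' T']]] ji.
have [d cd ob_] := top_face T'; rewrite cd => jd.
have [H1 _ _ _] := face_act_eq cd; have [H2 H3 H4 _] := face_act_eq jd.
have [_ ni' _ _] := T'; have [i1E ni oi ti] := T.
rewrite /= [X in X < _](bigD1_ord i') //= [X in _ < X](bigD1_ord j) //= (negbTE ni') add0n.
rewrite (eq_bigr (fun a => is_ob c (lift j a) : nat)); last by move=> a _; rewrite -H1 H2.
suff -> : is_ob c j by [].
apply/negPn/negP => nj; have jlt : j < i.
  have : j < i1 by rewrite ltnNge; apply: contra nj => ij; exact: (ob_le (vchP c) ij oi).
  by move: ji; rewrite -val_eqE /=; lia.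
have hi : i.-1 < m.+1 by have := ltn_ord i; lia.
have hi1 : i < m.+1 by have := ltn_ord i1; lia.
apply: (top_notop N' T' cd (a := Ordinal hi) (b := Ordinal hi1)).
have L1 : lift j (Ordinal hi) = i by apply: val_inj; rewrite /= /bump; lia.
have L2 : lift j (Ordinal hi1) = i1 by apply: val_inj; rewrite /= /bump; lia.
split; rewrite ?H2 ?L1 ?L2 //=; first by lia.
by move=> l; rewrite H3 H4 ?L1 ?L2 //=; lia.
Qed.

(** If no vertex is at the top of the first object [e], one is inserted just before [e]. The result
    is nondegenerate, since otherwise the preceding vertex would already be at the top. *)
Lemma top_matched m (x : collage Y m) : nondeg x -> ~ in_base x ->
  (exists (tau : collage Y m.+1) i, top_upper tau i /\ x = sact (collage Y) (dface i) tau) \/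
  (exists k (tau : collage Y k.+1) i, top_upper tau i /\
     existT (fun m => collage Y m) m x = existT _ k.+1 tau).
Proof.
case: x => [y|c] N B; first by case: B; exists y.
have P := vchP c; have [e oe ob_] := first_ob c.
have [[a Ta]|noT] := pselect (exists a, top_at c a e).
  right; case: m c N B e oe ob_ a Ta {P} => [|m] c N B e oe ob_ a Ta.
    by have [+ _ _ _] := Ta; rewrite (ord1 e) (ord1 a).
  by exists m, (inr c), a; split=> //; exists c, e.
left; pose i : 'I_m.+2 := widen_ord (leqnSn m.+1) e.
have ne : i != ord_max by rewrite -val_eqE /=; have := ltn_ord e; lia.
have lie : lift i e = i.+1 :> nat by rewrite /= /bump leqnn.
have H : exists2 t : vchain Y m.+1, sact (collage Y) (dface i) (inr t) = inr c &
    [/\ is_ob t i = false, dim t i = fun=> 0 &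
      forall (d : 'I_m.+1) j, e <= d -> mp t i (lift i d) j = fun=> mp c e d j (dim c e j)].
  (* The image of the new vertex in a later object is that of the last element of [e]. *)
  unshelve eexists (@insert n Y m c i false (fun=> 0) (fun a j => fun=> 0)
    (fun d j => fun=> mp c e d j (dim c e j)) (lastz c) _ _ _ _ _ _ _ _ _ _ _ _ _).
  - by move=> a; rewrite ob_ /=; lia.
  - by [].
  - by move=> iE; rewrite iE eqxx in ne.
  - by [].
  - by rewrite (negbTE ne).
  - by move=> a j _; exact: clamped_const.
  - move=> a j /= ea; apply: clamped_const.
    by have [_ K _] := mp_clamped P j ea; exact: K.
  - by move=> a b j ab; rewrite ob_ /=; lia.
  - move=> a b j /= ea ab oa; apply: funext => x /=.
    by rewrite (mp_comp P j ea ab oa).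
  - by [].
  - by [].
  - by move=> a b j /=; rewrite ob_ => ->.
  - move=> a b j /= ae eb _; have ae' : a <= e by exact: ltnW.
    rewrite (mp_comp P j ae' eb oe) /=; have [K _ _] := mp_clamped P j eb; apply: K.
    by have [_ K _] := mp_clamped P j ae'; exact: K.
  - by apply: insert_face => iE; rewrite iE eqxx in ne.
  - split; [exact: insert_ob_self | exact: insert_dim_self |].
    by move=> d j ed; rewrite insert_out.
have [t tc [nt dt mt]] := H.
have [H1 H2 H3 H4] := face_act_eq tc.
have T : top_at t i (lift i e).
  split; rewrite ?nt // -?H1 // => j.
  by rewrite mt // (mp_id P) -H2 minnn.
exists (inr t), i; split; last by rewrite tc.
exists t, (lift i e); split=> //; apply: (nondeg_unface tc N) => a b ba.
have [_ ni oi ti] := T.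
case/orP => /eqP E; subst.
- have bE : b = lift i e by apply: val_inj; rewrite /= in lie *; rewrite lie ba.
  by rewrite bE nt; split=> //; rewrite oi.
- split.
    by move=> oa; move: nt; rewrite (ob_le (vchP t) _ oa) // ba.
  move=> _ D; apply: noT.
  case: (unliftP i a) ba D => [a' ->|->] ba D; last by lia.
  have ae : e = a'.+1 :> nat by move: ba; rewrite /= /bump; lia.
  exists a'; split=> //; first by rewrite ob_ ae ltnn.
  move=> j; have ab : a' <= e by rewrite ae.
  by rewrite H3 // D // ti -H2.
Qed.

Lemma top_anodyne : anodyne in_base.
Proof.
apply: (@match_anodyne (collage Y) in_base in_base_act top_upper top_rank).
- exact: top_matched.
- by move=> m x i [c [i1 []]].
- exact: top_lower_nondeg.
- by move=> m x i [c [i1 [-> N T]]]; have [d -> _] := top_face T; case.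
- exact: top_upper_face.
- exact: top_lower_inj.
- exact: top_lower_upper.
- exact: top_rank_bound.
- exact: top_rank_lt.
Qed.

End TopVertex.

(** * The source is a deformation retract of the collage *)

Definition onto (l l' : nat) (f : nat -> nat) : Prop :=
  forall y, y <= l' -> exists2 x, x <= l & f x = y.

Lemma onto_dsurj l l' f : clamped l l' f -> onto l l' f -> dsurj (to_hom l l' f).
Proof.
move=> C O b; have [|x xl E] := O b; first by rewrite -ltnS.
have xl' : x < l.+1 by [].
by exists (Ordinal xl'); apply: val_inj; rewrite /= to_homE.
Qed.

Lemma dsurj_onto l l' (s : dhom l l') : dsurj s -> onto l l' (of_hom s).
Proof.
move=> sS y yl; have yl' : y < l'.+1 by [].
have [a E] := sS (Ordinal yl'); exists a; first by rewrite -ltnS.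
by rewrite of_homE E.
Qed.

Lemma onto_inj l l' f : clamped l l' f -> onto l l' f ->
  (forall x x', x <= l -> x' <= l -> f x = f x' -> x = x') ->
  l = l' /\ f = minn^~ l.
Proof.
move=> C O I; have sS := onto_dsurj C O.
have sI a b : to_hom l l' f a = to_hom l l' f b -> a = b.
  move=> /(congr1 val) /=; rewrite !to_homE // => /I E; apply: val_inj; apply: E.
    by rewrite -ltnS.
  by rewrite -ltnS.
have [d [sd _]] := dsurj_section sS ord0.
have dK b : to_hom l l' f (d b) = b.
  by have := congr1 (fun h : dhom l' l' => h b) sd; rewrite dcompE didE.
have ll : l = l'.
  apply/eqP; rewrite eqn_leq; apply/andP; split.
    have : (@ord_max l : nat) <= to_hom l l' f ord_max.
      by apply: dmono_strict => a b ba; apply/eqP => /sI E; move: ba; rewrite E; lia.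
    by move=> h; apply: leq_trans h _; rewrite -ltnS.
  have : (@ord_max l' : nat) <= d ord_max.
    apply: dmono_strict => a b ba; apply/eqP => E; move: ba.
    by rewrite -(dK a) E dK; lia.
  by move=> h; apply: leq_trans h _; rewrite -ltnS.
subst l'; split=> //; rewrite -(of_to_hom C) (dsurj_endo sS); exact: of_hom_id.
Qed.

(** A surjection in Delta is determined by its kernel: for a section g of [f], the composite of [f']
    with g is monotone and bijective, hence an identity. *)
Lemma kernel_onto q l l' f f' : clamped q l f -> clamped q l' f' ->
  onto q l f -> onto q l' f' ->
  (forall x x', x <= q -> x' <= q -> f x = f x' <-> f' x = f' x') ->
  l = l' /\ f = f'.
Proof.
move=> C C' O O' K; have sS := onto_dsurj C O.
have [d [sd _]] := dsurj_section sS ord0; pose g := of_hom d.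
have gC := of_hom_clamped d.
have gq y : g y <= q by case: gC => _ + _; apply.
have fg y : y <= l -> f (g y) = y.
  move=> yl; have := congr1 (fun h => of_hom h y) sd.
  by rewrite of_hom_comp of_to_hom //= of_hom_id => ->; apply/minn_idPl.
have f'f x : x <= q -> f' (g (f x)) = f' x.
  by move=> xq; apply/K => //; apply: fg; case: C => _ + _; apply.
have [ll E] : l = l' /\ f' \o g = minn^~ l.
  apply: onto_inj; first exact: clamped_comp C'.
    move=> y yl; have [x xq <-] := O' y yl; exists (f x) => /=; last exact: f'f.
    by case: C => _ + _; apply.
  move=> x x' xl xl' /= /K E; rewrite -(fg x xl) -(fg x' xl'); exact: E.
subst l'; split=> //; apply: funext => x.
have [_ _ Cx] := C; have [_ _ Cx'] := C'; rewrite -(Cx x) -(Cx' x).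
rewrite -f'f ?geq_minr //; have := congr1 (fun h => h (f (minn x q))) E => /= ->.
by apply/esym/minn_idPl; case: C => _ + _; apply.
Qed.

(** * Diagonal quotients of the simplex of vertices *)

Section QuotientVertex.
Variables (n : nat) (Y : msset n) (j0 : 'I_n).

(* The object a is a diagonal quotient of the simplex of vertices. *)
Definition dquot m (c : chain Y m) (a : 'I_m.+1) (l : nat) : Prop :=
  [/\ is_ob c a, forall j, dim c a j = l,
      forall v j, ~~ is_ob c v -> mp c v a j 0 = mp c v a j0 0 &
      forall x, x <= l -> exists2 v, ~~ is_ob c v & mp c v a j0 0 = x].

(** For an object [a] over (l, ..., l), the maps to the next object form a nondegenerate [l]-simplex
    of a product of standard simplices. When no object follows, [last_nondeg] is the same condition
    for the element of Y, as a simplex of the diagonal. *)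
Definition next_inj m (c : chain Y m) (a : 'I_m.+1) (l : nat) : Prop :=
  forall b : 'I_m.+1, b = a.+1 :> nat -> forall x x', x <= l -> x' <= l ->
  (forall j, mp c a b j x = mp c a b j x') -> x = x'.

Definition last_nondeg m (c : chain Y m) (a : 'I_m.+1) (l : nat) : Prop :=
  a = ord_max -> forall y : diag Y l,
  lastz c = existT (fun k => Y k) (fun=> l) y -> nondeg y.

Section OneChain.
Variables (m : nat) (c : vchain Y m).
Let P := vchP c.

Lemma vtx_lt (v a : 'I_m.+1) : ~~ is_ob c v -> is_ob c a -> v < a.
Proof. by move=> nv oa; rewrite ltnNge; apply: contra nv => av; exact: (ob_le P av oa). Qed.

Lemma mp_through (v a b : 'I_m.+1) j : ~~ is_ob c v -> is_ob c a -> a <= b ->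
  mp c v b j 0 = mp c a b j (mp c v a j 0).
Proof. by move=> nv oa ab; rewrite (mp_comp P j (ltnW (vtx_lt nv oa)) ab oa). Qed.

Lemma dquot_clamped a l j (b : 'I_m.+1) : dquot c a l -> a <= b ->
  clamped l (dim c b j) (mp c a b j).
Proof. by case=> _ E _ _; rewrite -(E j); exact: (mp_clamped P). Qed.

(** Every element of a quotient is the image of a vertex, with the same image in all coordinates, so
    the transition is read off on vertices. *)
Lemma dquot_map (a b : 'I_m.+1) l l' : dquot c a l -> dquot c b l' -> a <= b ->
  [/\ forall j, mp c a b j = mp c a b j0, clamped l l' (mp c a b j0) &
      onto l l' (mp c a b j0)].
Proof.
move=> Da Db ab; have Cl j := dquot_clamped j Da ab.
have [oa da ia sa] := Da; have [ob db ib sb] := Db; split.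
- move=> j; apply: funext => x; have [_ _ Cx] := Cl j; have [_ _ Cx0] := Cl j0.
  rewrite -(Cx x) -(Cx0 x); have [v nv <-] := sa (minn x l) (geq_minr _ _).
  by rewrite -{1}(ia v j nv) -!mp_through // ib.
- by have := Cl j0; rewrite db.
- move=> y yl; have [v nv E] := sb y yl; exists (mp c v a j0 0).
    have [_ + _] := mp_clamped P j0 (ltnW (vtx_lt nv oa)); rewrite da; exact.
  by rewrite -mp_through.
Qed.

Lemma dquot_deg (a b : 'I_m.+1) l l' : dquot c a l -> dquot c b l' -> a <= b ->
  (forall x x', x <= l -> x' <= l -> mp c a b j0 x = mp c a b j0 x' -> x = x') ->
  deg_ob c a b.
Proof.
move=> Da Db ab I; have [E C O] := dquot_map Da Db ab.
have [ll H] := onto_inj C O I; subst l'.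
have [_ da _ _] := Da; have [_ db _ _] := Db; split.
  by apply: funext => j; rewrite da db.
by move=> j; rewrite E H db.
Qed.

Lemma next_inj_deg (a b : 'I_m.+1) l l' : b = a.+1 :> nat ->
  dquot c a l -> dquot c b l' -> next_inj c a l -> deg_ob c a b.
Proof.
move=> ba Da Db I; have ab : a <= b by rewrite ba.
apply: (dquot_deg Da Db ab) => x x' xl xl' E; apply: (I b ba) => // j.
by have [Ej _ _] := dquot_map Da Db ab; rewrite Ej E.
Qed.

Lemma dquot_unique a l l' : dquot c a l -> dquot c a l' -> l = l'.
Proof. by case=> _ E _ _ [_ E' _ _]; rewrite -(E j0) -(E' j0). Qed.

(** If v < w have the same images in the first object [f], so do v and v + 1 by monotonicity. Maps
    from vertices to objects pass through [f], so these two vertices agree in every object. *)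
Lemma first_vtx_inj (f v w : 'I_m.+1) : nondeg (inr c : collage Y m) ->
  (forall a, is_ob c a = (f <= a)) -> v < f -> w < f ->
  (forall j, mp c v f j 0 = mp c w f j 0) -> v = w.
Proof.
move=> /nondeg_chainP N ob_; wlog vw : v w / v < w => [H vf wf E|vf wf E].
  case: (ltngtP v w) => [vw|wv|/val_inj//]; first exact: H.
  by apply: esym; apply: H.
have v1 : v.+1 < m.+1 by have := ltn_ord w; lia.
have nv (x : 'I_m.+1) : x < f -> ~~ is_ob c x by rewrite ob_; lia.
have [_ N2] := N v (Ordinal v1) erefl.
have nv1 : ~~ is_ob c (Ordinal v1) by apply: nv => /=; lia.
exfalso; apply: N2 => // x j ox; have fx : f <= x by rewrite -ob_.
have of_ : is_ob c f by rewrite ob_.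
rewrite (mp_through j (nv v vf) of_ fx) (mp_through j nv1 of_ fx).
have vf1 : v.+1 <= f by lia.
congr (mp c f x j _); apply/eqP; rewrite eqn_leq; apply/andP; split.
  by apply: (mp_vtx P).
rewrite E; exact: (@mp_vtx _ _ _ _ P (Ordinal v1) w f j vw (ltnW wf) (nv w wf)).
Qed.

End OneChain.

Section Face.
Variables (m : nat) (c : vchain Y m.+1) (i : 'I_m.+2) (d : vchain Y m).
Hypothesis cd : sact (collage Y) (dface i) (inr c) = inr d.
Hypothesis oi : is_ob c i.

(** Being a quotient involves only the object and the vertices, and removing the object [i] leaves
    the vertices in place. *)
Lemma dquot_face (a : 'I_m.+1) l : dquot d a l <-> dquot c (lift i a) l.
Proof.
have [ob_ dim_ mp_ _] := face_act_eq cd.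
have mpE v j : ~~ is_ob d v -> is_ob d a -> mp d v a j 0 = mp c (lift i v) (lift i a) j 0.
  by move=> nv oa; rewrite mp_ // ltnW // (vtx_lt nv oa).
have lifted x : ~~ is_ob c x -> exists2 v, ~~ is_ob d v & x = lift i v.
  by case: (unliftP i x) => [v -> nv|->]; [exists v; rewrite ?ob_ | rewrite oi].
split=> -[oa da ia sa]; split.
- by rewrite -ob_.
- by rewrite -dim_.
- by move=> x j /lifted [v nv ->]; rewrite -!mpE // ia.
- by move=> x /sa [v nv <-]; exists (lift i v); rewrite -?ob_ // mpE.
- by rewrite ob_.
- by rewrite dim_.
- move=> v j nv; have oda : is_ob d a by rewrite ob_.
  by rewrite !mpE //; apply: ia; rewrite -ob_.
- by move=> x /sa [w /lifted [v nv ->] <-]; exists v => //; rewrite mpE // ob_.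
Qed.

End Face.
End QuotientVertex.

Lemma existT_inj (A : Type) (T : A -> Type) a (x y : T a) :
  existT T a x = existT T a y -> x = y.
Proof. by move=> E; have := projT2_eq E; rewrite (Prop_irrelevance (projT1_eq E) erefl). Qed.

Section Quotient.
Variables (n : nat) (Y : msset n) (j0 : 'I_n).

Lemma nondeg_inl m (y : diag Y m) : nondeg (inl y : collage Y m) <-> nondeg y.
Proof.
split=> /nondegP N; apply/nondegP => a am E; apply: (N a am).
  by rewrite {1}E.
by case: E.
Qed.

Lemma lastz_const m (c : vchain Y m) l : (forall j, dim c ord_max j = l) ->
  exists y : diag Y l, lastz c = existT (fun k => Y k) (fun=> l) y.
Proof.
move=> H; have := dim_last (vchP c); case: (lastz c) => k z /= kE.
have {}kE : k = fun=> l by rewrite kE; apply: funext.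
by subst k; exists z.
Qed.

Lemma pull_const q l s (f : 'I_n -> nat -> nat) (y : diag Y l) : (forall j, f j = s) ->
  pull (fun=> q) f (existT (fun k => Y k) (fun=> l) y) = sact (diag Y) (to_hom q l s) y.
Proof. by move=> /funext ->. Qed.

Lemma face_lastz m (c : vchain Y m.+1) i (d : vchain Y m) :
  sact (collage Y) (dface i) (inr c) = inr d ->
  lastz d = existT _ (dim d ord_max)
    (pull (dim d ord_max) (mp c (lift i ord_max) ord_max) (lastz c)).
Proof.
have [H|H] := boolP (is_ob c (dface i ord_max)); last by rewrite [LHS](collage_act_vtx H).
by rewrite [LHS](collage_act_ob H) => -[<-] /=; rewrite dfaceE.
Qed.

Definition all_ob m (x : collage Y m) : Prop :=
  exists c : vchain Y m, x = inr c /\ forall a, is_ob c a.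

Lemma all_ob_act k m (f : dhom k m) (x : collage Y m) :
  all_ob x -> all_ob (sact (collage Y) f x).
Proof.
case=> c [-> oc]; exists (vchain_act (oc (f ord_max))); split; last by move=> a; exact: oc.
exact: collage_act_ob.
Qed.

(* The object i is the upper cell's removable one: it ends a run of diagonal
   quotients of the vertices, and is nondegenerate with respect to what follows. *)
Record qupper m (c : vchain Y m) (i : 'I_m.+1) (l : nat) : Prop := QUpper {
  qu_nondeg : nondeg (inr c : collage Y m);
  qu_vtx : ~~ is_ob c ord0;
  qu_le : forall a : 'I_m.+1, a <= i -> is_ob c a -> exists l', dquot j0 c a l';
  qu_dquot : dquot j0 c i l;
  qu_next : next_inj c i l;
  qu_last : last_nondeg c i l
}.

Lemma qu_ob m (c : vchain Y m) i l : qupper c i l -> is_ob c i.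
Proof. by case/qu_dquot. Qed.

Lemma qu_not m (c : vchain Y m) (i b : 'I_m.+1) l l' : qupper c i l -> b = i.+1 :> nat ->
  ~ dquot j0 c b l'.
Proof.
move=> Q bi Db; have /nondeg_chainP N := qu_nondeg Q.
have [N1 _] := N i b bi; apply: (N1 (qu_ob Q)).
exact: (next_inj_deg bi (qu_dquot Q) Db (qu_next Q)).
Qed.

(** By [qu_not] the object after [i] is not a quotient, while [qu_le] for a larger [i'] would make
    it one. *)
Lemma qu_unique m (c : vchain Y m) i i' l l' : qupper c i l -> qupper c i' l' -> i = i'.
Proof.
wlog ii' : i i' l l' / i < i' => [H Q Q'|Q Q'].
  case: (ltngtP i i') => [lt|gt|/val_inj//]; first exact: H Q Q'.
  by apply: esym; exact: H Q' Q.
have i1 : i.+1 < m.+1 by have := ltn_ord i'; lia.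
have oi : is_ob c (Ordinal i1) by apply: (ob_le (vchP c) _ (qu_ob Q)) => /=.
have [l1 D1] := qu_le Q' (a := Ordinal i1) ii' oi.
by case: (qu_not Q _ D1).
Qed.

(** The run of quotients of [d] stops at position [i], possibly past the end. In a lower cell this
    is the place of the removed object, and [run_le] shows that it is determined by [d]. *)
Definition run m (d : vchain Y m) (i : nat) : Prop :=
  (forall a : 'I_m.+1, a < i -> is_ob d a -> exists l, dquot j0 d a l) /\
  (forall a : 'I_m.+1, a = i :> nat -> is_ob d a /\ forall l, ~ dquot j0 d a l).

Lemma run_le m (d : vchain Y m) i i' : run d i -> run d i' -> i' <= m.+1 -> i' <= i.
Proof.
move=> [_ H] [H' _] im; rewrite leqNgt; apply/negP => ii'.
have i1 : i < m.+1 by lia.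
have [oi Ni] := H (Ordinal i1) erefl.
by have [l /Ni] := H' (Ordinal i1) ii' oi.
Qed.

Lemma lift_lt m (i : 'I_m.+2) (a : 'I_m.+1) : a < i -> lift i a = a :> nat.
Proof. by rewrite /= /bump; lia. Qed.

Lemma lift_ge m (i : 'I_m.+2) (a : 'I_m.+1) : i <= a -> lift i a = a.+1 :> nat.
Proof. by rewrite /= /bump; lia. Qed.

(** * Lower cells of the matching relative to the source *)

Section Lower.
Variables (m : nat) (c : vchain Y m.+1) (i : 'I_m.+2) (l : nat).
Hypothesis Q : qupper c i l.

Section FaceChain.
Variable d : vchain Y m.
Hypothesis cd : sact (collage Y) (dface i) (inr c) = inr d.

Lemma qu_run : run d i.
Proof.
have [ob_ _ _ _] := face_act_eq cd; split=> a ai.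
  rewrite ob_ => oa; have [|l' D] := qu_le Q _ oa; first by rewrite lift_leql.
  by exists l'; apply/(dquot_face j0 cd (qu_ob Q)).
have ai' : lift i a = i.+1 :> nat by rewrite lift_ge // ai.
split; first by rewrite ob_; apply: (ob_le (vchP c) _ (qu_ob Q)); rewrite ai'.
by move=> l' /(dquot_face j0 cd (qu_ob Q)); exact: qu_not Q ai'.
Qed.

(** What follows the quotient [a] in the face factors through the surjection from [a] onto [i]. If
    it were nondegenerate, that surjection would be injective, hence an identity, and [c] would be
    degenerate. When [i] is last, injectivity comes from [ez_nondeg]. *)
Lemma qu_stop (a : 'I_m.+1) la : a.+1 = i :> nat -> dquot j0 d a la ->
  next_inj d a la -> ~ last_nondeg d a la.
Proof.
move=> ai Da Na La; have oi := qu_ob Q.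
have Dc := (dquot_face j0 cd oi a la).1 Da.
have la_i : lift i a = a :> nat by apply: lift_lt; lia.
have ia : i = (lift i a).+1 :> nat by rewrite la_i.
have le_i : lift i a <= i by rewrite ia.
have /nondeg_chainP/(_ _ _ ia) [N1 _] := qu_nondeg Q.
have oa : is_ob c (lift i a) by case: Dc.
apply: (N1 oa); apply: (dquot_deg Dc (qu_dquot Q) le_i).
have [Ej C O] := dquot_map Dc (qu_dquot Q) le_i.
have [_ dim_ mp_ _] := face_act_eq cd.
have [iE|ne] := eqVneq i ord_max; last first.
  have b1 : i < m.+1 by move: ne; rewrite -val_eqE /=; have := ltn_ord i; lia.
  move=> x x' xl xl' E; apply: (Na (Ordinal b1)) => //= j.
  have ib : i <= lift i (Ordinal b1) by rewrite lift_leqr.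
  rewrite !mp_ //=; last by lia.
  by rewrite !(mp_comp (vchP c) j le_i ib oi) /= !Ej E.
have aE : a = ord_max by apply: val_inj; rewrite /=; move: ai; rewrite iE /=; lia.
have dl j : dim c ord_max j = l by rewrite -iE; have [_ + _ _] := qu_dquot Q; exact.
have [y yE] := lastz_const dl.
have yN := qu_last Q iE yE.
have ld : lastz d = existT (fun k => Y k) (fun=> la)
    (sact (diag Y) (to_hom la l (mp c (lift i a) i j0)) y).
  rewrite (face_lastz cd) yE -aE.
  have -> : dim d a = fun=> la by apply: funext => j; have [_ + _ _] := Da; exact.
  by congr existT; apply: pull_const => j; rewrite -[in LHS]iE Ej.
have zN := La aE _ ld.
have sE := ez_nondeg (onto_dsurj C O) yN zN.
have sid x : x <= la -> mp c (lift i a) i j0 x = x.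
  move=> xl; have xl' : x < la.+1 by [].
  by have := sE (Ordinal xl'); rewrite to_homE.
by move=> x x' xl xl'; rewrite !sid.
Qed.

(** If the neighbours of [i] became equal, the surjection from the previous quotient onto [i] would
    be injective and [c] degenerate. Two vertices that agree in all other objects also agree in
    [i]. *)
Lemma qu_lower_nondeg : nondeg (inr d : collage Y m).
Proof.
have [ob_ dim_ mp_ _] := face_act_eq cd; have oi := qu_ob Q.
have [e oe eob] := first_ob d.
apply: (nondeg_face cd (qu_nondeg Q)) => [a b ba bi|a b ba bi nb _ D j].
  have ob : is_ob d b by have [_ H] := qu_run; have [] := H b bi.
  split=> [oa Dg|]; last by rewrite ob.
  have ai : a < i by rewrite -bi ba.
  have lb : lift i b = i.+1 :> nat by rewrite lift_ge // bi.
  have [H _] := qu_run; have [la Da] := H a ai oa.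
  have Dc := (dquot_face j0 cd oi a la).1 Da.
  have la_i : i = (lift i a).+1 :> nat by rewrite (lift_lt ai) -ba bi.
  have le_i : lift i a <= i by rewrite la_i.
  have /nondeg_chainP/(_ _ _ la_i) [N1 _] := qu_nondeg Q.
  apply: N1; first by rewrite -ob_.
  apply: (dquot_deg Dc (qu_dquot Q) le_i) => x x' xl xl' E.
  have [Ej _ _] := dquot_map Dc (qu_dquot Q) le_i.
  have [Dg1 Dg2] := Dg; have [_ dla _ _] := Da.
  have ab : a <= b by rewrite ba.
  have ilb : i <= lift i b by rewrite lb.
  have := Dg2 j0; rewrite -Dg1 dla mp_ // (mp_comp (vchP c) j0 le_i ilb oi) => H2.
  have := congr1 (fun h => h x) H2; have := congr1 (fun h => h x') H2 => /=.
  by rewrite E => -> ; move/minn_idPl: xl => ->; move/minn_idPl: xl' => ->.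
have ab : a <= b by rewrite ba.
have na : ~~ is_ob d a := vtx_le ab nb.
have [nca ncb] : ~~ is_ob c (lift i a) /\ ~~ is_ob c (lift i b) by rewrite -!ob_.
(* If [i] is last, the images of the vertices in [i] pass through the last object of the face;
   otherwise [next_inj] reduces their equality to that in the next object. *)
have [iE|ne] := eqVneq i ord_max.
  have od : is_ob d ord_max := ob_max (vchP d).
  have olm : is_ob c (lift i ord_max) by rewrite -ob_.
  have lei : lift i ord_max <= i by rewrite iE le_max.
  rewrite (mp_through j nca olm lei) (mp_through j ncb olm lei).
  by rewrite -!mp_ ?le_max // (D ord_max j od).
have b1 : i < m.+1 by move: ne; rewrite -val_eqE /=; have := ltn_ord i; lia.
pose b' := Ordinal b1; have ob' : is_ob d b' by have [_ H] := qu_run; have [] := H b' erefl.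
have lb' : lift i b' = i.+1 :> nat by rewrite lift_ge.
have lib : i <= lift i b' by rewrite lb'.
have [_ dl il _] := qu_dquot Q.
have vl (x : 'I_m.+2) j' : ~~ is_ob c x -> mp c x i j' 0 <= l.
  by move=> nx; have [_ + _] := mp_clamped (vchP c) j' (ltnW (vtx_lt nx oi)); rewrite dl; exact.
rewrite !(il _ j) //; apply: (qu_next Q lb'); [exact: vl | exact: vl |] => j'.
rewrite -!(il _ j') // -(mp_through j' nca oi lib) -(mp_through j' ncb oi lib).
have lt_b' x : ~~ is_ob d x -> x <= b' by move=> nx; exact: ltnW (vtx_lt nx ob').
by rewrite -!mp_ ?lt_b' // (D b' j' ob').
Qed.

End FaceChain.
End Lower.
End Quotient.

Section Quotient.
Variables (n : nat) (Y : msset n) (j0 : 'I_n).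
Local Notation dquot := (dquot j0).
Local Notation qupper := (qupper j0).

Definition vtx_map m (c : chain Y m) (a : 'I_m.+1) (q x : nat) : nat :=
  mp c (inord (minn x q)) a j0 0.

Lemma vtx_mapP m (c : vchain Y m) (a f : 'I_m.+1) l : dquot c a l ->
  (forall x, is_ob c x = (f <= x)) -> 0 < f ->
  clamped f.-1 l (vtx_map c a f.-1) /\ onto f.-1 l (vtx_map c a f.-1).
Proof.
move=> [oa da ia sa] ob_ f0.
have fa : f <= a by rewrite -ob_.
have inE x : (inord (minn x f.-1) : 'I_m.+1) = minn x f.-1 :> nat.
  by rewrite (@inordK m) //; have := ltn_ord f; lia.
have vlt x : (inord (minn x f.-1) : 'I_m.+1) < f by rewrite (inE x); lia.
have nv x : ~~ is_ob c (inord (minn x f.-1)) by rewrite ob_ -ltnNge.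
split; [split=> [x y xy|x|x] | move=> y yl].
- apply: (mp_vtx (vchP c)); last exact: nv.
    by rewrite !inE; lia.
  exact: leq_trans (ltnW (vlt y)) fa.
- have [_ H _] := mp_clamped (vchP c) j0 (leq_trans (ltnW (vlt x)) fa).
  by rewrite -(da j0); exact: H.
- by rewrite /vtx_map -minnA minnn.
- have [v nv' <-] := sa y yl; exists v; last by rewrite /vtx_map (_ : inord _ = v) //;
    apply: val_inj => /=; rewrite inE; move: nv'; rewrite ob_; lia.
  by move: nv'; rewrite ob_; lia.
Qed.

Lemma dquot_through m (c : vchain Y m) (a : 'I_m.+1) l x : dquot c a l ->
  exists v, [/\ ~~ is_ob c v, mp c v a j0 0 = minn x l &
    forall (b : 'I_m.+1) j, a <= b -> mp c a b j x = mp c v b j 0].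
Proof.
move=> D; have [oa da ia sa] := D; have [v nv E] := sa (minn x l) (geq_minr _ _).
exists v; split=> // b j ab; rewrite (mp_through j nv oa ab) (ia v j nv) E.
by have [_ _ ->] := dquot_clamped j D ab.
Qed.

Lemma dquot_self m (c : vchain Y m) (a : 'I_m.+1) l v j : dquot c a l -> ~~ is_ob c v ->
  mp c v a j = fun=> mp c v a j0 0.
Proof.
move=> [oa _ ia _] nv; rewrite (mp_vtx_cst j nv (ltnW (vtx_lt nv oa))).
by rewrite (ia v j nv).
Qed.

(** The case where [i] is the only object. Nondegeneracy separates the vertices, so the quotient
    onto [i] is the identity of [m], and the face is the element of Y carried by [i], nondegenerate
    by [qu_last]. *)
Lemma qu_face_vtx m (c : vchain Y m.+1) (i : 'I_m.+2) l : qupper c i l ->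
  ~~ is_ob c (dface i ord_max) ->
  exists y : diag Y m, [/\ i = ord_max, forall a, ~~ is_ob c (lift i a),
    sact (collage Y) (dface i) (inr c) = inl y & nondeg y].
Proof.
move=> Q nob; have oi := qu_ob Q; have D := qu_dquot Q.
have iE : i = ord_max by apply/eqP/negPn/negP => ne; move: nob; rewrite face_ob.
have nv a : ~~ is_ob c (lift i a).
  apply: vtx_le nob; rewrite dfaceE lift_leq; exact: le_max.
have ob_ x : is_ob c x = (i <= x).
  case: (unliftP i x) => [a ->|->]; last by rewrite oi leqnn.
  by rewrite (negbTE (nv a)) lift_leqr iE; apply/esym/negbTE; rewrite -ltnNge /=.
have i0 : 0 < i by rewrite iE.
have [C O] := vtx_mapP D ob_ i0; have im : i.-1 = m by rewrite iE.
rewrite im in C O.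
have inE (x : nat) : x <= m -> (inord x : 'I_m.+2) = x :> nat by move=> xm; rewrite (@inordK m.+1) //; lia.
have [ml E] : m = l /\ vtx_map c i m = minn^~ m.
  apply: onto_inj => // x x' xm x'm E.
  have := @first_vtx_inj _ _ _ c i (inord x) (inord x') (qu_nondeg Q) ob_.
  rewrite (inE x xm) (inE x' x'm) => H.
  have /(congr1 val) : inord x = inord x' :> 'I_m.+2.
    apply: H; [by rewrite iE /=; lia | by rewrite iE /=; lia |].
    have nn (z : nat) : z <= m -> ~~ is_ob c (inord z) by move=> zm; rewrite ob_ (inE z zm) iE /=; lia.
    move=> j; rewrite (dquot_self j D (nn x xm)) (dquot_self j D (nn x' x'm)).
    by move: E; rewrite /vtx_map (minn_idPl xm) (minn_idPl x'm).
  by rewrite /= (inE x xm) (inE x' x'm).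
subst l; have dl j : dim c ord_max j = m by rewrite -iE; have [_ + _ _] := D; exact.
have [y yE] := lastz_const dl.
exists y; split=> //; last exact: (qu_last Q iE yE).
rewrite [LHS](collage_act_vtx nob); congr inl.
rewrite /realize_chain mact_pull; last by move=> j; exact: last_vtx_clamped.
rewrite yE (@pull_const _ _ m m (minn^~ m)); first by rewrite to_hom_id sact_id.
move=> j; apply: funext => x /=; rewrite /of_hom.
rewrite last_vtxE dfaceE (dim_vtx (vchP c) j (nv _)) -iE.
set a := inord (minn x m); have am : a = minn x m :> nat by rewrite /a inordK; lia.
rewrite (dquot_self j D (nv a)).
have := congr1 (fun h => h x) E; rewrite /vtx_map => <-; congr (mp c _ i j0 0).
have ai : a < i by rewrite iE /=; have := ltn_ord a; lia.
by apply: val_inj; apply: etrans (lift_lt ai) _; rewrite /= am inE // geq_minr.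
Qed.

Definition quot_upper m (x : collage Y m.+1) (i : 'I_m.+2) : Prop :=
  exists (c : vchain Y m.+1) l, x = inr c /\ qupper c i l.

Lemma quot_lower_nondeg m (x : collage Y m.+1) i :
  quot_upper x i -> nondeg (sact (collage Y) (dface i) x).
Proof.
case=> c [l [-> Q]]; have [H|H] := boolP (is_ob c (dface i ord_max)).
  have cd : sact (collage Y) (dface i) (inr c) = inr (vchain_act H) := collage_act_ob H.
  by rewrite cd; exact: (qu_lower_nondeg Q cd).
by have [y [_ _ -> yN]] := qu_face_vtx Q H; apply/nondeg_inl.
Qed.

Lemma quot_lowerNA m (x : collage Y m.+1) i :
  quot_upper x i -> ~ all_ob (sact (collage Y) (dface i) x).
Proof.
case=> c [l [-> Q]] [d [cd od]]; have [ob_ _ _ _] := face_act_eq cd.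
have := od ord0; rewrite ob_ (_ : lift i ord0 = ord0) ?(negbTE (qu_vtx Q)) //.
apply: val_inj; apply: lift_lt; rewrite lt0n; apply/eqP => i0.
have := qu_ob Q; rewrite (_ : i = ord0) ?(negbTE (qu_vtx Q)) //; exact: val_inj.
Qed.

Lemma quot_upper_face m (x : collage Y m.+1) i i' : quot_upper x i -> quot_upper x i' -> i = i'.
Proof. by case=> c [l [-> Q]] [c' [l' [[<-] Q']]]; exact: qu_unique Q Q'. Qed.

(** The run of quotients of the face stops at [i], so the removable object of the face could only be
    the one just before [i], which [qu_stop] excludes. *)
Lemma quot_lower_upper m (x : collage Y m.+2) i : quot_upper x i ->
  forall i', ~ quot_upper (sact (collage Y) (dface i) x) i'.
Proof.
case=> c [l [-> Q]] i' [d [l' [cd Q']]].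
have [_ R] := qu_run Q cd; have o' := qu_ob Q'.
have [ii'|i'i] := leqP i i'.
  have i1 : i < m.+2 by have := ltn_ord i'; lia.
  have [oi Ni] := R (Ordinal i1) erefl.
  by have [l1 /Ni] := qu_le Q' (a := Ordinal i1) ii' oi.
have [E|ne] := eqVneq i'.+1 (i : nat).
  exact: (qu_stop Q cd E (qu_dquot Q') (qu_next Q') (qu_last Q')).
have i1 : i'.+1 < m.+2 by have := ltn_ord i; lia.
have o1 : is_ob d (Ordinal i1) by apply: (ob_le (vchP d) _ o') => /=.
have [R1 _] := qu_run Q cd; have lt1 : i'.+1 < i by lia.
have [l1 D1] := R1 (Ordinal i1) lt1 o1.
exact: (@qu_not _ _ _ _ _ _ (Ordinal i1) _ _ Q' erefl D1).
Qed.

(** * An upper cell is determined by its lower face *)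

Section LowerInj.
Variables (m : nat) (c c' : vchain Y m.+1) (i i' : 'I_m.+2) (l l' : nat).
Hypothesis Q : qupper c i l.
Hypothesis Q' : qupper c' i' l'.
Hypothesis cc' : sact (collage Y) (dface i) (inr c) = sact (collage Y) (dface i') (inr c').

(** The position is the end of the run of quotients of the face; if the face has no object left, it
    is the last position. *)
Lemma lower_agree : i = i' /\
  [/\ forall a, is_ob c (lift i a) = is_ob c' (lift i a),
      forall a, dim c (lift i a) = dim c' (lift i a),
      forall (a b : 'I_m.+1) j, a <= b ->
        mp c (lift i a) (lift i b) j = mp c' (lift i a) (lift i b) j &
      i != ord_max -> lastz c = lastz c'].
Proof.
have [H|H] := boolP (is_ob c (dface i ord_max));
  have [H'|H'] := boolP (is_ob c' (dface i' ord_max)).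
- have cd : sact (collage Y) (dface i) (inr c) = inr (vchain_act H) := collage_act_ob H.
  move: cc'; rewrite cd => /esym c'd.
  have ii : i = i'.
    apply: val_inj; apply/eqP; rewrite eqn_leq; apply/andP; split.
      apply: run_le (qu_run Q' c'd) (qu_run Q cd) _; by rewrite -ltnS.
    apply: run_le (qu_run Q cd) (qu_run Q' c'd) _; by rewrite -ltnS.
  subst i'; split=> //.
  have [E1 E2 E3 E4] := face_act_eq cd; have [E1' E2' E3' E4'] := face_act_eq c'd.
  split=> [a|a|a b j ab|ne].
  + by rewrite -E1 -E1'.
  + by rewrite -E2 -E2'.
  + by rewrite -E3 // -E3'.
  + by rewrite -E4 // -E4'.
- by move: cc'; rewrite [LHS](collage_act_ob H); have [y [_ _ -> _]] := qu_face_vtx Q' H'.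
- by move: cc'; rewrite [RHS](collage_act_ob H'); have [y [_ _ -> _]] := qu_face_vtx Q H.
- have [y [iE nv _ _]] := qu_face_vtx Q H; have [y' [i'E nv' _ _]] := qu_face_vtx Q' H'.
  have ii : i = i' by rewrite iE i'E.
  clear i'E; subst i'; split=> //; split=> [a|a|a b j ab|].
  + by rewrite (negbTE (nv a)) (negbTE (nv' a)).
  + by apply: funext => j; rewrite !(dim_vtx (vchP _)).
  + by rewrite !mp_to_vtx.
  + by rewrite iE eqxx.
Qed.

End LowerInj.

Section LowerInj2.
Variables (m : nat) (c c' : vchain Y m.+1) (i : 'I_m.+2) (l l' : nat).
Hypothesis Q : qupper c i l.
Hypothesis Q' : qupper c' i l'.
Hypothesis cc' : sact (collage Y) (dface i) (inr c) = sact (collage Y) (dface i) (inr c').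
Hypothesis obE : forall a, is_ob c (lift i a) = is_ob c' (lift i a).
Hypothesis dimE : forall a, dim c (lift i a) = dim c' (lift i a).
Hypothesis mpE : forall (a b : 'I_m.+1) j, a <= b ->
  mp c (lift i a) (lift i b) j = mp c' (lift i a) (lift i b) j.
Hypothesis zE : i != ord_max -> lastz c = lastz c'.

Lemma lower_ob a : is_ob c a = is_ob c' a.
Proof. by case: (unliftP i a) => [b ->|->]; rewrite ?obE // (qu_ob Q) (qu_ob Q'). Qed.

Variable f : 'I_m.+2.
Hypothesis f_ob : forall a, is_ob c a = (f <= a).

Lemma f_gt0 : 0 < f.
Proof.
rewrite lt0n; apply/eqP => f0; have := qu_vtx Q.
by rewrite f_ob f0.
Qed.

Lemma f_ob' a : is_ob c' a = (f <= a).
Proof. by rewrite -lower_ob. Qed.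

Let fi : f <= i. Proof. by rewrite -f_ob (qu_ob Q). Qed.

(** If an object follows [i], the kernel of the quotient is that of the maps from the vertices to
    this object, by [next_inj], and [kernel_onto] applies. If [i] is last, the quotient and its
    element of Y are the Eilenberg-Zilber decomposition of the simplex spanned by the vertices, and
    [ez_unique] applies. *)
Lemma lower_vtx_eq : [/\ l = l', vtx_map c i f.-1 = vtx_map c' i f.-1 & lastz c = lastz c'].
Proof.
have [C O] := vtx_mapP (qu_dquot Q) f_ob f_gt0.
have [C' O'] := vtx_mapP (qu_dquot Q') f_ob' f_gt0.
have inE x : (inord (minn x f.-1) : 'I_m.+2) = minn x f.-1 :> nat.
  by rewrite (@inordK m.+1) //; have := ltn_ord f; lia.
have vlt x : (inord (minn x f.-1) : 'I_m.+2) < f by rewrite (inE x); have := f_gt0; lia.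
have nv x : ~~ is_ob c (inord (minn x f.-1)) by rewrite f_ob -ltnNge.
have nv' x : ~~ is_ob c' (inord (minn x f.-1)) by rewrite f_ob' -ltnNge.
have [iE|ne] := eqVneq i ord_max; last first.
  have b1 : i < m.+1 by move: ne; rewrite -val_eqE /=; have := ltn_ord i; lia.
  pose i1 := lift i (Ordinal b1); have i1E : i1 = i.+1 :> nat by rewrite lift_ge.
  have ii1 : i <= i1 by rewrite i1E.
  have ker (d : vchain Y m.+1) k (Qd : qupper d i k) (nd : forall x, ~~ is_ob d (inord (minn x f.-1))) x x' :
      vtx_map d i f.-1 x = vtx_map d i f.-1 x' <->
      forall j, mp d (inord (minn x f.-1)) i1 j 0 = mp d (inord (minn x' f.-1)) i1 j 0.
    have oi := qu_ob Qd; have [_ di ii _] := qu_dquot Qd.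
    have bd y : vtx_map d i f.-1 y <= k.
      have [_ + _] := mp_clamped (vchP d) j0 (ltnW (vtx_lt (nd y) oi)).
      by rewrite di; exact.
    split=> [E j|E].
      rewrite (mp_through j (nd x) oi ii1) (mp_through j (nd x') oi ii1) !(ii _ j) //.
      by congr (mp d i i1 j _).
    apply: (qu_next Qd i1E (bd x) (bd x')) => j.
    by rewrite /vtx_map -!(ii _ j) // -!mp_through.
  have [ll E] : l = l' /\ vtx_map c i f.-1 = vtx_map c' i f.-1.
    apply: (kernel_onto C C' O O') => x x' _ _.
    have H y j : mp c (inord (minn y f.-1)) i1 j 0 = mp c' (inord (minn y f.-1)) i1 j 0.
      have := vlt y; case: (unliftP i (inord (minn y f.-1))) => [v ->|->]; last by lia.
      move=> lf; rewrite mpE //=; move: lf; rewrite /= /bump; lia.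
    split=> [/(ker _ _ Q nv) E|/(ker _ _ Q' nv') E].
      by apply/(ker _ _ Q' nv') => j; rewrite -!H.
    by apply/(ker _ _ Q nv) => j; rewrite !H.
  by split=> //; exact: zE.
have dl j : dim c ord_max j = l by rewrite -iE; have [_ + _ _] := qu_dquot Q; exact.
have dl' j : dim c' ord_max j = l' by rewrite -iE; have [_ + _ _] := qu_dquot Q'; exact.
have [y yE] := lastz_const dl; have [y' y'E] := lastz_const dl'.
have Vm (a b : 'I_f.-1.+1) : a <= b ->
  (inord (minn a f.-1) : 'I_m.+2) <= (inord (minn b f.-1) : 'I_m.+2).
  by rewrite !inE; lia.
(* The inclusion of the vertices. It misses [i], so the simplex that they span is computed in the
   common face. *)
pose V : dhom f.-1 m.+1 := mkdhom Vm.
have VE (a : 'I_f.-1.+1) : V a = inord (minn a f.-1) by rewrite ffunE.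
have [V' V'E] : exists V', V = dcomp (dface i) V'.
  apply: miss_factor => a; rewrite -val_eqE VE /=; have := vlt a; lia.
have act_V (d : vchain Y m.+1) k z (Qd : qupper d i k) (nd : forall x, ~~ is_ob d (inord (minn x f.-1))) :
    lastz d = existT (fun k => Y k) (fun=> k) z ->
    sact (collage Y) V (inr d) = inl (sact (diag Y) (to_hom f.-1 k (vtx_map d i f.-1)) z).
  move=> dE; have nV : ~~ is_ob d (V ord_max) by rewrite VE.
  rewrite [LHS](collage_act_vtx nV); congr inl.
  rewrite /realize_chain mact_pull; last by move=> j; exact: last_vtx_clamped.
  rewrite dE; apply: pull_const => j; apply: funext => x /=; rewrite /of_hom last_vtxE VE.
  rewrite (dim_vtx (vchP d) j (nd _)) -iE (dquot_self j (qu_dquot Qd) (nd _)) /vtx_map.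
  by congr (mp d _ i j0 0); rewrite inordK; [rewrite -minnA minnn | lia].
have := act_V c l y Q nv yE; rewrite V'E sact_comp cc' -sact_comp -V'E.
rewrite (act_V c' l' y' Q' nv' y'E) => -[E].
have {}E := ez_unique (onto_dsurj C' O') (onto_dsurj C O)
  (qu_last Q' iE y'E) (qu_last Q iE yE) E.
have e := projT1_eq E; rewrite /= in e; subst l'.
have E0 := existT_inj E; split=> //; last by rewrite yE y'E (congr1 snd E0 : y' = y).
by rewrite -[LHS](of_to_hom C) -[RHS](of_to_hom C'); congr of_hom; exact: esym (congr1 fst E0).
Qed.

(** Every object up to [i] is a quotient of the vertices, so maps out of it are determined by maps
    out of the vertices. Among the latter, those into [i] come from [lower_vtx_eq] and the others
    belong to the common face. *)
Lemma lower_chain_eq : c = c'.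
Proof.
have [ll vE lE] := lower_vtx_eq.
have D := qu_dquot Q; have D' : dquot c' i l by rewrite ll; exact: qu_dquot Q'.
have [oi di _ _] := D; have [oi' di' _ _] := D'.
have dimE' a : dim c a = dim c' a.
  case: (unliftP i a) => [b ->|->]; first exact: dimE.
  by apply: funext => j; rewrite di di'.
have nvE v : ~~ is_ob c v -> ~~ is_ob c' v by rewrite lower_ob.
have vtxE v j : ~~ is_ob c v -> mp c v i j = mp c' v i j.
  move=> nv; rewrite (dquot_self j D nv) (dquot_self j D' (nvE v nv)).
  have vf : v < f by move: nv; rewrite f_ob; lia.
  have := congr1 (fun h : nat -> nat => h v) vE; rewrite /vtx_map.
  rewrite (_ : inord _ = v) => [-> //|]; apply: val_inj => /=.
  by rewrite (@inordK m.+1) //; have := ltn_ord v; lia.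
have vtx_any (v b : 'I_m.+2) j : ~~ is_ob c v -> v <= b -> mp c v b j = mp c' v b j.
  move=> nv; case: (unliftP i b) => [b' ->|->]; last by move=> _; exact: vtxE.
  case: (unliftP i v) nv => [v' -> _|->]; last by rewrite oi.
  by rewrite lift_leq; exact: mpE.
apply: vchain_eq => [||a b j ab|//].
- by apply: funext; exact: lower_ob.
- by apply: funext; exact: dimE'.
have [oa|na] := boolP (is_ob c a); last exact: vtx_any.
have [ai|ia] := leqP a i; last first.
  case: (unliftP i a) ab ia => [a' -> ab ia|->]; last by lia.
  case: (unliftP i b) ab => [b' ->|->]; first by rewrite lift_leq; exact: mpE.
  by rewrite leqNgt ia.
have [la Da] := qu_le Q ai oa.
have [la' Da'] : exists la', dquot c' a la' by apply: (qu_le Q' ai); rewrite -lower_ob.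
have lE' : la' = la.
  by have [_ d1 _ _] := Da; have [_ d2 _ _] := Da'; rewrite -(d1 j0) -(d2 j0) dimE'.
subst la'; apply: funext => x.
have [v [nv v1 v2]] := dquot_through x Da; rewrite v2 //.
have va : v <= a := ltnW (vtx_lt nv oa).
rewrite (vtx_any v b j nv (leq_trans va ab)).
have oa' : is_ob c' a by rewrite -lower_ob.
rewrite (mp_through j (nvE v nv) oa' ab) (dquot_self j Da' (nvE v nv)).
rewrite -(vtx_any v a j0 nv va) v1.
by have [_ _ ->] := dquot_clamped j Da' ab.
Qed.

End LowerInj2.

Lemma quot_lower_inj m (x x' : collage Y m.+1) i i' : quot_upper x i -> quot_upper x' i' ->
  sact (collage Y) (dface i) x = sact (collage Y) (dface i') x' -> x = x'.
Proof.
case=> c [l [-> Q]] [c' [l' [-> Q']]] E.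
have [ii [E1 E2 E3 E4]] := lower_agree Q Q' E; subst i'.
have [f _ fob] := first_ob c.
by congr inr; exact: (lower_chain_eq Q Q' E E1 E2 E3 E4 fob).
Qed.

End Quotient.

(** * Insertion of a quotient that is nondegenerate with respect to what follows *)

Section Simplices.
Variables (n : nat) (q : 'I_n -> nat).

(** The product of the standard simplices of dimensions [q j], to which the Eilenberg-Zilber
    decomposition is applied. *)
Definition simplices : sset := @SSet (fun k => forall j, dhom k (q j))
  (fun k l f x j => dcomp (x j) f)
  (fun k x => fext (fun j => dcompf1 (x j)))
  (fun k l m f g x => fext (fun j => dcompA (x j) g f)).

(** If x < x' have the same images, so do [x] and [x.+1] by monotonicity, and [y] is fixed by
    [merge l x]. *)
Lemma simplices_inj l (y : simplices l) : nondeg y -> forall x x', x <= l -> x' <= l ->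
  (forall j, of_hom (y j) x = of_hom (y j) x') -> x = x'.
Proof.
move=> /nondegP N x x'; wlog xx' : x x' / x < x' => [H xl x'l E|xl x'l E].
  case: (ltngtP x x') => // h; first exact: H.
  by apply/esym; apply: H.
exfalso; have xl' : x < l by lia.
apply: (N x xl'); apply: fext => j; apply: dhom_eq => a; rewrite (dcompE (y j) (merge l x)).
have [ax|ax] := eqVneq (a : nat) x; last first.
  by congr (nat_of_ord (y j _)); apply: val_inj; rewrite /= mergeE (negbTE ax).
rewrite -(of_homE (y j) a) -(of_homE (y j) (merge l x a)) mergeE ax eqxx xl' /=.
have [H _ _] := of_hom_clamped (y j).
apply/eqP; rewrite eqn_leq; apply/andP; split; first exact: H.
by rewrite E; apply: H.
Qed.

End Simplices.

Section Quotient.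
Variables (n : nat) (Y : msset n) (j0 : 'I_n).
Local Notation dquot := (dquot j0).
Local Notation qupper := (qupper j0).
Local Notation quot_upper := (quot_upper j0).

Section Step.
Variables (m : nat) (c : vchain Y m) (i0 : 'I_m.+1) (l0 : nat).
Hypothesis D0 : dquot c i0 l0.
Let P := vchP c.
Variables (I : 'I_m.+2) (l : nat) (s : dhom l0 l).
Hypothesis I0 : I = i0.+1 :> nat.
Hypothesis sS : dsurj s.
Variables (outm : 'I_m.+1 -> 'I_n -> nat -> nat) (zz : {k & Y k}).
Hypothesis out_clamped : forall (a : 'I_m.+1) j, I <= a -> clamped l (dim c a j) (outm a j).
Hypothesis out_comp : forall (a b : 'I_m.+1) j, I <= a -> a <= b ->
  outm b j = mp c a b j \o outm a j.
Hypothesis out_quot : forall (a : 'I_m.+1) j, I <= a -> mp c i0 a j = outm a j \o of_hom s.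
Hypothesis zz_last : if I == ord_max then projT1 zz = fun=> l else zz = lastz c.
Hypothesis zz_max : I = ord_max ->
  existT _ (dim c ord_max) (pull (dim c ord_max) (fun=> of_hom s) zz) = lastz c.

(** Common part of the two cases of [quot_step]: after the quotient [i0], its further quotient along
    [s] is inserted, given a factorization through [s] of what follows. *)
Lemma step_exists : exists t : vchain Y m.+1,
  [/\ sact (collage Y) (dface I) (inr t) = inr c, dquot t I l,
      forall (a : 'I_m.+1) j, I <= a -> mp t I (lift I a) j = outm a j & lastz t = zz].
Proof.
have [oi di ii si] := D0.
have i0a (a : 'I_m.+1) : a < I -> a <= i0 by rewrite I0.
unshelve eexists (@insert n Y m c I true (fun=> l) (fun a j => of_hom s \o mp c a i0 j)
    outm zz _ _ _ _ _ _ _ _ _ _ _ _ _).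
- by [].
- by move=> a Ia _; apply: (ob_le P _ oi); lia.
- by [].
- by [].
- exact: zz_last.
- move=> a j /i0a ai; apply: clamped_comp (of_hom_clamped s).
  by rewrite -(di j); exact: mp_clamped.
- exact: out_clamped.
- move=> a b j ab /i0a bi ob; apply: funext => x /=.
  by rewrite (mp_comp P j ab bi ob).
- by move=> a b j Ia ab _; exact: out_comp.
- move=> a b j /i0a ai Ib _; have ib : i0 <= b by lia.
  by rewrite (mp_comp P j ai ib oi) out_quot.
- move=> a b j ab /i0a bi nb /=; have [H _ _] := of_hom_clamped s; apply: H.
  exact: (mp_vtx P).
- by move=> a b j Ia _ na; move: na; rewrite (ob_le P _ oi) //; lia.
- by [].
split.
- apply: insert_face => IE _.
  have i0E : i0 = ord_max by apply: val_inj => /=; move: I0; rewrite IE /=; lia.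
  split; first exact: ob_max P.
  rewrite -(zz_max IE); congr (existT _ _ (pull _ _ _)); apply: funext => j.
  rewrite i0E (mp_id P) -i0E di; exact: clamped_comp_id (of_hom_clamped s).
- set t := insert _ _ _ _ _ _ _ _ _ _ _ _ _.
  have lifted x : ~~ is_ob t x -> exists2 v, ~~ is_ob c v & x = lift I v.
    case: (unliftP I x) => [v ->|->].
      by rewrite insert_ob_lift => nv; exists v.
    by rewrite insert_ob_self.
  have vE v j : ~~ is_ob c v -> mp t (lift I v) I j 0 = of_hom s (mp c v i0 j 0).
    move=> nv; have vi := vtx_lt nv oi.
    by rewrite insert_in //; lia.
  split; first exact: insert_ob_self.
  + by move=> j; rewrite insert_dim_self.
  + by move=> x j /lifted [v nv ->]; rewrite !vE // ii.
  + move=> x xl; have [y yl <-] := dsurj_onto sS xl.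
    have [v nv <-] := si y yl; exists (lift I v); last exact: vE.
    by rewrite insert_ob_lift.
- by move=> a j Ia; rewrite insert_out.
- by [].
Qed.

End Step.

Definition reduced m (t : vchain Y m.+1) (I : 'I_m.+2) (c : vchain Y m) (l : nat) : Prop :=
  [/\ sact (collage Y) (dface I) (inr t) = inr c, dquot t I l,
      next_inj t I l & last_nondeg t I l].

(** The object [i0] carries a simplex: its element in [diag Y] if it is last, and otherwise its maps
    to the next object, in a product of standard simplices. The surjection of the Eilenberg-Zilber
    decomposition of this simplex gives the new object, and its nondegenerate part gives what
    follows. *)
Lemma quot_step m (c : vchain Y m) (i0 : 'I_m.+1) l0 (I : 'I_m.+2) : dquot c i0 l0 ->
  I = i0.+1 :> nat -> exists t l, reduced t I c l.
Proof.
move=> D0 I0; have P := vchP c; have [oi di _ _] := D0.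
have [i0E|ne] := eqVneq i0 ord_max.
  have dl j : dim c ord_max j = l0 by rewrite -i0E.
  have [y yE] := lastz_const dl.
  have IE : I = ord_max by apply: val_inj; rewrite /= I0 i0E.
  have [l [s [z [yz sS zN _]]]] := ez_exists y.
  have Ia (a : 'I_m.+1) : I <= a = false by rewrite IE /=; have := ltn_ord a; lia.
  have [|||||t [tc Dt _ zt]] := @step_exists m c i0 l0 D0 I l s I0 sS (fun _ _ _ => 0)
      (existT (fun k => Y k) (fun=> l) z).
  - by move=> a j; rewrite Ia.
  - by move=> a b j; rewrite Ia.
  - by move=> a j; rewrite Ia.
  - by rewrite IE eqxx.
  - move=> _; rewrite yE yz (_ : dim c ord_max = fun=> l0); last exact: funext.
    by rewrite (@pull_const _ _ l0 l (of_hom s)) // to_of_hom.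
  exists t, l; split=> //.
  + by move=> b bE; have := ltn_ord b; rewrite bE IE /= ltnn.
  + by move=> _ y'; rewrite zt => E; rewrite -(existT_inj E).
have h1 : i0.+1 < m.+1 by move: ne; rewrite -val_eqE /=; have := ltn_ord i0; lia.
pose i1 := Ordinal h1; have i01 : i0 <= i1 by rewrite /=.
have o1 : is_ob c i1 by exact: (ob_le P i01 oi).
have C1 j : clamped l0 (dim c i1 j) (mp c i0 i1 j) by rewrite -(di j); exact: mp_clamped.
pose x : simplices (dim c i1) l0 := fun j => to_hom l0 (dim c i1 j) (mp c i0 i1 j).
have [l [s [y [xE sS yN _]]]] := ez_exists x.
have mE j : mp c i0 i1 j = of_hom (y j) \o of_hom s.
  have := congr1 (fun h : simplices (dim c i1) l0 => of_hom (h j)) xE.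
  by rewrite /x of_to_hom //= of_hom_comp.
have neI : I != ord_max by rewrite -val_eqE /= I0; lia.
have i1I (a : 'I_m.+1) : I <= a -> i1 <= a by rewrite I0.
have [|||||t [tc Dt ot zt]] := @step_exists m c i0 l0 D0 I l s I0 sS
    (fun a j => mp c i1 a j \o of_hom (y j)) (lastz c).
- by move=> a j /i1I ia; apply: clamped_comp (of_hom_clamped (y j)) (mp_clamped P j ia).
- move=> a b j /i1I ia ab; have oa : is_ob c a by exact: (ob_le P ia o1).
  by rewrite (mp_comp P j ia ab oa).
- by move=> a j /i1I ia; rewrite (mp_comp P j i01 ia o1) mE.
- by rewrite (negbTE neI).
- by move=> IE; rewrite IE eqxx in neI.
have Ii1 : I <= i1 by rewrite I0.
exists t, l; split=> //.
+ move=> b bI u u' ul u'l E; apply: (simplices_inj yN ul u'l) => j.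
  have bE : b = lift I i1.
    by apply: val_inj; rewrite /= in bI *; rewrite bI /bump Ii1 I0.
  have := E j; rewrite bE ot //= (mp_id P).
  have bd w : of_hom (y j) w <= dim c i1 j by have [_ + _] := of_hom_clamped (y j); exact.
  by rewrite !(minn_idPl (bd _)).
+ by move=> IE; rewrite IE eqxx in neI.
Qed.

(** The simplex of vertices is itself inserted as an object, of dimension [f.-1]. Condition
    [next_inj] holds because nondegeneracy separates the vertices in the first object, by
    [first_vtx_inj]. *)
Lemma quot_start m (c : vchain Y m) (f : 'I_m.+1) (I : 'I_m.+2) :
  nondeg (inr c : collage Y m) -> (forall a, is_ob c a = (f <= a)) -> 0 < f ->
  I = f :> nat -> exists t l, reduced t I c l.
Proof.
move=> N ob_ f0 If; have P := vchP c.
have inE x : (inord (minn x f.-1) : 'I_m.+1) = minn x f.-1 :> nat.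
  by rewrite (@inordK m) //; have := ltn_ord f; lia.
have vlt x : (inord (minn x f.-1) : 'I_m.+1) < f by rewrite (inE x); lia.
have nv x : ~~ is_ob c (inord (minn x f.-1)) by rewrite ob_ -ltnNge.
have inK (v : 'I_m.+1) : v < f -> inord (minn v f.-1) = v :> 'I_m.+1.
  by move=> vf; apply: val_inj; rewrite /= inE; lia.
have neI : I != ord_max by rewrite -val_eqE /= If; have := ltn_ord f; lia.
have obf (a : 'I_m.+1) : I <= a -> is_ob c a by rewrite ob_ If.
have H : exists t : vchain Y m.+1, [/\ sact (collage Y) (dface I) (inr t) = inr c,
    is_ob t I, dim t I = fun=> f.-1,
    forall (v : 'I_m.+1) j, v < I -> mp t (lift I v) I j = fun=> v &
    forall (a : 'I_m.+1) j, I <= a ->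
      mp t I (lift I a) j = fun x => mp c (inord (minn x f.-1)) a j 0].
  unshelve eexists (@insert n Y m c I true (fun=> f.-1) (fun a j => fun=> a)
    (fun a j x => mp c (inord (minn x f.-1)) a j 0) (lastz c) _ _ _ _ _ _ _ _ _ _ _ _ _).
  - by [].
  - by move=> a Ia _; exact: obf.
  - by [].
  - by [].
  - by rewrite (negbTE neI).
  - by move=> a j; rewrite If => af; apply: clamped_const; lia.
  - move=> a j Ia; have le x : (inord (minn x f.-1) : 'I_m.+1) <= a by have := vlt x; lia.
    split=> [x y xy|x|x].
    + by apply: (mp_vtx P j _ (le y) (nv y)); rewrite !inE; lia.
    + by have [_ + _] := mp_clamped P j (le x); exact.
    + by rewrite -minnA minnn.
  - by move=> a b j _; rewrite ob_ If; lia.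
  - move=> a b j Ia ab oa; apply: funext => x /=.
    by rewrite (mp_comp P j _ ab oa) //; have := vlt x; lia.
  - move=> a b j; rewrite If => af fb _; apply: funext => x /=; rewrite inK //.
    have na : ~~ is_ob c a by rewrite ob_ -ltnNge.
    by rewrite [in LHS](mp_vtx_cst j na (ltnW (leq_trans af fb))).
  - by [].
  - by move=> a b j Ia _; rewrite obf.
  - by [].
  split; [|exact: insert_ob_self|exact: insert_dim_self| |].
  - by apply: insert_face => IE; rewrite IE eqxx in neI.
  - by move=> v j vI; rewrite insert_in.
  - by move=> a j Ia; rewrite insert_out.
have [t [tc oI dI tin tout]] := H.
have [tob _ _ _] := face_act_eq tc.
have lifted x : ~~ is_ob t x -> exists2 v : 'I_m.+1, v < I & x = lift I v.
  case: (unliftP I x) => [v ->|->]; last by rewrite oI.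
  by rewrite -tob ob_ => nvx; exists v => //; lia.
exists t, f.-1; split=> //.
- split=> //.
  + by rewrite dI.
  + by move=> x j /lifted [v vI ->]; rewrite !tin.
  + move=> x xf; have xm : x < m.+1 by have := ltn_ord f; lia.
    exists (lift I (Ordinal xm)); first by rewrite -tob ob_ /= -ltnNge; lia.
    by rewrite tin //= If; lia.
- move=> b bI x x' xf x'f E; have Ilef : I <= f by rewrite If.
  have bE : b = lift I f.
    by apply: val_inj; rewrite /= in bI *; rewrite bI /bump Ilef If.
  have /(congr1 val) : (inord (minn x f.-1) : 'I_m.+1) = inord (minn x' f.-1).
    apply: (first_vtx_inj N ob_ (vlt x) (vlt x')) => j.
    by have := E j; rewrite bE tout.
  by rewrite /= !inE; lia.
- by move=> IE; rewrite IE eqxx in neI.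
Qed.

(** Nondegeneracy is in question only around the new object. If its successor repeated it, that one
    would be a quotient, contrary to [run]; if it repeated its predecessor, the latter would inherit
    [next_inj] and [last_nondeg], contrary to the last hypothesis. *)
Lemma reduced_upper m (t : vchain Y m.+1) (I : 'I_m.+2) (c : vchain Y m) l :
  reduced t I c l -> nondeg (inr c : collage Y m) -> ~~ is_ob c ord0 -> run j0 c I ->
  (forall (a : 'I_m.+1) la, a.+1 = I :> nat -> dquot c a la -> next_inj c a la ->
     ~ last_nondeg c a la) -> quot_upper (inr t) I.
Proof.
move=> [tc D NI LN] N v0 [run1 run2] stop; exists t, l; split=> //.
have [oI dI iI sI] := D; have [ob_ dim_ mp_ _] := face_act_eq tc.
have I0 : 0 < I.
  rewrite lt0n; apply/eqP => I0; have [ob0 _] := run2 ord0 (esym I0).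
  by rewrite ob0 in v0.
split=> //.
- apply: (nondeg_unface tc N) => a b ba; case/orP => /eqP E; subst.
  + have Ib : I <= b by rewrite ba.
    split; last by rewrite (ob_le (vchP t) Ib oI).
    move=> _ [D1 D2]; case: (unliftP I b) ba D1 D2 Ib => [b' ->|->] ba D1 D2 Ib; last by lia.
    have b'I : b' = I :> nat.
      by move: ba; rewrite /= /bump; lia.
    have [_ nD] := run2 b' b'I; apply: (nD l); apply/(dquot_face j0 tc oI).
    split; first exact: (ob_le (vchP t) Ib oI).
    * by move=> j; rewrite -D1.
    * by move=> v j nv; rewrite !(mp_through _ nv oI Ib) !D2 iI // -!D1 !dI.
    * move=> x xl; have [v nv vx] := sI x xl; exists v => //.
      by rewrite (mp_through _ nv oI Ib) D2 vx -D1 dI; apply/minn_idPl.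
  + split; last by rewrite oI.
    case: (unliftP I a) ba => [a' ->|->] ba; last by lia.
    move=> oa [D1 D2]; have a'I : a' < I by move: ba; rewrite /= /bump; lia.
    have a'I1 : a'.+1 = I :> nat by move: ba; rewrite lift_lt.
    have oa' : is_ob c a' by rewrite ob_.
    have [la Da] := run1 a' a'I oa'.
    have laI : lift I a' <= I by rewrite lift_leql.
    have ll : la = l.
      by have [_ d _ _] := Da; rewrite -(d j0) dim_ D1 dI.
    subst la; apply: (stop a' l a'I1 Da).
      move=> b' b'E x x' xl x'l E; have Ib' : I <= b' by rewrite b'E a'I1.
      have lb' : lift I b' = I.+1 :> nat by rewrite lift_ge // b'E a'I1.
      have IL : I <= lift I b' by rewrite lb'.
      apply: (NI _ lb') => // j; have := E j; rewrite !mp_; last by rewrite b'E.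
        by rewrite (mp_comp (vchP t) j laI IL oI) /= !D2 dI !(minn_idPl _).
    move=> aM y yE; have IE : I = ord_max by apply: val_inj; rewrite /= -a'I1 aM.
    have dl j : dim t ord_max j = l by rewrite -IE dI.
    have [z zE] := lastz_const dl.
    have zN := LN IE z zE; move: yE; rewrite (face_lastz tc) zE -aM.
    rewrite (_ : dim c a' = fun=> l); last by apply: funext => j; rewrite dim_ D1 dI.
    rewrite (@pull_const _ _ l l (minn^~ l)).
      by rewrite to_hom_id => E; rewrite -(existT_inj E) sact_id.
    by move=> j; rewrite -[X in mp t _ X]IE D2 dI.
- rewrite (_ : ord0 = lift I ord0); first by rewrite -ob_.
  apply: val_inj.
  by apply/esym; exact: lift_lt.
- move=> a; case: (unliftP I a) => [a' ->|-> _ _]; last by exists l.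
  rewrite lift_leql => aI oa; have [|la Da] := run1 a' aI; first by rewrite ob_.
  by exists la; apply/(dquot_face j0 tc oI).
Qed.

End Quotient.

Section Quotient.
Variables (n : nat) (Y : msset n) (j0 : 'I_n).
Local Notation dquot := (dquot j0).
Local Notation qupper := (qupper j0).
Local Notation quot_upper := (quot_upper j0).

Section Cone.
Variables (m : nat) (y : diag Y m).

(** The upper cell matched with a simplex [y] of Y: its vertices, then [y] itself as an object over
    (m, ..., m), in which the vertex [a] is [a]. *)
Definition cone_chain : chain Y m.+1 := Chain
  (fun a => a == ord_max) (fun a j => if a == ord_max then m else 0)
  (fun a b j x => if b == ord_max then if a == ord_max then minn x m else a else 0)
  (existT (fun k => Y k) (fun=> m) y).

Lemma cone_chain_ok : chain_ok cone_chain.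
Proof.
have max_le (a b : 'I_m.+2) : a <= b -> a == ord_max -> b == ord_max.
  by rewrite -!val_eqE /= => ab /eqP am; have := ltn_ord b; lia.
have lt_max (a : 'I_m.+2) : (a == ord_max) = false -> a <= m.
  by rewrite -val_eqE /=; have := ltn_ord a; lia.
split=> /=.
- by rewrite eqxx.
- exact: max_le.
- by move=> a j /negbTE ->.
- by rewrite eqxx.
- move=> a b j ab; case bm: (b == ord_max); last exact: (@clamped_const _ _ 0).
  case am: (a == ord_max); first exact: clamped_id.
  by apply: clamped_const; exact: lt_max.
- move=> a j; apply: funext => x; case: (a == ord_max) => //.
- move=> a b d j ab bd bm; apply: funext => x /=; rewrite bm (max_le _ _ bd bm).
  case am: (a == ord_max); first by rewrite -minnA minnn.
  by apply/esym/minn_idPl; exact: lt_max.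
- move=> a b d j ab bd /negbTE bm; rewrite bm.
  by case dm: (d == ord_max) => //; case am: (a == ord_max); rewrite ?min0n.
- by move=> a b j ba; apply: funext => x; case bm: (b == ord_max) => //;
    move: bm ba; rewrite -val_eqE /=; have := ltn_ord a; lia.
Qed.

Definition cone := VChain cone_chain_ok.

Lemma cone_upper : nondeg y -> qupper cone ord_max m.
Proof.
move=> yN; have om : is_ob cone ord_max by rewrite /= eqxx.
have D : dquot cone ord_max m.
  split.
  - exact: om.
  - by move=> j; rewrite /= eqxx.
  - by move=> v j /= /negbTE ->; rewrite eqxx.
  move=> x xm; have xm2 : x < m.+2 by lia.
  have xne : Ordinal xm2 != ord_max by rewrite -val_eqE /=; lia.
  by exists (Ordinal xm2); rewrite /= ?eqxx ?(negbTE xne).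
split=> //.
- apply/nondeg_chainP => a b ba; split.
    by move=> /= /eqP aM; have := ltn_ord b; rewrite ba aM /= ltnn.
  move=> nb Dg; have := Dg ord_max j0 om => /=; rewrite eqxx.
  have na : ~~ is_ob cone a by apply: vtx_le nb; rewrite ba.
  by move: na nb => /= /negbTE -> /negbTE ->; lia.
- by move=> a _ /= /eqP ->; exists m.
- by move=> b bE; have := ltn_ord b; rewrite bE /= ltnn.
- by move=> _ y' E; rewrite -(existT_inj E).
Qed.

Lemma cone_face : sact (collage Y) (dface ord_max) (inr cone) = inl y.
Proof.
have nob : ~~ is_ob cone (dface ord_max ord_max).
  by rewrite dfaceE /= eq_sym neq_lift.
rewrite [LHS](collage_act_vtx nob); congr inl.
rewrite /realize_chain mact_pull; last by move=> j; exact: last_vtx_clamped.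
rewrite (@pull_const _ _ m m (minn^~ m)); first by rewrite to_hom_id sact_id.
move=> j; apply: funext => x.
rewrite [LHS](last_vtxE cone j (dface ord_max (inord (minn x m)))) dfaceE /= eqxx.
rewrite [lift _ _ == _]eq_sym (negbTE (neq_lift _ _)) /= inordK /bump; lia.
Qed.

End Cone.

Lemma quot_self m (c : vchain Y m) i l : qupper c i l ->
  exists k (tau : collage Y k.+1) i', quot_upper tau i' /\
    existT (fun m => collage Y m) m (inr c) = existT _ k.+1 tau.
Proof.
case: m c i => [|m] c i Q.
  by have := qu_vtx Q; rewrite (_ : ord0 = i) ?(qu_ob Q) // (ord1 i).
by exists m, (inr c), i; split=> //; exists c, l.
Qed.

(** A simplex of Y is the face of its cone. For a chain, three cases arise according to the run of
    quotients at the beginning of the objects: if it is empty, the simplex of vertices is inserted;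
    if its last quotient is nondegenerate with respect to what follows, the chain is an upper cell;
    otherwise a further quotient is inserted. *)
Lemma quot_matched m (x : collage Y m) : nondeg x -> ~ all_ob x ->
  (exists (tau : collage Y m.+1) i, quot_upper tau i /\ x = sact (collage Y) (dface i) tau) \/
  (exists k (tau : collage Y k.+1) i, quot_upper tau i /\
     existT (fun m => collage Y m) m x = existT _ k.+1 tau).
Proof.
case: x => [y|c] N A.
  left; exists (inr (cone y)), ord_max; split; last by rewrite cone_face.
  by exists (cone y), m; split=> //; apply: cone_upper; apply/nondeg_inl.
have [f of_ ob_] := first_ob c.
have f0 : 0 < f.
  rewrite lt0n; apply/eqP => f0; apply: A; exists c; split=> // a.
  by rewrite ob_ f0.
have v0 : ~~ is_ob c ord0 by rewrite ob_ -ltnNge.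
(* The position [m.+1], past the end, satisfies [P] vacuously; it is the minimum when all objects
   are quotients. *)
pose P i := (f <= i) && `[< forall (a : 'I_m.+1) l, a = i :> nat -> ~ dquot c a l >].
have exP : exists i, P i.
  exists m.+1; rewrite /P ltnW ?ltn_ord //=; apply/asboolP => a l aE.
  by have := ltn_ord a; rewrite aE ltnn.
case: (ex_minnP exP) => i /andP [fi /asboolP iN] imin.
have im : i < m.+2.
  rewrite ltnS; apply: imin; rewrite /P ltnW ?ltn_ord //=; apply/asboolP => a l aE.
  by have := ltn_ord a; rewrite aE ltnn.
have before (a : 'I_m.+1) : a < i -> is_ob c a -> exists l, dquot c a l.
  move=> ai; rewrite ob_ => fa; apply: contrapT => Hn.
  have : P a.
    rewrite /P fa; apply/asboolP => b l /val_inj -> D; apply: Hn; by exists l.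
  by move/imin; lia.
have R : run j0 c i.
  split=> // a aE; split; first by rewrite ob_ aE.
  by move=> l; exact: iN.
pose I := Ordinal im.
have [fE|ne] := eqVneq (f : nat) i.
  have [t [l T]] := @quot_start _ _ j0 m c f I N ob_ f0 (esym fE).
  left; exists (inr t), I; have [tc _ _ _] := T; split=> //.
  apply: (reduced_upper T N v0 R) => a la aE [oa _ _ _].
  by move: aE oa; rewrite ob_ fE /= => <-; rewrite ltnn.
have i1 : i.-1 < m.+1 by lia.
pose i0 := Ordinal i1.
have I0 : I = i0.+1 :> nat by rewrite /= prednK //; lia.
have [||l0 D0] := before i0; [by rewrite /=; lia | by rewrite ob_ /=; lia |].
have [[NI LN]|stop] := pselect (next_inj c i0 l0 /\ last_nondeg c i0 l0).
  right; apply: (@quot_self _ c i0 l0); split=> // a ai oa.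
  by apply: before => //; move: ai; rewrite /=; lia.
have [t [l T]] := quot_step D0 I0.
left; exists (inr t), I; have [tc _ _ _] := T; split=> //.
apply: (reduced_upper T N v0 R) => a la aE Da NI LN; apply: stop.
have ai : a = i0 by apply: val_inj; rewrite /= -[i]aE.
subst a; by rewrite (dquot_unique D0 Da).
Qed.

Definition num_vtx m (c : chain Y m) : nat := \sum_(a < m.+1) ~~ is_ob c a.

(** Lexicographic in the number of vertices, then in the position of the removable object counted
    from the end; this second term is at most m + 2, whence the weight m + 3. *)
Definition quot_rank m (x : collage Y m.+1) : nat :=
  match x with
  | inl _ => 0
  | inr c => match pselect (exists i l, qupper c i l) with
             | left H => num_vtx c * (m + 3) + (m.+2 - projT1 (cid H))
             | right _ => 0
             end
  end.

Lemma quot_rankE m (c : vchain Y m.+1) i l : qupper c i l ->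
  quot_rank (inr c) = num_vtx c * (m + 3) + (m.+2 - i).
Proof.
move=> Q /=; case: pselect => [H|[]]; last by exists i, l.
by case: cid => i' /= [l' Q']; rewrite (qu_unique Q Q').
Qed.

Lemma num_vtx_le m (c : chain Y m) : num_vtx c <= m.+1.
Proof.
apply: (@leq_trans (\sum_(a < m.+1) 1)); last by rewrite sum1_card card_ord.
by apply: leq_sum => a _; case: is_ob.
Qed.

Lemma quot_rank_bound m (x : collage Y m.+1) : quot_rank x <= (m + 4) ^ 2.
Proof.
case: x => [//|c] /=; case: pselect => // H.
have := num_vtx_le c; have := leq_subr (projT1 (cid H)) m.+2.
by move: (_ - _) (num_vtx _) => i v; nia.
Qed.

Lemma num_vtx_face m (c : vchain Y m.+1) j (d : vchain Y m) :
  sact (collage Y) (dface j) (inr c) = inr d -> num_vtx c = ~~ is_ob c j + num_vtx d.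
Proof.
move=> cd; have [ob_ _ _ _] := face_act_eq cd.
rewrite /num_vtx (bigD1_ord j) //=; congr (_ + _).
by apply: eq_bigr => a _; rewrite ob_.
Qed.

(** A common face in Y would force j = i. If [j] is a vertex, [c'] has one vertex fewer than [c]. If
    [j] is an object, the numbers of vertices agree and i < i': the run of quotients of the face
    stops at [i'] and contains what is left of the quotients of [c] up to [i]. *)
Lemma quot_rank_lt m (x x' : collage Y m.+1) i i' j : quot_upper x i -> quot_upper x' i' ->
  j != i -> sact (collage Y) (dface j) x = sact (collage Y) (dface i') x' ->
  quot_rank x' < quot_rank x.
Proof.
case=> c [l [-> Q]] [c' [l' [-> Q']]] ji E.
rewrite (quot_rankE Q) (quot_rankE Q').
have oi := qu_ob Q; have oi' := qu_ob Q'.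
have [H'|H'] := boolP (is_ob c' (dface i' ord_max)); last first.
  have [y [_ _ yE _]] := qu_face_vtx Q' H'; rewrite yE in E.
  have jE : j = ord_max.
    apply/eqP/negPn/negP => /(face_ob c) H.
    by move: E; rewrite [LHS](collage_act_ob H).
  have H : ~~ is_ob c (dface j ord_max).
    by apply/negP => H; move: E; rewrite [LHS](collage_act_ob H).
  case/negP: ji; apply/eqP/val_inj/eqP; rewrite eqn_leq; apply/andP; split; last first.
    by rewrite jE; exact: le_max.
  rewrite leqNgt; apply: contra H => ij; apply: (ob_le (vchP c) _ oi).
  by rewrite dfaceE jE /= /bump; move: ij; rewrite jE /=; lia.
have cd' : sact (collage Y) (dface i') (inr c') = inr (vchain_act H') := collage_act_ob H'.
move: (vchain_act H') cd' => d cd'; rewrite cd' in E.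
rewrite (num_vtx_face E) (num_vtx_face cd') oi' add0n.
have [oj|nj] := boolP (is_ob c j); last by rewrite /=; nia.
rewrite /= add0n ltn_add2l; suff : i < i' by have := ltn_ord i'; lia.
rewrite ltnNge; apply/negP => i'i.
have [ob_ dim_ mp_ lz_] := face_act_eq E.
have [run1 run2] := qu_run Q' cd'.
have absurd (a : 'I_m.+1) : a = i' :> nat -> lift j a <= i -> False.
  move=> aE ai; have [oa Na] := run2 a aE.
  have [|la Da] := qu_le Q ai; first by rewrite -ob_.
  by apply: (Na la); apply/(dquot_face j0 E oj).
have [ij|ij] := ltnP i j.
  have i'm : i' < m.+1 by have := ltn_ord j; lia.
  apply: (absurd (Ordinal i'm) erefl); rewrite lift_lt //=; lia.
have {}ij : j < i by move: ji; rewrite -val_eqE /=; lia.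
have [i'lt|i'ge] := ltnP i' i.
  have i'm : i' < m.+1 by have := ltn_ord i; lia.
  by apply: (absurd (Ordinal i'm) erefl); rewrite /= /bump; lia.
have {i'i i'ge} i'E : i' = i by apply: val_inj; rewrite /=; lia.
subst i'; have im : i.-1 < m.+1 by have := ltn_ord i; lia.
pose a : 'I_m.+1 := Ordinal im.
have aE : a.+1 = i :> nat by rewrite /= prednK //; lia.
have la : lift j a = i by apply: val_inj; rewrite /= /bump; lia.
(* The remaining case has j < i and i' = i: the quotient [i] of [c] has become the one just before
   position [i'] in the face, and it is still nondegenerate with respect to what follows. *)
apply: (@qu_stop _ _ _ _ _ _ _ Q' d cd' a l aE).
- by apply/(dquot_face j0 E oj); rewrite la; exact: qu_dquot Q.
- move=> b bE u u' ul u'l He.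
  have lb : lift j b = i.+1 :> nat by rewrite -aE -bE lift_ge // bE; lia.
  apply: (qu_next Q lb) => // j'; have := He j'.
  by rewrite !mp_ ?bE // la.
- move=> aM y yE; have iE : i = ord_max.
    by apply: val_inj; apply: etrans (esym aE) _; rewrite aM.
  apply: (qu_last Q iE); rewrite -lz_ //.
  by move: ji; rewrite iE.
Qed.

Lemma quot_anodyne : anodyne (@all_ob n Y).
Proof.
apply: (@match_anodyne (collage Y) (@all_ob n Y) (@all_ob_act n Y) quot_upper quot_rank).
- exact: quot_matched.
- by move=> m x i [c [l [-> []]]].
- exact: quot_lower_nondeg.
- exact: quot_lowerNA.
- exact: quot_upper_face.
- exact: quot_lower_inj.
- exact: quot_lower_upper.
- exact: quot_rank_bound.
- exact: quot_rank_lt.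
Qed.

End Quotient.

Import Order.TTheory GRing.Theory Num.Theory.
Import numFieldNormedType.Exports.
Local Open Scope ring_scope.
Local Open Scope classical_set_scope.

(** * Geometric realization *)

Lemma pair_continuous (T A B : topologicalType) (f : T -> A) (g : T -> B) :
  continuous f -> continuous g -> continuous (fun x => (f x, g x)).
Proof. by move=> cf cg x; apply: (cvg_pair (cf x) (cg x)). Qed.

Lemma comp_continuous (S T U : topologicalType) (f : S -> T) (g : T -> U) :
  continuous f -> continuous g -> continuous (g \o f).
Proof. by move=> cf cg x; apply: continuous_comp; [exact: cf | exact: cg]. Qed.

Lemma id_continuous (T : topologicalType) : continuous (@id T).
Proof. by move=> x; exact: cvg_id. Qed.

Lemma cst_continuous' (S T : topologicalType) (a : T) : continuous (fun _ : S => a).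
Proof. by move=> x; exact: cvg_cst. Qed.

Lemma fst_continuous (S T : topologicalType) : continuous (@fst S T).
Proof. by move=> x; exact: cvg_fst. Qed.

Lemma snd_continuous (S T : topologicalType) : continuous (@snd S T).
Proof. by move=> x; exact: cvg_snd. Qed.

Section Realization.
Variables (R : realType) (X : sset).

Definition rpt k (x : X k) (t : @simplex R k) : realization R X :=
  realization_pi (point_of x t).

Lemma rpt_glue k l (f : dhom k l) (x : X l) (t : @simplex R k) :
  rpt (sact X f x) t = rpt x (simplex_map f t).
Proof. by apply/eqmodP/asboolP/rst_step; exact: Glue. Qed.

Lemma rpt_surj (z : realization R X) : exists k (x : X k) t, z = rpt x t.
Proof.
rewrite -[z](@reprK _ (quotient_topology {eq_quot glued_rel R X}%qT)).
by case: (repr z) => -[k x] t; exists k, x, t.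
Qed.

Lemma realization_open (U : set (realization R X)) :
  open U <-> forall k (x : X k), open [set t | U (rpt x t)].
Proof.
split=> [H k x|H].
  by move/sigT_openP: H => /(_ (existT _ k x)).
by apply/sigT_openP => -[k x]; exact: H.
Qed.

Lemma rpt_continuous k (x : X k) : continuous (rpt x).
Proof.
by apply/continuousP => U oU; exact: ((realization_open U).1 oU k x).
Qed.

Section Glue.
Variables (T : Type) (phi : forall k, X k -> @simplex R k -> T).
Hypothesis phi_nat : forall k l (f : dhom k l) (x : X l) t,
  phi (sact X f x) t = phi x (simplex_map f t).

Definition glue_map (z : realization R X) : T :=
  phi (projT2 (projT1 (repr z) : {k & X k})) (projT2 (repr z)).

Lemma glue_map_rpt k (x : X k) t : glue_map (rpt x t) = phi x t.
Proof.
pose f (p : prerealize R X) := phi (projT2 (projT1 p : {k & X k})) (projT2 p).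
have H (u v : prerealize R X) :
    clos_refl_sym_trans (prerealize R X) (@Defs.glue R X) u v -> f u = f v.
  by elim=> // [_ _ [k' l' g y s]|u' v' w' _ -> _ ->] //; exact: phi_nat.
apply: (H _ (point_of x t)); apply/asboolP.
apply: (introT (b := glued _ _) idP).
by apply/(@eqmodP _ (glued_rel R X)); exact: reprK.
Qed.

End Glue.

Lemma realization_continuous (Z : topologicalType) (f : realization R X -> Z) :
  (forall k (x : X k), continuous (f \o rpt x)) -> continuous f.
Proof.
move=> H; apply/continuousP => U oU; apply/realization_open => k x.
by have /continuousP/(_ U oU) := H k x.
Qed.

(* The real line being locally compact, its product with the quotient map onto
   the realization is again a quotient map. *)
Lemma realization_homotopy_continuous (Z : topologicalType)
    (H : R * realization R X -> Z) :
  (forall k (x : X k), continuous (fun st : R * @simplex R k => H (st.1, rpt x st.2))) ->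
  continuous H.
Proof.
move=> cH; have cs z : continuous (fun s => H (s, z)).
  have [k [x [t ->]]] := rpt_surj z.
  apply: (comp_continuous (f := fun s => (s, t)) _ (cH k x)).
  by apply: pair_continuous; [exact: id_continuous | exact: cst_continuous'].
apply/continuousP => O oO; rewrite openE => -[s0 z0] /= Hs0.
have : nbhs s0 [set s | O (H (s, z0))].
  by have /continuousP/(_ O oO) := cs z0; rewrite openE; apply.
move=> /nbhs_ballP [e /= e0 He].
pose K : set R := `[s0 - e / 2, s0 + e / 2]%classic.
(* Open by the tube lemma, applied on each cell with the compact interval [K]. *)
pose V : set (realization R X) := [set z | forall s, K s -> O (H (s, z))].
have oV : open V.
  apply/realization_open => k x; rewrite openE => t /= Kt.
  have /compact_near_coveringP cK : compact K := @segment_compact _ _ _.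
  apply: (cK _ (nbhs t) (fun t s => O (H (s, rpt x t))) _) => s Ks.
  have : nbhs (s, t) [set st : R * @simplex R k | O (H (st.1, rpt x st.2))].
    have /continuousP/(_ O oO) := cH k x; rewrite openE; apply; exact: Kt.
  by [].
have Vz0 : V z0.
  move=> s; rewrite /K /= in_itv /= => /andP [h1 h2]; apply: He.
  rewrite /ball /= ltr_distl; apply/andP; split; lra.
exists (ball s0 (e / 2), V); last first.
  case=> s z /= [hs Vz]; apply: Vz; rewrite /K /= in_itv /=.
  by move: hs; rewrite /ball /= ltr_distlC => /andP [h1 h2]; apply/andP; split; lra.
split; first by apply: nbhsx_ballx; lra.
exact: open_nbhs_nbhs.
Qed.

End Realization.

Section RealizationMaps.
Variable R : realType.

Lemma realize_map_rpt (X Y : sset) (F : smap X Y) k (x : X k) (t : @simplex R k) :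
  realize_map F (rpt x t) = rpt (F k x) t.
Proof. exact: realize_map_pi. Qed.

End RealizationMaps.

Section RealValued.
Variables (R : realType) (T : topologicalType).
Implicit Types f g : T -> R.

Lemma add_continuous f g :
  continuous f -> continuous g -> continuous (fun x => f x + g x).
Proof. by move=> cf cg x; apply: continuousD; [exact: cf | exact: cg]. Qed.

Lemma sub_continuous f g :
  continuous f -> continuous g -> continuous (fun x => f x - g x).
Proof. by move=> cf cg x; apply: continuousB; [exact: cf | exact: cg]. Qed.

Lemma mul_continuous f g :
  continuous f -> continuous g -> continuous (fun x => f x * g x).
Proof. by move=> cf cg x; apply: continuousM; [exact: cf | exact: cg]. Qed.

Lemma min_continuous f g :
  continuous f -> continuous g -> continuous (fun x => Num.min (f x) (g x)).
Proof. by move=> cf cg x; apply: (@continuous_min R T f g x); [exact: cf | exact: cg]. Qed.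

Lemma max_continuous f g :
  continuous f -> continuous g -> continuous (fun x => Num.max (f x) (g x)).
Proof. by move=> cf cg x; apply: (@continuous_max R T f g x); [exact: cf | exact: cg]. Qed.

Lemma inv_continuous f :
  (forall x, f x != 0) -> continuous f -> continuous (fun x => (f x)^-1).
Proof. by move=> f0 cf x; apply: cvgV; [exact: f0 | exact: cf]. Qed.

Lemma sum_continuous (I : Type) (r : seq I) (P : pred I) (F : I -> T -> R) :
  (forall i, continuous (F i)) -> continuous (fun x => \sum_(i <- r | P i) F i x).
Proof.
move=> cF; elim: r => [|i r IH].
  under eq_fun do rewrite big_nil.
  exact: cst_continuous'.
under eq_fun do rewrite big_cons.
by case: (P i) => //; exact: add_continuous.
Qed.

Lemma bigmin_continuous (I : Type) (r : seq I) (P : pred I) (F : I -> T -> R) a :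
  (forall i, continuous (F i)) ->
  continuous (fun x => \big[Num.min/a]_(i <- r | P i) F i x).
Proof.
move=> cF; elim: r => [|i r IH].
  under eq_fun do rewrite big_nil.
  exact: cst_continuous'.
under eq_fun do rewrite big_cons.
by case: (P i) => //; exact: min_continuous.
Qed.

Lemma row_continuous k (f : T -> 'rV[R]_k) :
  (forall i, continuous (fun x => f x ord0 i)) -> continuous f.
Proof.
move=> cf x A /= [P HP HA]; rewrite nbhs_simpl /=.
have : \forall y \near x, forall i, P ord0 i (f y ord0 i).
  apply: filter_forall => i; exact: (cf i x _ (HP ord0 i)).
by apply: filterS => y Hy; apply: HA => i j; rewrite ord1.
Qed.

Lemma le_closed f g : continuous f -> continuous g ->
  closed [set x | f x <= g x].
Proof.
move=> cf cg.
rewrite (_ : [set x | _] = (fun x => g x - f x) @^-1` [set y | 0 <= y]).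
  by apply: preimage_closed; [move=> x _; exact: sub_continuous | exact: closed_ge].
by apply/seteqP; split=> x /=; rewrite subr_ge0.
Qed.

End RealValued.

(** The map [g] depends on a proof of [P i] because, for a horn, only the faces opposite to j != i
    carry a map. *)
Lemma paste_continuous (T Z : topologicalType) (I : finType) (P : pred I)
    (K : I -> set T) (f : T -> Z) (g : forall i, P i -> T -> Z) :
  (forall i, P i -> closed (K i)) -> (forall x, exists2 i, P i & K i x) ->
  (forall i Pi, continuous (g i Pi)) ->
  (forall i Pi x, K i x -> f x = g i Pi x) -> continuous f.
Proof.
move=> cK KT cg fg; apply/continuous_closedP => A cA.
rewrite (_ : f @^-1` A = \bigcup_(i in [set i | P i]) (K i `&` f @^-1` A)).
  apply: closed_bigcup => [|i Pi]; first exact: finite_finset.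
  rewrite (_ : _ `&` _ = K i `&` g i Pi @^-1` A).
    apply: closedI; first exact: cK.
    by have /continuous_closedP := cg i Pi; exact.
  by apply/seteqP; split=> x /= [Kx]; rewrite (fg i Pi).
apply/seteqP; split=> x /=; last by case=> i _ [].
by move=> fA; have [i Pi Ki] := KT x; exists i.
Qed.

Lemma paste2_continuous (T Z : topologicalType) (K L : set T) (f g h : T -> Z) :
  closed K -> closed L -> (forall x, K x \/ L x) ->
  continuous g -> continuous h ->
  (forall x, K x -> f x = g x) -> (forall x, L x -> f x = h x) -> continuous f.
Proof.
move=> cK cL KL cg ch fg fh.
apply: (@paste_continuous _ _ bool xpredT (fun b => if b then K else L) f
  (fun b _ => if b then g else h)).
- by case.
- by move=> x; case: (KL x); [exists true | exists false].
- by case.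
- by move=> [] _ x /=; [exact: fg | exact: fh].
Qed.

Section Simplex.
Variable R : realType.

Lemma simplex_coord_continuous m i : continuous (fun t : @simplex R m => val t ord0 i).
Proof.
apply: (comp_continuous (f := fun t : @simplex R m => val t)
  (g := fun v : 'rV[R]_m.+1 => v ord0 i)); last exact: coord_continuous.
exact: initial_continuous.
Qed.

Lemma to_simplex_continuous (T : topologicalType) m (f : T -> @simplex R m) :
  (forall i, continuous (fun x => val (f x) ord0 i)) -> continuous f.
Proof.
move=> cf; apply: continuous_comp_initial.
exact: row_continuous.
Qed.

Lemma simplex_eq m (t u : @simplex R m) :
  (forall i, val t ord0 i = val u ord0 i) -> t = u.
Proof. by move=> H; apply: val_inj; apply/rowP. Qed.

Lemma simplex_ge0 m (t : @simplex R m) i : 0 <= val t ord0 i.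
Proof. by have /set_mem [] := valP t. Qed.

Lemma simplex_sum m (t : @simplex R m) : \sum_i val t ord0 i = 1.
Proof. by have /set_mem [] := valP t. Qed.

Lemma simplex_mapE k l (f : dhom k l) (t : @simplex R k) b :
  val (simplex_map f t) ord0 b = \sum_(a | f a == b) val t ord0 a.
Proof. by rewrite mxE. Qed.

Lemma simplex_map_continuous k l (f : dhom k l) :
  continuous (@simplex_map R k l f).
Proof.
apply: to_simplex_continuous => b.
under eq_fun do rewrite simplex_mapE.
by apply: sum_continuous => a; exact: simplex_coord_continuous.
Qed.

Lemma simplex_map_comp k l m (g : dhom l m) (f : dhom k l) (t : @simplex R k) :
  simplex_map (dcomp g f) t = simplex_map g (simplex_map f t).
Proof.
apply: simplex_eq => c; rewrite !simplex_mapE.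
under [RHS]eq_bigr do rewrite simplex_mapE.
rewrite (partition_big f (fun b => g b == c)) /=; last by move=> a; rewrite dcompE.
apply: eq_bigr => b /eqP gb; apply: eq_bigl => a.
by rewrite dcompE; case: (f a =P b) => [->|_]; rewrite ?andbF // gb !eqxx.
Qed.

Lemma simplex_map_id k (t : @simplex R k) : simplex_map (did k) t = t.
Proof.
apply: simplex_eq => b; rewrite simplex_mapE (bigD1 b) /= ?didE // big1 ?addr0 //.
by move=> a /andP [/eqP <-]; rewrite didE eqxx.
Qed.

Lemma simplex_map_fix k (e : dhom k k) (t : @simplex R k) :
  (forall a, val t ord0 a != 0 -> e a = a) -> simplex_map e t = t.
Proof.
move=> He; apply: simplex_eq => b; rewrite simplex_mapE.
have [tb|tb] := eqVneq (val t ord0 b) 0; last first.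
  rewrite (bigD1 b) ?He //= big1 ?addr0 // => a /andP [/eqP ea ab].
  by apply/eqP/negPn/negP => /He; rewrite ea => E; rewrite E eqxx in ab.
rewrite tb big1 // => a /eqP ea; apply/eqP/negPn/negP => ta.
by move: (ta); rewrite -(He a ta) ea tb eqxx.
Qed.

End Simplex.

(** * Realization of anodyne extensions *)

Section Collapse.
Variables (m : nat) (i : 'I_m.+1).

(** The retraction onto the face opposite to [j] that moves [j] one step towards [i]. Composing with
    it extends to the whole simplex the data given on a face of the horn. *)
Definition collapse_fun (j a : 'I_m.+1) : 'I_m.+1 :=
  if a == j then (if (j < i)%N then inord j.+1 else inord j.-1) else a.

Lemma collapse_val (j a : 'I_m.+1) : j != i -> collapse_fun j a =
  (if a == j :> nat then (if j < i then j.+1 else j.-1)%N else a) :> nat.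
Proof.
move=> ji; have jiN : j <> i :> nat by move/val_inj => E; rewrite E eqxx in ji.
rewrite /collapse_fun -val_eqE /=; case: (_ == _ :> nat) => //.
have hi := ltn_ord i; have hj := ltn_ord j; case: ifP => h; rewrite inordK; lia.
Qed.

Lemma collapse_mono (j a b : 'I_m.+1) : j != i -> (a <= b)%N ->
  (collapse_fun j a <= collapse_fun j b)%N.
Proof.
move=> ji ab; rewrite !collapse_val //; have := ltn_ord a; have := ltn_ord b.
by do !case: ifP; lia.
Qed.

Definition collapse (j : 'I_m.+1) : dhom m m :=
  if pselect (j != i) is left ji then mkdhom (fun a b => @collapse_mono j a b ji)
  else did m.

Lemma collapseE j a : j != i -> collapse j a = collapse_fun j a.
Proof. by move=> ji; rewrite /collapse; case: pselect => // ji'; rewrite ffunE. Qed.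

Lemma collapse_fix j a : a != j -> collapse j a = a.
Proof.
rewrite /collapse; case: pselect => [ji|_] ne; rewrite ffunE //.
by rewrite /collapse_fun (negbTE ne).
Qed.

Lemma collapse_neq j a : j != i -> collapse j a != j.
Proof.
move=> ji; have jiN : j <> i :> nat by move/val_inj => E; rewrite E eqxx in ji.
have := ltn_ord i; have := ltn_ord j.
by rewrite -val_eqE /= collapseE // collapse_val //; do !case: ifP; lia.
Qed.

(** Vertices that move towards [i] cannot be exchanged: they would be adjacent and on both sides of
    [i]. *)
Lemma collapse_neq2 j k : j != i -> k != i ->
  collapse k k != j \/ collapse j j != k.
Proof.
move=> ji ki.
have jiN : j <> i :> nat by move/val_inj => E; rewrite E eqxx in ji.
have kiN : k <> i :> nat by move/val_inj => E; rewrite E eqxx in ki.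
have := ltn_ord i; have := ltn_ord j; have := ltn_ord k => h1 h2 h3.
apply/orP; rewrite -!val_eqE /= !collapseE // !collapse_val //.
by do !case: ifP; lia.
Qed.

Lemma collapse_horn j : j != i -> in_horn i (collapse j).
Proof. by move=> ji; exists j => // a; exact: collapse_neq. Qed.

End Collapse.

Section Flow.
Variables (R : realType) (m : nat) (i : 'I_m.+2).
Implicit Types (t : @simplex R m.+1).

(** Vanishes exactly on the horn omitting the face opposite to [i]; it is the amount by which the
    other coordinates can decrease before the horn is reached. *)
Definition depth t : R := \big[Num.min/1]_(j | j != i) val t ord0 j.

Lemma depth_le1 t : depth t <= 1.
Proof. exact: bigmin_le_id. Qed.

Lemma depth_le t j : j != i -> depth t <= val t ord0 j.
Proof. by move=> ji; exact: (@bigmin_inf _ _ _ _ j (fun j => j != i)). Qed.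

Lemma depth_ge0 t : 0 <= depth t.
Proof. by apply: le_bigmin => // j _; exact: simplex_ge0. Qed.

Lemma depth_attained t : exists2 j, j != i & val t ord0 j = depth t.
Proof.
have [j0 ji] : exists j, j != i.
  by have [->|ne] := eqVneq i ord0; [exists ord_max | exists ord0; rewrite eq_sym].
have t1 j : val t ord0 j <= 1.
  rewrite -(simplex_sum t) (bigD1 j) //= lerDl.
  by apply: sumr_ge0 => k _; exact: simplex_ge0.
have [j ji' E] := eq_bigmin j0 (fun k => k != i) (fun k => val t ord0 k) ji
  (fun k _ => t1 k).
by exists j.
Qed.

Definition amount (c : R) t := Num.min (depth t) (Num.max 0 c).

Lemma amount_le c t : amount c t <= depth t.
Proof. by rewrite /amount ge_min lexx. Qed.

Lemma amount_ge0 c t : 0 <= amount c t.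
Proof. by rewrite /amount le_min depth_ge0 le_max lexx. Qed.

Definition flow_row (c : R) t : 'rV[R]_m.+2 :=
  \row_j (if j == i then val t ord0 i + (amount c t) *+ m.+1
          else val t ord0 j - amount c t).

Lemma flow_subproof c t : flow_row c t \in @simplex R m.+1.
Proof.
apply/mem_set; split=> [j|].
  rewrite mxE; case: eqVneq => [_|ji].
    by rewrite addr_ge0 ?mulrn_wge0 ?amount_ge0 ?simplex_ge0.
  by rewrite subr_ge0; apply: le_trans (amount_le c t) (depth_le t ji).
rewrite -(simplex_sum t) (bigD1 i) //= [RHS](bigD1 i) //= mxE eqxx.
rewrite (eq_bigr (fun j => val t ord0 j - amount c t)); last first.
  by move=> j /negbTE ji; rewrite mxE ji.
rewrite big_split /= sumrN sumr_const.
have -> : #|[pred j | j != i]| = m.+1.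
  by have := cardC1 i; rewrite card_ord; apply: etrans; exact: eq_card.
move: (amount c t *+ m.+1) => b; ring.
Qed.

(* Moves the point t away from the face opposite to i, along the direction which
   decreases all the other coordinates at the same speed. *)
Definition flow c t : @simplex R m.+1 := exist _ (flow_row c t) (flow_subproof c t).

Lemma flow_fix c t : amount c t = 0 -> flow c t = t.
Proof.
move=> E; apply: simplex_eq => j; rewrite /flow /= mxE E mul0rn subr0 addr0.
by case: eqVneq => [->|].
Qed.

Lemma flow_depth c t j : j != i -> depth t <= c -> val t ord0 j = depth t ->
  val (flow c t) ord0 j = 0.
Proof.
move=> /negbTE ji dc tj; rewrite mxE ji tj /amount (max_idPr _).
  by rewrite (min_idPl dc) subrr.
exact: le_trans (depth_ge0 t) dc.
Qed.

Section Continuity.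
Variable T : topologicalType.

Lemma depth_continuous (f : T -> @simplex R m.+1) :
  continuous f -> continuous (fun x => depth (f x)).
Proof.
move=> cf; apply: bigmin_continuous => j.
exact: (comp_continuous cf (@simplex_coord_continuous R m.+1 j)).
Qed.

Lemma flow_continuous (c : T -> R) (f : T -> @simplex R m.+1) :
  continuous c -> continuous f -> continuous (fun x => flow (c x) (f x)).
Proof.
move=> cc cf; have ca : continuous (fun x => amount (c x) (f x)).
  apply: min_continuous; first exact: depth_continuous.
  by apply: max_continuous => //; exact: cst_continuous'.
have cj j := comp_continuous cf (@simplex_coord_continuous R m.+1 j).
apply: to_simplex_continuous => j; under eq_fun do rewrite mxE.
case: eqVneq => _; last by apply: sub_continuous => //; exact: cj.
apply: add_continuous; first exact: cj.
under eq_fun do rewrite -mulr_natr.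
by apply: mul_continuous => //; exact: cst_continuous'.
Qed.

End Continuity.
End Flow.

Section Deformation.
Variables (R : realType) (A M : sset) (inc : smap A M).
Local Notation geo := (realization R).

(* A simplex of M together with a map of it to |A|, and a homotopy to its
   characteristic map. *)
Record deformation m := Deformation {
  def_cell : M m;
  def_ret : @simplex R m -> geo A;
  def_hom : R * @simplex R m -> geo M;
  def_ret_cont : continuous def_ret;
  def_hom_cont : continuous def_hom;
  def_hom0 : forall t, def_hom (0, t) = realize_map inc (def_ret t);
  def_hom1 : forall s t, 1 <= s -> def_hom (s, t) = rpt def_cell t
}.

Lemma deformation_eq m (d e : deformation m) : def_cell d = def_cell e ->
  (forall t, def_ret d t = def_ret e t) ->
  (forall st, def_hom d st = def_hom e st) -> d = e.
Proof.
case: d e => [x r h c1 c2 c3 c4] [x' r' h' c1' c2' c3' c4'] /= E1 /funext E2 /funext E3.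
by subst x' r' h'; congr Deformation; exact: Prop_irrelevance.
Qed.

Lemma simplex_map2_continuous k l (f : dhom k l) :
  continuous (fun st : R * @simplex R k => (st.1, simplex_map f st.2)).
Proof.
apply: pair_continuous; first exact: fst_continuous.
exact: (comp_continuous (@snd_continuous _ _) (@simplex_map_continuous R _ _ f)).
Qed.

Definition deformation_act k l (f : dhom k l) (d : deformation l) : deformation k.
Proof.
refine (@Deformation k (sact M f (def_cell d))
  (fun t => def_ret d (simplex_map f t))
  (fun st => def_hom d (st.1, simplex_map f st.2)) _ _ _ _).
- exact: (comp_continuous (@simplex_map_continuous R _ _ f) (@def_ret_cont _ d)).
- exact: (comp_continuous (@simplex_map2_continuous _ _ f) (@def_hom_cont _ d)).
- by move=> t /=; exact: def_hom0.
- by move=> s t s1 /=; rewrite rpt_glue; exact: def_hom1.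
Defined.

(** A section of [deformation_cell] is a choice of deformations compatible with all simplicial
    operators, that is, one that descends to the realization of [M]. *)
Definition deformations : sset.
Proof.
refine (@SSet deformation deformation_act _ _).
- move=> k d; apply: deformation_eq => /= [|t|[s t]].
  + exact: sact_id.
  + by rewrite simplex_map_id.
  + by rewrite simplex_map_id.
- move=> k l m f g d; apply: deformation_eq => /= [|t|[s t]].
  + exact: sact_comp.
  + by rewrite simplex_map_comp.
  + by rewrite simplex_map_comp.
Defined.

Definition deformation_cell : smap deformations M :=
  @SMap deformations M def_cell (fun k l f d => erefl).

Section HornLift.
Variables (m : nat) (tau : M m.+1) (i : 'I_m.+2).
Variable phi : forall k (theta : dhom k m.+1), in_horn i theta -> deformation k.
Hypothesis phi_cell : forall k theta H, def_cell (phi (k := k) (theta := theta) H) = sact M theta tau.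
Hypothesis phi_act : forall k l (f : dhom k l) theta (H : in_horn i theta)
  (H' : in_horn i (dcomp theta f)), phi H' = deformation_act f (phi H).

Definition face j (ji : j != i) : deformation m.+1 := phi (collapse_horn ji).

Lemma phi_irr k (theta theta' : dhom k m.+1) H H' :
  theta = theta' -> phi (theta := theta) H = phi (theta := theta') H'.
Proof. by move=> E; subst theta'; congr phi; exact: Prop_irrelevance. Qed.

Lemma face_act k (theta : dhom k m.+1) (H : in_horn i theta) j (ji : j != i) :
  (forall a, theta a != j) -> deformation_act theta (face ji) = phi H.
Proof.
move=> Hj; have H' := in_horn_comp theta (collapse_horn ji).
rewrite /face -(phi_act (collapse_horn ji) H'); apply: phi_irr.
by apply: dhom_eq => a; rewrite dcompE collapse_fix.
Qed.

Lemma collapse_fix_point j (t : @simplex R m.+1) : val t ord0 j = 0 ->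
  simplex_map (collapse i j) t = t.
Proof.
move=> tj; apply: simplex_map_fix => a ta; apply: collapse_fix.
by apply: contra ta => /eqP ->; rewrite tj.
Qed.

(** The point [t] is fixed by the composite [e] of the two collapses, whose image avoids both [j]
    and [k]; both sides are then the datum [phi] at [e]. *)
Lemma face_eq1 j k (ji : j != i) (ki : k != i) (t : @simplex R m.+1) :
  val t ord0 j = 0 -> val t ord0 k = 0 -> collapse i k k != j ->
  def_ret (face ji) t = def_ret (face ki) t /\
  forall s, def_hom (face ji) (s, t) = def_hom (face ki) (s, t).
Proof.
move=> tj tk kj; pose e := dcomp (collapse i k) (collapse i j).
have Et : simplex_map e t = t.
  by rewrite simplex_map_comp !collapse_fix_point.
have ek a : e a != k by rewrite dcompE; exact: collapse_neq.
have ej a : e a != j.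
  rewrite dcompE; have [->//|ne] := eqVneq (collapse i j a) k.
  by rewrite collapse_fix // collapse_neq.
have He : in_horn i e by exists j.
have := face_act He ki ek; rewrite -(face_act He ji ej) => E.
have Er := congr1 (fun d => def_ret d t) E.
have Eh := congr1 (fun d => def_hom d) E.
move: Er => /=; rewrite Et => ->; split=> // s.
by have := congr1 (fun h => h (s, t)) Eh; rewrite /= Et => ->.
Qed.

Lemma face_eq j k (ji : j != i) (ki : k != i) (t : @simplex R m.+1) :
  val t ord0 j = 0 -> val t ord0 k = 0 ->
  def_ret (face ji) t = def_ret (face ki) t /\
  forall s, def_hom (face ji) (s, t) = def_hom (face ki) (s, t).
Proof.
move=> tj tk; have [kj|jk] := collapse_neq2 ji ki; first exact: face_eq1.
by have [E1 E2] := face_eq1 ki ji tk tj jk; split=> // s; rewrite E2.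
Qed.

Let sel (t : @simplex R m.+1) := cid2 (depth_attained i t).

Lemma flow1_eq0 (t : @simplex R m.+1) j : j != i -> val t ord0 j = depth i t ->
  val (flow i 1 t) ord0 j = 0.
Proof. by move=> ji; apply: flow_depth => //; exact: depth_le1. Qed.

(** The point is pushed onto the horn by the flow. By [face_eq], the choice of a face reached there
    does not matter. *)
Definition lift_ret (t : @simplex R m.+1) : geo A :=
  def_ret (face (s2valP (sel t))) (flow i 1 t).

Lemma lift_retE (t : @simplex R m.+1) j (ji : j != i) : val t ord0 j = depth i t ->
  lift_ret t = def_ret (face ji) (flow i 1 t).
Proof.
move=> tj; have [] // := face_eq (s2valP (sel t)) ji (t := flow i 1 t).
  exact: (flow1_eq0 (s2valP (sel t)) (s2valP' (sel t))).
exact: flow1_eq0.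
Qed.

Lemma coord_depth_closed (T : topologicalType) (f : T -> @simplex R m.+1) j :
  continuous f -> j != i -> closed [set x | val (f x) ord0 j = depth i (f x)].
Proof.
move=> cf ji.
rewrite (_ : [set x | _] = [set x | val (f x) ord0 j <= depth i (f x)]).
  apply: le_closed; last exact: depth_continuous.
  exact: (comp_continuous cf (@simplex_coord_continuous R m.+1 j)).
apply/seteqP; split=> x /=; first by move=> ->.
by move=> H; apply/eqP; rewrite eq_le H depth_le.
Qed.

Lemma flow1_continuous : continuous (flow (R := R) i 1).
Proof.
exact: (@flow_continuous R m i _ (fun=> 1) id (@cst_continuous' _ _ _) (@id_continuous _)).
Qed.

Lemma lift_ret_continuous : continuous lift_ret.
Proof.
apply: (@paste_continuous (@simplex R m.+1) (geo A) 'I_m.+2 (fun j => j != i)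
  (fun j => [set t : @simplex R m.+1 | val t ord0 j = depth i t]) lift_ret
  (fun j ji t => def_ret (face ji) (flow i 1 t))).
- by move=> j ji; exact: (coord_depth_closed (@id_continuous (@simplex R m.+1))).
- by move=> t; have [j ji tj] := depth_attained i t; exists j.
- by move=> j ji; exact: (comp_continuous flow1_continuous (@def_ret_cont _ (face ji))).
- by move=> j ji t; exact: lift_retE.
Qed.

Definition lift_tail (st : R * @simplex R m.+1) : geo M :=
  def_hom (face (s2valP (sel st.2))) (st.1 / (1 - depth i st.2 / 2), flow i 1 st.2).

Lemma lift_tailE (st : R * @simplex R m.+1) j (ji : j != i) : val st.2 ord0 j = depth i st.2 ->
  lift_tail st = def_hom (face ji) (st.1 / (1 - depth i st.2 / 2), flow i 1 st.2).
Proof.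
case: st => s t /= tj.
have [||_ H] := face_eq (s2valP (sel t)) ji (t := flow i 1 t).
- exact: (flow1_eq0 (s2valP (sel t)) (s2valP' (sel t))).
- exact: flow1_eq0.
- exact: H.
Qed.

(** Halving the depth leaves at least half of the time to the homotopy on the horn, so the rescaling
    of time in [lift_tail] is continuous. *)
Lemma half_depth_neq0 (t : @simplex R m.+1) : 1 - depth i t / 2 != 0.
Proof. by have := depth_le1 i t => H; apply: lt0r_neq0; lra. Qed.

Lemma lift_tail_continuous : continuous lift_tail.
Proof.
apply: (@paste_continuous (R * @simplex R m.+1)%type (geo M) 'I_m.+2 (fun j => j != i)
  (fun j => [set st : R * @simplex R m.+1 | val st.2 ord0 j = depth i st.2]) lift_tail
  (fun j ji st => def_hom (face ji) (st.1 / (1 - depth i st.2 / 2), flow i 1 st.2))).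
- by move=> j ji; exact: (coord_depth_closed (@snd_continuous R (@simplex R m.+1))).
- by move=> st; have [j ji tj] := depth_attained i st.2; exists j.
- move=> j ji; apply: (comp_continuous _ (@def_hom_cont _ (face ji))).
  apply: pair_continuous.
    apply: mul_continuous; first exact: fst_continuous.
    apply: inv_continuous => [st|]; first exact: half_depth_neq0.
    apply: sub_continuous; first exact: cst_continuous'.
    apply: mul_continuous; last exact: cst_continuous'.
    exact: depth_continuous (@snd_continuous _ _).
  exact: (comp_continuous (@snd_continuous _ _) flow1_continuous).
- by move=> j ji st; exact: lift_tailE.
Qed.

(* The homotopy on the horn is run during the time [1 - depth / 2]; the rest of
   the time is used to flow back from the horn to the given point. *)
Definition lift_hom (st : R * @simplex R m.+1) : geo M :=
  if 2 * (1 - st.1) <= depth i st.2 then rpt tau (flow i (2 * (1 - st.1)) st.2)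
  else lift_tail st.

(** Where the two formulas meet, the homotopy on the horn has just ended, and both give the image in
    [tau] of the point pushed onto the horn. *)
Lemma lift_hom_tail (st : R * @simplex R m.+1) : depth i st.2 <= 2 * (1 - st.1) -> lift_hom st = lift_tail st.
Proof.
case: st => s t /= H; rewrite /lift_hom /=; case: ifP => // H'.
have [j ji tj] := depth_attained i t.
have E : depth i t = 2 * (1 - s) by apply/eqP; rewrite eq_le H H'.
rewrite (@lift_tailE (s, t) j ji tj) /= def_hom1; last first.
  have -> : 1 - depth i t / 2 = s by rewrite E; lra.
  by rewrite divff //; have := depth_le1 i t; rewrite E => ?; apply: lt0r_neq0; lra.
rewrite phi_cell rpt_glue collapse_fix_point; last exact: flow1_eq0.
congr (rpt tau _); apply: simplex_eq => k; rewrite !mxE.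
suff -> : amount i (2 * (1 - s)) t = amount i 1 t by [].
rewrite -E /amount (max_idPr (depth_ge0 i t)) (max_idPr ler01) minxx.
by rewrite (min_idPl (depth_le1 i t)).
Qed.

Lemma two_cos : continuous (fun st : R * @simplex R m.+1 => 2 * (1 - st.1)).
Proof.
apply: mul_continuous; first exact: cst_continuous'.
by apply: sub_continuous; [exact: cst_continuous' | exact: fst_continuous].
Qed.

Lemma lift_hom_continuous : continuous lift_hom.
Proof.
apply: (@paste2_continuous _ _ [set st | 2 * (1 - st.1) <= depth i st.2]
  [set st | depth i st.2 <= 2 * (1 - st.1)] lift_hom
  (fun st => rpt tau (flow i (2 * (1 - st.1)) st.2)) lift_tail).
- apply: le_closed; first exact: two_cos.
  exact: depth_continuous (@snd_continuous _ _).
- apply: le_closed; last exact: two_cos.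
  exact: depth_continuous (@snd_continuous _ _).
- by move=> st; apply/orP; exact: le_total.
- apply: (comp_continuous _ (@rpt_continuous _ _ _ tau)).
  by apply: flow_continuous; [exact: two_cos | exact: snd_continuous].
- exact: lift_tail_continuous.
- by move=> st /= H; rewrite /lift_hom H.
- exact: lift_hom_tail.
Qed.

Lemma lift_hom0 t : lift_hom (0, t) = realize_map inc (lift_ret t).
Proof.
have H := depth_le1 i t; rewrite lift_hom_tail /=; last by lra.
by rewrite /lift_tail /= mul0r def_hom0.
Qed.

Lemma lift_hom1 s t : 1 <= s -> lift_hom (s, t) = rpt tau t.
Proof.
move=> s1; have := depth_ge0 i t => H; rewrite /lift_hom /= ifT; last by lra.
by rewrite flow_fix // /amount (max_idPl _) ?(min_idPr _) //; lra.
Qed.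

Definition lift : deformation m.+1 :=
  Deformation lift_ret_continuous lift_hom_continuous lift_hom0 lift_hom1.

(** On the horn the depth vanishes, so the flow is stationary and time is not rescaled. Homotopies
    being indexed by all of R, they must also agree after time 1, whence the form of [def_hom1]. *)
Lemma lift_act k (theta : dhom k m.+1) (H : in_horn i theta) :
  deformation_act theta lift = phi H.
Proof.
have [j ji Hj] := H.
have t0 t : val (simplex_map theta t) ord0 j = 0 :> R.
  by rewrite simplex_mapE big1 // => a /eqP E; have := Hj a; rewrite E eqxx.
have d0 t : depth i (simplex_map theta t) = 0 :> R.
  by apply/eqP; rewrite eq_le depth_ge0 andbT -(t0 t) depth_le.
have fl c t : flow i c (simplex_map theta t) = simplex_map theta t :> @simplex R _.
  by apply: flow_fix; rewrite /amount d0 (min_idPl _) // le_max lexx.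
rewrite -(face_act H ji Hj); apply: deformation_eq => [|t|[s t]] /=.
- by rewrite !phi_cell -sact_comp -(phi_cell H) -(face_act H ji Hj) /= phi_cell -sact_comp.
- by rewrite (lift_retE ji) ?fl // t0 d0.
- have [s1|s1] := leP 1 s.
    rewrite lift_hom1 // def_hom1 // phi_cell rpt_glue.
    by rewrite collapse_fix_point.
  rewrite lift_hom_tail /=; last by rewrite d0; lra.
  rewrite (@lift_tailE (s, simplex_map theta t) j ji) /= ?fl ?t0 ?d0 //.
  by rewrite mul0r subr0 divr1.
Qed.

End HornLift.

Definition constant_deformation m (x : M m) (a : A m) (E : inc m a = x) : deformation m.
Proof.
refine (@Deformation m x (fun t => rpt a t) (fun st => rpt x st.2) _ _ _ _).
- exact: rpt_continuous.
- exact: (comp_continuous (@snd_continuous _ _) (@rpt_continuous _ _ _ x)).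
- by move=> t; rewrite realize_map_rpt E.
- by [].
Defined.

(** The constant deformations over [P] extend, by [anodyne_section], to deformations of all cells
    compatible with the simplicial operators; these glue to a retraction and a homotopy on the
    realization. *)
Lemma deformation_section (P : forall m, M m -> Prop) (an : anodyne P)
    (pre : forall m (x : M m), P m x -> A m) :
  (forall k l (f : dhom k l) x, P l x -> P k (sact M f x)) ->
  (forall m (x : M m) Px, inc m (@pre m x Px) = x) ->
  (forall k l (f : dhom k l) (x : M l) Px Px', @pre k (sact M f x) Px' = sact A f (@pre l x Px)) ->
  (forall m (x : A m), P m (inc m x)) ->
  (forall m (x : A m) Px, pre m (inc m x) Px = x) ->
  exists (r : geo M -> geo A) (H : R * geo M -> geo M),
  [/\ continuous r, continuous H, forall z, r (realize_map inc z) = z,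
      forall z, H (0, z) = realize_map inc (r z) & forall z, H (1, z) = z].
Proof.
move=> P_act incK pre_act P_inc preK.
pose base m (x : M m) (Px : P m x) := constant_deformation (incK m x Px).
have base_act k l (f : dhom k l) (x : M l) Px Px' :
    base k (sact M f x) Px' = deformation_act f (base l x Px).
  apply: deformation_eq => //= [t|st]; last exact: rpt_glue.
  by rewrite (pre_act _ _ _ _ Px) rpt_glue.
have [||s [s_cell s_act s_base]] := @anodyne_section M P an P_act deformations
  deformation_cell base (fun _ _ _ => erefl).
- exact: base_act.
- move=> m tau i phi phi_cell phi_act.
  exists (lift phi_cell phi_act) => // k theta H; exact: lift_act.
pose r : geo M -> geo A := glue_map (fun k (x : M k) t => def_ret (s k x) t).
pose H (sz : R * geo M) : geo M :=
  glue_map (fun k (x : M k) t => def_hom (s k x) (sz.1, t)) sz.2.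
have rE k (x : M k) t : r (rpt x t) = def_ret (s k x) t.
  by apply: glue_map_rpt => k' l f y u; rewrite s_act.
have HE u k (x : M k) t : H (u, rpt x t) = def_hom (s k x) (u, t).
  rewrite /H /=; apply: (glue_map_rpt (phi := fun k (x : M k) t => def_hom (s k x) (u, t))).
  by move=> k' l f y v; rewrite s_act.
have cell_s k (x : M k) : def_cell (s k x) = x by exact: s_cell.
exists r, H; split.
- apply: realization_continuous => k x; rewrite (_ : _ \o _ = def_ret (s k x)).
    exact: def_ret_cont.
  by apply: funext => t; exact: rE.
- apply: realization_homotopy_continuous => k x.
  rewrite (_ : (fun st => _) = def_hom (s k x)); first exact: def_hom_cont.
  by apply: funext => -[u t]; exact: HE.
- move=> z; have [k [x [t ->]]] := rpt_surj z.
  by rewrite realize_map_rpt rE (s_base _ _ (P_inc k x)) /= preK.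
- move=> z; have [k [x [t ->]]] := rpt_surj z.
  by rewrite HE def_hom0 rE.
- move=> z; have [k [x [t ->]]] := rpt_surj z.
  by rewrite HE def_hom1 // cell_s.
Qed.

End Deformation.

(** * Homotopy equivalences are weak equivalences *)

Lemma within_comp (S T U : topologicalType) (K : set T) (f : T -> U) (g : S -> T) :
  {within K, continuous f} -> continuous g -> (forall x, K (g x)) -> continuous (f \o g).
Proof.
move=> /subspace_continuousP cf cg Kg x A /(cf _ (Kg x)) H.
have := cg x _ H; rewrite /= !nbhs_simpl /=.
by apply: filterS => y; apply.
Qed.

Section Time.
Variables (R : realType) (T A : topologicalType).

Lemma time_continuous (p q : R) : continuous (fun st : R * T => (p * st.1 + q, st.2)).
Proof.
apply: pair_continuous; last exact: snd_continuous.
apply: add_continuous; last exact: cst_continuous'.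
by apply: mul_continuous; [exact: cst_continuous' | exact: fst_continuous].
Qed.

Lemma paste_time (c : R) (f g h : R * T -> A) : continuous g -> continuous h ->
  (forall t, g (c, t) = h (c, t)) ->
  (forall st, f st = if st.1 <= c then g st else h st) -> continuous f.
Proof.
move=> cg ch gh fE.
have cl : closed [set st : R * T | st.1 <= c].
  by apply: le_closed; [exact: fst_continuous | exact: cst_continuous'].
have cr : closed [set st : R * T | c <= st.1].
  by apply: le_closed; [exact: cst_continuous' | exact: fst_continuous].
apply: (paste2_continuous cl cr _ cg ch).
- by move=> st /=; apply/orP; exact: le_total.
- by move=> st /= H; rewrite fE H.
- move=> [s t] /= H; rewrite fE /=; case: ifP => // H'.
  by have -> : s = c; [apply/eqP; rewrite eq_le H H' | exact: gh].
Qed.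

End Time.

(** * Spheres and relative homotopies on the cube *)

Section Cube.
Variable R : realType.

Section Clamp.
Variables (T : topologicalType).

(** The retraction of R onto [0, 1]. Composing with it turns maps continuous within the cube into
    maps continuous everywhere, as in [sphere_clamp] and [sphere_rel]. *)
Definition clamp01 (s : R) : R := Num.max 0 (Num.min 1 s).

Lemma clamp01_ge0 s : 0 <= clamp01 s.
Proof. by rewrite le_max lexx. Qed.

Lemma clamp01_le1 s : clamp01 s <= 1.
Proof. by rewrite ge_max ler01 ge_min lexx. Qed.

Lemma clamp01_id s : 0 <= s -> s <= 1 -> clamp01 s = s.
Proof. by move=> s0 s1; rewrite /clamp01 (min_idPr _) // (max_idPr _). Qed.

Lemma clamp01_eq0 s : s <= 0 -> clamp01 s = 0.
Proof. by move=> s0; rewrite /clamp01 (max_idPl _) // ge_min s0 orbT. Qed.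

Lemma clamp01_eq1 s : 1 <= s -> clamp01 s = 1.
Proof. by move=> s1; rewrite /clamp01 (min_idPl _) // (max_idPr _). Qed.

Lemma clamp01_continuous (f : T -> R) : continuous f -> continuous (fun x => clamp01 (f x)).
Proof.
move=> cf; apply: max_continuous; first exact: cst_continuous'.
by apply: min_continuous => //; exact: cst_continuous'.
Qed.

End Clamp.

Variable n : nat.
Implicit Types t : 'rV[R]_n.

Definition clamp_cube t : 'rV[R]_n := \row_i clamp01 (t ord0 i).

Lemma clamp_cubeE t i : clamp_cube t ord0 i = clamp01 (t ord0 i).
Proof. by rewrite mxE. Qed.

Lemma clamp_cube_in t : cube (clamp_cube t).
Proof. by move=> i; rewrite clamp_cubeE clamp01_ge0 clamp01_le1. Qed.

Lemma clamp_cube_id t : cube t -> clamp_cube t = t.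
Proof.
by move=> Ct; apply/rowP => i; rewrite clamp_cubeE; case/andP: (Ct i); exact: clamp01_id.
Qed.

Lemma coord_cont i : continuous (fun t => t ord0 i).
Proof. exact: coord_continuous. Qed.

Lemma clamp_cube_continuous : continuous clamp_cube.
Proof.
apply: row_continuous => i; under eq_fun do rewrite clamp_cubeE.
by apply: clamp01_continuous; exact: coord_cont.
Qed.

(* Maps the cube of side 1/2 with the same center onto the cube, and the rest
   of the cube into its boundary. *)
Definition zoom t : 'rV[R]_n := \row_i clamp01 (2 * t ord0 i - 1 / 2).

Lemma zoomE t i : zoom t ord0 i = clamp01 (2 * t ord0 i - 1 / 2).
Proof. by rewrite mxE. Qed.

Lemma zoom_in t : cube (zoom t).
Proof. by move=> i; rewrite zoomE clamp01_ge0 clamp01_le1. Qed.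

Lemma zoom_continuous : continuous zoom.
Proof.
apply: row_continuous => i; under eq_fun do rewrite zoomE.
apply: clamp01_continuous; apply: sub_continuous; last exact: cst_continuous'.
by apply: mul_continuous; [exact: cst_continuous' | exact: coord_cont].
Qed.

(* Vanishes on the boundary, and is at least 1 on the cube of side 1/2. *)
Definition collar t : R :=
  \big[Num.min/2]_(i < n) Num.min (4 * t ord0 i) (4 * (1 - t ord0 i)).

Lemma collar_continuous : continuous collar.
Proof.
apply: bigmin_continuous => i; apply: min_continuous; apply: mul_continuous;
  try exact: cst_continuous'; first exact: coord_cont.
by apply: sub_continuous; [exact: cst_continuous' | exact: coord_cont].
Qed.

Lemma collar_boundary t : cube_boundary t -> collar t = 0.
Proof.
case=> Ct [i ti]; apply/eqP; rewrite eq_le; apply/andP; split.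
  apply/bigmin_leP; right; exists i => //.
  by rewrite ge_min; case: ti => ->; apply/orP; [left | right]; lra.
apply: le_bigmin; first by lra.
by move=> j _; have /andP [t0 t1] := Ct j; rewrite le_min; apply/andP; split; lra.
Qed.

Lemma collar_zoom t : collar t <= 1 -> cube_boundary (zoom t).
Proof.
(* The default value 2 of the minimum exceeds 1: in dimension 0 the collar is empty, like the
   boundary. *)
move=> /bigmin_leP [|[i _]]; first by lra.
rewrite ge_min => ti; split; first exact: zoom_in.
exists i; rewrite zoomE; case/orP: ti => ti; [left; apply: clamp01_eq0 | right; apply: clamp01_eq1]; lra.
Qed.

Section Homotopy.
Variable A : topologicalType.
Implicit Types (a : A) (u v w : 'rV[R]_n -> A).

Definition sphere a u := continuous u /\ forall t, cube_boundary t -> u t = a.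

Definition rel_homotopic a u v := exists H : R * 'rV[R]_n -> A,
  [/\ continuous H, forall t, cube t -> H (0, t) = u t,
      forall t, cube t -> H (1, t) = v t &
      forall s t, cube_boundary t -> H (s, t) = a].

Lemma sphere_clamp a u : is_sphere a u -> sphere a (u \o clamp_cube).
Proof.
case=> cu bu; split.
  by apply: (within_comp cu clamp_cube_continuous); exact: clamp_cube_in.
by move=> t bt; rewrite /= clamp_cube_id ?bu //; case: bt.
Qed.

Lemma sphere_is a u : sphere a u -> is_sphere a u.
Proof. by case=> cu bu; split=> //; exact: continuous_subspaceT. Qed.

Lemma rel_eq a u v u' v' : (forall t, cube t -> u t = u' t) ->
  (forall t, cube t -> v t = v' t) -> rel_homotopic a u v -> rel_homotopic a u' v'.
Proof.
move=> uE vE [H [cH H0 H1 Hb]]; exists H; split=> // t Ct.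
  by rewrite H0 ?uE.
by rewrite H1 ?vE.
Qed.

Lemma rel_sphere a u v : rel_homotopic a u v -> sphere_homotopic a u v.
Proof.
case=> H [cH H0 H1 Hb]; exists H; split=> //; first exact: continuous_subspaceT.
by move=> s t _; exact: Hb.
Qed.

Lemma sphere_rel a u v : sphere_homotopic a u v -> rel_homotopic a u v.
Proof.
case=> H [cH H0 H1 Hb].
have c01 s : `[0, 1] (clamp01 s) by rewrite /= in_itv /= clamp01_ge0 clamp01_le1.
exists (H \o fun st => (clamp01 st.1, clamp_cube st.2)); split.
- apply: (within_comp cH) => [|st]; last by split; [exact: c01 | exact: clamp_cube_in].
  apply: pair_continuous; first by apply: clamp01_continuous; exact: fst_continuous.
  exact: (comp_continuous (@snd_continuous _ _) clamp_cube_continuous).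
- by move=> t Ct; rewrite /= clamp_cube_id // clamp01_eq0 // H0.
- by move=> t Ct; rewrite /= clamp_cube_id // clamp01_eq1 // H1.
- move=> s t bt; have [Ct _] := bt; rewrite /= clamp_cube_id // Hb //.
  by apply/mem_set.
Qed.

Lemma rel_sym a u v : rel_homotopic a u v -> rel_homotopic a v u.
Proof.
case=> H [cH H0 H1 Hb]; exists (fun st : R * 'rV[R]_n => H (-1 * st.1 + 1, st.2)); split.
- exact: (comp_continuous (@time_continuous R _ (-1) 1) cH).
- by move=> t Ct /=; rewrite mulr0 add0r H1.
- by move=> t Ct /=; rewrite mulr1 addNr H0.
- by move=> s t bt /=; exact: Hb.
Qed.

Lemma rel_trans a u v w : rel_homotopic a u v -> rel_homotopic a v w -> rel_homotopic a u w.
Proof.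
case=> H [cH H0 H1 Hb] [K [cK K0 K1 Kb]].
pose c2 (st : R * 'rV[R]_n) := (st.1, clamp_cube st.2).
have cc2 : continuous c2.
  apply: pair_continuous; first exact: fst_continuous.
  exact: (comp_continuous (@snd_continuous _ _) clamp_cube_continuous).
pose HH (st : R * 'rV[R]_n) := H (c2 (2 * st.1 + 0, st.2)).
pose KK (st : R * 'rV[R]_n) := K (c2 (2 * st.1 + -1, st.2)).
exists (fun st : R * 'rV[R]_n => if st.1 <= 1 / 2 then HH st else KK st); split.
- apply: (@paste_time R _ _ (1 / 2) _ HH KK) => //.
  + exact: (comp_continuous (@time_continuous R _ 2 0) (comp_continuous cc2 cH)).
  + exact: (comp_continuous (@time_continuous R _ 2 (-1)) (comp_continuous cc2 cK)).
  + move=> t; rewrite /HH /KK /c2 /=.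
    have -> : 2 * (1 / 2) + 0 = 1 :> R by lra.
    have -> : 2 * (1 / 2) + -1 = 0 :> R by lra.
    by have Ct := @clamp_cube_in t; rewrite H1 // K0.
- move=> t Ct /=; rewrite ifT; last by lra.
  by rewrite /HH /c2 /= clamp_cube_id // mulr0 addr0 H0.
- move=> t Ct /=; rewrite ifF; last by apply/negbTE; rewrite -ltNge; lra.
  rewrite /KK /c2 /= clamp_cube_id // (_ : 2 * 1 + -1 = 1) ?K1 //; lra.
- move=> s t bt /=; have [Ct _] := bt.
  by case: ifP => _; rewrite /HH /KK /c2 /= clamp_cube_id // (Hb, Kb).
Qed.

(** The straight-line homotopy from the identity to [zoom]. Coordinates equal to 0 or 1 are kept by
    [zoom], so the boundary stays in the boundary. *)
Lemma zoom_homotopic a u : sphere a u -> rel_homotopic a u (u \o zoom).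
Proof.
case=> cu bu.
exists (fun st : R * 'rV[R]_n =>
  u (clamp_cube (\row_i ((1 - st.1) * st.2 ord0 i + st.1 * zoom st.2 ord0 i)))).
split.
- have c2 (f : 'rV[R]_n -> R) : continuous f -> continuous (fun st : R * 'rV[R]_n => f st.2).
    by move=> cf; exact: (comp_continuous (@snd_continuous _ _) cf).
  refine (comp_continuous _ (comp_continuous clamp_cube_continuous cu)).
  apply: row_continuous => i; under eq_fun do rewrite mxE.
  apply: add_continuous; apply: mul_continuous.
  + by apply: sub_continuous; [exact: cst_continuous' | exact: fst_continuous].
  + by apply: (c2 (fun t => t ord0 i)); exact: coord_cont.
  + exact: fst_continuous.
  + apply: (c2 (fun t => zoom t ord0 i)).
    exact: (comp_continuous zoom_continuous (@coord_cont i)).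
- move=> t Ct /=; congr u; rewrite -[RHS]clamp_cube_id //; congr clamp_cube.
  by apply/rowP => i; rewrite !mxE subr0 mul1r mul0r addr0.
- move=> t Ct /=; congr u; rewrite -[RHS](clamp_cube_id (zoom_in t)); congr clamp_cube.
  by apply/rowP => i; rewrite !mxE subrr mul1r mul0r add0r.
- move=> s t [Ct [i ti]] /=; apply: bu; split; first exact: clamp_cube_in.
  exists i; rewrite clamp_cubeE mxE zoomE; case: ti => ->; [left | right].
    by rewrite (@clamp01_eq0 (_ - _)) ?clamp01_eq0 //; lra.
  by rewrite (@clamp01_eq1 (_ - _)) ?clamp01_eq1 //; lra.
Qed.

(* A free homotopy F whose trace on the boundary is a loop contracted by G:
   the contraction is inserted in the collar. *)
Lemma free_homotopy a (F : R * 'rV[R]_n -> A) (G : R * R -> A) :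
  continuous F -> continuous G ->
  (forall s t, cube_boundary t -> F (s, t) = G (s, 1)) ->
  (forall s, G (s, 0) = a) -> (forall r, G (0, r) = a) -> (forall r, G (1, r) = a) ->
  rel_homotopic a (fun t => F (0, t)) (fun t => F (1, t)).
Proof.
move=> cF cG FG G0 Ga Gb.
have slice s : continuous (fun t => F (s, t)).
  apply: (comp_continuous (f := fun t : 'rV[R]_n => (s, t))) => //.
  by apply: pair_continuous; [exact: cst_continuous' | exact: id_continuous].
have sph0 : sphere a (fun t => F (0, t)) by split=> [|t bt]; [exact: slice | rewrite FG].
have sph1 : sphere a (fun t => F (1, t)) by split=> [|t bt]; [exact: slice | rewrite FG].
apply: rel_trans (zoom_homotopic sph0) _.
apply: rel_trans _ (rel_sym (zoom_homotopic sph1)).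
have c2 (S : topologicalType) (f : 'rV[R]_n -> S) :
    continuous f -> continuous (fun st : R * 'rV[R]_n => f st.2).
  by move=> cf; exact: (comp_continuous (@snd_continuous _ _) cf).
pose C (st : R * 'rV[R]_n) :=
  if 1 <= collar st.2 then F (st.1, zoom st.2) else G (st.1, collar st.2).
have lt1 t : (1 <= collar t) = false -> collar t <= 1.
  by move=> /negbT; rewrite -ltNge => /ltW.
exists C; split.
- apply: (@paste2_continuous _ _ [set st | 1 <= collar st.2] [set st | collar st.2 <= 1] C
    (fun st => F (st.1, zoom st.2)) (fun st => G (st.1, collar st.2))).
  + by apply: le_closed; [exact: cst_continuous' | apply: c2; exact: collar_continuous].
  + by apply: le_closed; [apply: c2; exact: collar_continuous | exact: cst_continuous'].
  + by move=> st /=; apply/orP; exact: le_total.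
  + apply: (comp_continuous _ cF); apply: pair_continuous; first exact: fst_continuous.
    by apply: c2; exact: zoom_continuous.
  + apply: (comp_continuous _ cG); apply: pair_continuous; first exact: fst_continuous.
    by apply: c2; exact: collar_continuous.
  + by move=> st /= H; rewrite /C H.
  + move=> st /= H; rewrite /C; case: ifP => // H'.
    rewrite FG; last exact: collar_zoom.
    by congr (G (_, _)); apply/eqP; rewrite eq_le H H'.
- move=> t Ct; rewrite /C /=; case: ifP => // /lt1 H.
  by rewrite FG ?Ga //; exact: collar_zoom.
- move=> t Ct; rewrite /C /=; case: ifP => // /lt1 H.
  by rewrite FG ?Gb //; exact: collar_zoom.
- move=> s t bt; rewrite /C /= collar_boundary // ler10.
  exact: G0.
Qed.

End Homotopy.

Lemma rel_comp (A B : topologicalType) (f : A -> B) a (u v : 'rV[R]_n -> A) :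
  continuous f -> rel_homotopic a u v -> rel_homotopic (f a) (f \o u) (f \o v).
Proof.
move=> cf [H [cH H0 H1 Hb]]; exists (f \o H); split.
- exact: comp_continuous.
- by move=> t Ct /=; rewrite H0.
- by move=> t Ct /=; rewrite H1.
- by move=> s t bt /=; rewrite (Hb s t bt).
Qed.

Lemma sphere_comp (A B : topologicalType) (f : A -> B) a (u : 'rV[R]_n -> A) :
  continuous f -> sphere a u -> sphere (f a) (f \o u).
Proof.
move=> cf [cu bu]; split; first exact: comp_continuous.
by move=> t bt /=; rewrite bu.
Qed.

(** * A map homotopic to the identity is bijective on homotopy classes of spheres *)

Section Deformation.
Variables (A : topologicalType) (h : A -> A) (K : R * A -> A).
Hypothesis cK : continuous K.
Hypothesis K0 : forall x, K (0, x) = h x.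
Hypothesis K1 : forall x, K (1, x) = x.

Lemma K_continuous (T : topologicalType) (f : T -> R) (g : T -> A) :
  continuous f -> continuous g -> continuous (fun x => K (f x, g x)).
Proof. by move=> cf cg; exact: (comp_continuous (pair_continuous cf cg) cK). Qed.

(** Running [K] backwards on [u], then [H], then [K] on [v], one third of the time each, gives a
    free homotopy. Its boundary follows the path of [a] to [h a], waits, and comes back, a loop that
    [free_homotopy] contracts. *)
Lemma deformation_inj a (u v : 'rV[R]_n -> A) : sphere a u -> sphere a v ->
  rel_homotopic (h a) (h \o u) (h \o v) -> rel_homotopic a u v.
Proof.
move=> [cu bu] [cv bv] [H [cH H0 H1 Hb]].
have csnd (T : topologicalType) (f : 'rV[R]_n -> T) :
    continuous f -> continuous (fun st : R * 'rV[R]_n => f (clamp_cube st.2)).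
  move=> cf.
  exact: (comp_continuous (@snd_continuous _ _) (comp_continuous clamp_cube_continuous cf)).
have affine (p q : R) : continuous (fun st : R * 'rV[R]_n => p * st.1 + q).
  apply: add_continuous; last exact: cst_continuous'.
  by apply: mul_continuous; [exact: cst_continuous' | exact: fst_continuous].
pose F1 (st : R * 'rV[R]_n) := K (-3 * st.1 + 1, u (clamp_cube st.2)).
pose F2 (st : R * 'rV[R]_n) := H (3 * st.1 + -1, clamp_cube st.2).
pose F3 (st : R * 'rV[R]_n) := K (3 * st.1 + -2, v (clamp_cube st.2)).
pose F23 st := if st.1 <= 2 / 3 then F2 st else F3 st.
pose F st := if st.1 <= 1 / 3 then F1 st else F23 st.
have cF2 : continuous F2.
  apply: (comp_continuous (f := fun st : R * 'rV[R]_n => (3 * st.1 + -1, clamp_cube st.2))) => //.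
  by apply: pair_continuous; [exact: affine | exact: (csnd _ id (@id_continuous _))].
have cF23 : continuous F23.
  apply: (@paste_time R _ _ (2 / 3) _ F2 F3) => //.
    by apply: K_continuous; [exact: affine | exact: csnd].
  move=> t; rewrite /F2 /F3 /=.
  have -> : 3 * (2 / 3) + -1 = 1 :> R by lra.
  have -> : 3 * (2 / 3) + -2 = 0 :> R by lra.
  by rewrite K0 H1 //; exact: clamp_cube_in.
have cF : continuous F.
  apply: (@paste_time R _ _ (1 / 3) _ F1 F23) => //.
    by apply: K_continuous; [exact: affine | exact: csnd].
  move=> t; rewrite /F1 /F23 /= ifT; last by lra.
  rewrite /F2 /=.
  have -> : -3 * (1 / 3) + 1 = 0 :> R by lra.
  have -> : 3 * (1 / 3) + -1 = 0 :> R by lra.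
  by rewrite K0 H0 //; exact: clamp_cube_in.
(* The parameter on the path of [a] at time [s]: from 1 to 0, constant, then back to 1. The map [G]
   pushes it towards 1, where [K] is at [a]. *)
pose mu (s : R) : R := Num.max (-3 * s + 1) (Num.max 0 (3 * s + -2)).
pose G (sr : R * R) := K (1 - sr.2 * (1 - mu sr.1), a).
have cmu : continuous (fun sr : R * R => mu sr.1).
  have lin (p q : R) : continuous (fun sr : R * R => p * sr.1 + q).
    apply: add_continuous; last exact: cst_continuous'.
    by apply: mul_continuous; [exact: cst_continuous' | exact: fst_continuous].
  apply: max_continuous; first exact: lin.
  by apply: max_continuous; [exact: cst_continuous' | exact: lin].
have cG : continuous G.
  apply: K_continuous; last exact: cst_continuous'.
  apply: sub_continuous; first exact: cst_continuous'.
  apply: mul_continuous; first exact: snd_continuous.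
  by apply: sub_continuous; [exact: cst_continuous' |].
apply: (rel_eq _ _ (free_homotopy cF cG _ _ _ _)).
- move=> t Ct; rewrite /F /= ifT; last by lra.
  by rewrite /F1 /= mulr0 add0r K1 clamp_cube_id.
- move=> t Ct; rewrite /F /F23 /= !ifF; try by (apply/negbTE; rewrite -ltNge; lra).
  by rewrite /F3 /= (_ : 3 * 1 + -2 = 1 :> R) ?K1 ?clamp_cube_id //; lra.
- move=> s t bt; have [Ct _] := bt.
  rewrite /F /F23 /F1 /F2 /F3 /G /= !mul1r subKr clamp_cube_id // bu // bv // Hb // -K0.
  have [s1|s1] := leP s 3^-1.
    by congr K; congr pair; rewrite /mu (max_idPl _) // ge_max; apply/andP; split; lra.
  have [s2|s2] := leP s (2 / 3).
    congr K; congr pair; rewrite /mu (max_idPr _); last by rewrite le_max; apply/orP; left; lra.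
    by rewrite (max_idPl _) //; lra.
  congr K; congr pair; rewrite /mu (max_idPr _); last by rewrite le_max; apply/orP; left; lra.
  by rewrite (max_idPr _) //; lra.
- by move=> s; rewrite /G /= mul0r subr0 K1.
- move=> r; rewrite /G /= (_ : mu 0 = 1) ?subrr ?mulr0 ?subr0 ?K1 //.
  by rewrite /mu !mulr0 !add0r (max_idPl _) // ge_max; apply/andP; split; lra.
- move=> r; rewrite /G /= (_ : mu 1 = 1) ?subrr ?mulr0 ?subr0 ?K1 //.
  rewrite /mu (max_idPr _); last by rewrite le_max; apply/orP; left; lra.
  by rewrite (max_idPr _); lra.
Qed.

(** The sphere [u] is [w] on the inner cube, joined in the collar to the base point [a] by the path
    of [a]. The homotopy [U] shrinks this path while [w] stays fixed on the inner cube. *)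
Lemma deformation_surj a (w : 'rV[R]_n -> A) : sphere (h a) w ->
  exists2 u, sphere a u & rel_homotopic (h a) (h \o u) w.
Proof.
move=> sw; have [cw bw] := sw.
pose U (st : R * 'rV[R]_n) :=
  if 1 <= collar st.2 then w (zoom st.2) else K ((1 - collar st.2) * (1 - st.1), a).
have c2 (S : topologicalType) (f : 'rV[R]_n -> S) :
    continuous f -> continuous (fun st : R * 'rV[R]_n => f st.2).
  by move=> cf; exact: (comp_continuous (@snd_continuous _ _) cf).
have cU : continuous U.
  apply: (@paste2_continuous _ _ [set st | 1 <= collar st.2] [set st | collar st.2 <= 1] U
    (fun st => w (zoom st.2)) (fun st => K ((1 - collar st.2) * (1 - st.1), a))).
  + by apply: le_closed; [exact: cst_continuous' | apply: c2; exact: collar_continuous].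
  + by apply: le_closed; [apply: c2; exact: collar_continuous | exact: cst_continuous'].
  + by move=> st /=; apply/orP; exact: le_total.
  + by apply: (c2 _ (w \o zoom)); apply: comp_continuous => //; exact: zoom_continuous.
  + apply: K_continuous; last exact: cst_continuous'.
    apply: mul_continuous.
      by apply: sub_continuous; [exact: cst_continuous' | apply: c2; exact: collar_continuous].
    by apply: sub_continuous; [exact: cst_continuous' | exact: fst_continuous].
  + by move=> st /= H; rewrite /U H.
  + move=> st /= H; rewrite /U; case: ifP => // H'.
    rewrite bw; last exact: collar_zoom.
    have -> : collar st.2 = 1 by apply/eqP; rewrite eq_le H H'.
    by rewrite subrr mul0r K0.
pose u t := U (0, t).
have cu : continuous u.
  apply: (comp_continuous (f := fun t : 'rV[R]_n => (0 : R, t))) => //.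
  by apply: pair_continuous; [exact: cst_continuous' | exact: id_continuous].
have Ub s t : cube_boundary t -> U (s, t) = K (1 - s, a).
  by move=> bt; rewrite /U /= collar_boundary // ler10 subr0 mul1r.
have bu t : cube_boundary t -> u t = a by move=> bt; rewrite /u Ub // subr0 K1.
exists u => //.
pose F1 (st : R * 'rV[R]_n) := K (2 * st.1 + 0, u st.2).
pose F2 (st : R * 'rV[R]_n) := U (2 * st.1 + -1, st.2).
pose F st := if st.1 <= 1 / 2 then F1 st else F2 st.
have cF : continuous F.
  apply: (@paste_time R _ _ (1 / 2) _ F1 F2) => //.
  - apply: K_continuous; last exact: c2.
    apply: add_continuous; last exact: cst_continuous'.
    by apply: mul_continuous; [exact: cst_continuous' | exact: fst_continuous].
  - exact: (comp_continuous (@time_continuous R _ 2 (-1)) cU).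
  - move=> t; rewrite /F1 /F2 /=.
    have -> : 2 * (1 / 2) + 0 = 1 :> R by lra.
    have -> : 2 * (1 / 2) + -1 = 0 :> R by lra.
    by rewrite K1.
(* On the boundary [F] follows the path from [h a] to [a] and returns; [G] shortens this loop to the
   base point [h a]. *)
pose G (sr : R * R) := K (sr.2 * Num.min (2 * sr.1) (2 - 2 * sr.1), a).
have cG : continuous G.
  apply: K_continuous; last exact: cst_continuous'.
  apply: mul_continuous; first exact: snd_continuous.
  have c2s : continuous (fun sr : R * R => 2 * sr.1).
    by apply: mul_continuous; [exact: cst_continuous' | exact: fst_continuous].
  apply: min_continuous => //.
  by apply: sub_continuous; [exact: cst_continuous' |].
have Fw : rel_homotopic (h a) (h \o u) (w \o zoom).
  apply: (rel_eq _ _ (free_homotopy cF cG _ _ _ _)).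
  - move=> t Ct; rewrite /F /= ifT; last by lra.
    by rewrite /F1 /= mulr0 add0r K0.
  - move=> t Ct; rewrite /F /= ifF; last by apply/negbTE; rewrite -ltNge; lra.
    rewrite /F2 /= (_ : 2 * 1 + -1 = 1 :> R); last by lra.
    rewrite /U /=; case: ifP => // /negbT; rewrite -ltNge => /ltW H.
    by rewrite subrr mulr0 K0 bw //; exact: collar_zoom.
  - move=> s t bt; rewrite /F /F1 /F2 /G /= bu // Ub // !mul1r.
    have [s1|s1] := leP s 2^-1.
      by rewrite addr0 (min_idPl _) //; lra.
    by congr K; congr pair; rewrite (min_idPr _); lra.
  - by move=> s; rewrite /G /= mul0r K0.
  - by move=> r; rewrite /G /= mulr0 subr0 (min_idPl _) ?mulr0 ?K0.
  - by move=> r; rewrite /G /= mulr1 subrr (min_idPr _) ?mulr0 ?K0.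
exact: rel_trans Fw (rel_sym (zoom_homotopic sw)).
Qed.

End Deformation.
End Cube.

Definition homotopic (R : realType) (A B : topologicalType) (f g : A -> B) : Prop :=
  exists K : R * A -> B, [/\ continuous K, forall x, K (0, x) = f x & forall x, K (1, x) = g x].

(** Injectivity for [g \o f] gives it for [f]. For surjectivity, [deformation_surj] for [g \o f]
    gives [u] such that g f u and g v are homotopic; applying [f], injectivity for [f \o g] at the
    base point f a gives that f u and v are homotopic. *)
Lemma homotopy_equiv_weak (R : realType) (A B : topologicalType) (f : A -> B) (g : B -> A) :
  continuous f -> continuous g -> homotopic R (g \o f) id -> homotopic R (f \o g) id ->
  weak_homotopy_equiv R f.
Proof.
move=> cf cg [K [cK K0 K1]] [L [cL L0 L1]]; split=> //.
- by move=> b; exists; exact: g b.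
- move=> n a u v su sv /sphere_rel Huv.
  have su' := sphere_clamp su; have sv' := sphere_clamp sv.
  apply: rel_sphere; apply: (@rel_eq _ _ _ _ (u \o @clamp_cube R n) (v \o @clamp_cube R n)).
  + by move=> t Ct; rewrite /= clamp_cube_id.
  + by move=> t Ct; rewrite /= clamp_cube_id.
  apply: (deformation_inj cK K0 K1 su' sv').
  apply: rel_eq (rel_comp cg Huv) => t Ct; by rewrite /= clamp_cube_id.
- move=> n a v sv; have sv' := sphere_clamp sv.
  have [u su Hu] := deformation_surj cK K0 K1 (sphere_comp cg sv').
  exists u; first exact: sphere_is.
  apply: rel_sphere; apply: (@rel_eq _ _ _ _ (f \o u) (v \o @clamp_cube R n)) => //.
    by move=> t Ct; rewrite /= clamp_cube_id.
  apply: (deformation_inj cL L0 L1 (sphere_comp cf su) sv').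
  exact: (rel_comp cf Hu).
Qed.

(** * The theorem *)

Section Retracts.
Variables (R : realType) (n : nat) (Y : msset n).
Local Notation geo X := (realization R X).

Lemma base_retract :
  exists (r : geo (collage Y) -> geo (diag Y)) (H : R * geo (collage Y) -> geo (collage Y)),
  [/\ continuous r, continuous H, forall z, r (realize_map (collage_simplex Y) z) = z,
      forall z, H (0, z) = realize_map (collage_simplex Y) (r z) & forall z, H (1, z) = z].
Proof.
apply: (@deformation_section R _ _ _ (@in_base n Y) (@top_anodyne n Y)
  (fun m x _ => collage_ret Y m x)).
- exact: in_base_act.
- by move=> m x [y ->].
- by move=> k l f x [y ->] _.
- by move=> m y; exists y.
- by [].
Qed.

Lemma nerve_retract (j0 : 'I_n) :
  exists (r : geo (collage Y) -> geo (diag (nerve (groth Y))))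
         (H : R * geo (collage Y) -> geo (collage Y)),
  [/\ continuous r, continuous H, forall z, r (realize_map (collage_nerve Y) z) = z,
      forall z, H (0, z) = realize_map (collage_nerve Y) (r z) & forall z, H (1, z) = z].
Proof.
have ex m (x : collage Y m) : all_ob x -> exists F, collage_nerve Y m F = x.
  by case=> c [-> oc]; have [F <-] := nerve_chain_ob oc; exists F.
have inj m (F G : diag (nerve (groth Y)) m) : collage_nerve Y m F = collage_nerve Y m G -> F = G.
  by move=> /(@inr_inj _ _ _ _); exact: nerve_chain_inj.
pose pre m (x : collage Y m) (Px : all_ob x) := projT1 (cid (ex m x Px)).
have preE m (x : collage Y m) Px : collage_nerve Y m (@pre m x Px) = x by rewrite /pre; case: cid.
apply: (@deformation_section R _ _ (collage_nerve Y) (@all_ob n Y) (@quot_anodyne n Y j0) pre).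
- exact: all_ob_act.
- exact: preE.
- by move=> k l f x Px Px'; apply: inj; rewrite preE snat preE.
- by move=> m F; exists (nerve_chain F).
- by move=> m F Px; apply: inj; rewrite preE.
Qed.

Lemma realize_map_comp (X X' X'' : sset) (F : smap X X') (G : smap X' X'') (K : smap X X'') :
  (forall m (x : X m), G m (F m x) = K m x) ->
  forall z : geo X, realize_map G (realize_map F z) = realize_map K z.
Proof.
by move=> E z; have [k [x [t ->]]] := rpt_surj z; rewrite !realize_map_rpt E.
Qed.

Lemma realize_map_retract (X X' : sset) (F : smap X X') (G : smap X' X) :
  (forall m (x : X m), G m (F m x) = x) ->
  forall z : geo X, realize_map G (realize_map F z) = z.
Proof.
by move=> E z; have [k [x [t ->]]] := rpt_surj z; rewrite !realize_map_rpt E.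
Qed.

End Retracts.

Lemma homotopic_trans (R : realType) (A B : topologicalType) (f g h : A -> B) :
  homotopic R f g -> homotopic R g h -> homotopic R f h.
Proof.
case=> H [cH H0 H1] [K [cK K0 K1]].
exists (fun sx : R * A => if sx.1 <= 1 / 2 then H (2 * sx.1 + 0, sx.2) else K (2 * sx.1 + -1, sx.2)).
split.
- apply: (@paste_time R A B (1 / 2) _ (fun sx => H (2 * sx.1 + 0, sx.2))
    (fun sx => K (2 * sx.1 + -1, sx.2))) => //.
  + exact: (comp_continuous (@time_continuous R A 2 0) cH).
  + exact: (comp_continuous (@time_continuous R A 2 (-1)) cK).
  + move=> x /=; have -> : 2 * (1 / 2) + 0 = 1 :> R by lra.
    have -> : 2 * (1 / 2) + -1 = 0 :> R by lra.
    by rewrite H1 K0.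
- by move=> x; rewrite /= ifT ?mulr0 ?addr0 ?H0 //; lra.
- move=> x; rewrite /= ifF; last by apply/negbTE; rewrite -ltNge; lra.
  by rewrite (_ : 2 * 1 + -1 = 1 :> R) ?K1 //; lra.
Qed.

Lemma homotopic_comp (R : realType) (A B C E : topologicalType) (f g : B -> C)
    (u : A -> B) (v : C -> E) : continuous u -> continuous v ->
  homotopic R f g -> homotopic R (v \o f \o u) (v \o g \o u).
Proof.
move=> cu cv [K [cK K0 K1]]; exists (v \o K \o (fun sx => (sx.1, u sx.2))); split.
- apply: comp_continuous; last exact: comp_continuous.
  apply: pair_continuous; first exact: fst_continuous.
  exact: (comp_continuous (@snd_continuous _ _) cu).
- by move=> x /=; rewrite K0.
- by move=> x /=; rewrite K1.
Qed.

Lemma homotopic_eq (R : realType) (A B : topologicalType) (f g f' g' : A -> B) :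
  f =1 f' -> g =1 g' -> homotopic R f g -> homotopic R f' g'.
Proof. by move=> /funext <- /funext <-. Qed.

Lemma homotopic_sym (R : realType) (A B : topologicalType) (f g : A -> B) :
  homotopic R f g -> homotopic R g f.
Proof.
case=> K [cK K0 K1]; exists (fun sx : R * A => K (1 - sx.1, sx.2)); split.
- apply: (comp_continuous (f := fun sx : R * A => (1 - sx.1, sx.2))) => //.
  apply: pair_continuous; last exact: snd_continuous.
  by apply: sub_continuous; [exact: cst_continuous' | exact: fst_continuous].
- by move=> x /=; rewrite subr0.
- by move=> x /=; rewrite subrr.
Qed.

(** Both legs of the cospan are homotopy equivalences, and the given retraction [r] is an inverse of
    [k] up to homotopy; hence [f], which is [r \o i], has inverse [p \o k]. *)
Lemma cospan_weak (R : realType) (X M Z : topologicalType) (i : X -> M) (k : Z -> M)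
    (r : M -> Z) (p : M -> X) (q : M -> Z) (f : X -> Z) :
  continuous i -> continuous k -> continuous r -> continuous p -> continuous q ->
  r \o k =1 id -> r \o i =1 f -> p \o i =1 id -> homotopic R (i \o p) id ->
  homotopic R (k \o q) id -> weak_homotopy_equiv R f.
Proof.
move=> ci ck cr cp cq rk ri pi ip kq.
have kr : homotopic R (k \o r) id.
  (* The homotopy concerns the retraction [q], which need not be [r]. Since r k is the identity,
     composing the homotopy from k q to the identity with k r relates k q to k r. *)
  have H1 : homotopic R (k \o r) (k \o q).
    apply: homotopic_sym.
    apply: (homotopic_eq _ _ (homotopic_comp (@id_continuous _) (comp_continuous cr ck) kq)) => x //=.
    by have /= -> := rk (q x).
  exact: homotopic_trans H1 kq.
have fE : r \o i = f by apply: funext.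
rewrite -fE; apply: (@homotopy_equiv_weak _ _ _ _ (p \o k)).
- exact: comp_continuous.
- exact: comp_continuous.
- apply: (homotopic_eq _ _ (homotopic_comp ci cp kr)) => x //=.
  exact: pi.
- apply: (homotopic_eq _ _ (homotopic_comp ck cr ip)) => x //=.
  exact: rk.
Qed.

Theorem theorem9p22 (R : realType) (n : nat) (hn : (1 <= n)%N)
    (D : nfold_cat n) :
  nerve_map (lambda D) = rho (nerve D) /\ nfold_weq R (lambda D).
Proof.
split; first exact: nerve_map_lambda.
pose Y := nerve D.
have [q [K [cq cK qi K0 K1]]] := base_retract R Y.
have [p [H [cp cH pi H0 H1]]] := nerve_retract R Y (Ordinal hn).
apply: (@cospan_weak R _ (realization R (collage Y)) _ (realize_map (collage_nerve Y))
  (realize_map (collage_simplex Y)) (realize_map (collage_ret Y)) p q) => //.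
- exact: realize_map_continuous.
- exact: realize_map_continuous.
- exact: realize_map_continuous.
- exact: realize_map_retract.
- move=> z /=; apply: realize_map_comp => m F.
  by rewrite collage_ret_nerve nerve_map_lambda.
- by exists H; split.
- by exists K; split.
Qed.
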